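(* (a) Each of the nilpotent real Lie algebras $\mathcal{H}_1(\mathbb{C})$ and $\mathcal{H}_1(\mathbb{R})\times\mathcal{H}_1(\mathbb{R})$ has infinitely many rational Lie algebra structures (up to isomorphism of $\mathbb{Q}$-Lie algebras), corresponding to squarefree integers $d$: for every squarefree integer $d\neq 0$ the $\mathbb{Q}$-Lie algebra $\mathfrak{n}_d$ is a rational structure on $\mathcal{H}_1(\mathbb{C})$ if $d>0$ and on $\mathcal{H}_1(\mathbb{R})\times\mathcal{H}_1(\mathbb{R})$ if $d<0$, and $\mathfrak{n}_d\not\cong\mathfrak{n}_{d'}$ for $d\neq d'$. Consequently, the corresponding simply connected real Lie groups $H_1(\mathbb{C})$ and $H_1(\mathbb{R})\times H_1(\mathbb{R})$ each have infinitely many commensurability classes of lattices. (b) In $H_1(\mathbb{C})$, each commensurability class of lattices contains a lattice isomorphic to $H_1(\mathcal{A})$, where $\mathcal{A}$ is the ring of integers of an imaginary quadratic field $\mathbb{Q}(\sqrt{-d})$, $d>0$ a squarefree integer. In $H_1(\mathbb{R})\times H_1(\mathbb{R})$, every commensurability class of lattices contains either a lattice isomorphic to $H_1(\mathcal{A})$, with $\mathcal{A}$ the ring of integers of a real quadratic field $\mathbb{Q}(\sqrt{-d})$, $d<-1$ a squarefree integer, or a lattice isomorphic to $H_1(\mathbb{Z})\times H_1(\mathbb{Z})$ (case $d=-1$).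
   Context: For a commutative ring $R$, $H_1(R)$ is the Heisenberg group of $3\times 3$ upper unitriangular matrices with entries in $R$, and $\mathcal{H}_1(R)$ is the Heisenberg Lie $R$-algebra, free with basis $f_1,f_2,f_3$ and only nonzero bracket $[f_1,f_2]=f_3$ (up to antisymmetry). $\mathcal{H}_1(\mathbb{C})$ is regarded as a 6-dimensional real Lie algebra and $H_1(\mathbb{C})$ as a 6-dimensional real Lie group. A rational Lie algebra structure on a real Lie algebra $\mathfrak{g}$ is a $\mathbb{Q}$-Lie algebra $A$ with $A\otimes_{\mathbb{Q}}\mathbb{R}\cong\mathfrak{g}$. For a nonzero squarefree integer $d$, $\mathfrak{n}_d$ is the 6-dimensional $\mathbb{Q}$-Lie algebra with basis $e_1,\dots,e_6$ and nonzero brackets (up to antisymmetry) $$[e_1,e_4]=[e_2,e_3]=e_5,\quad [e_1,e_3]=e_6,\quad [e_2,e_4]=-d\,e_6 .$$ A lattice in a simply connected nilpotent Lie group is a discrete cocompact subgroup. Two lattices are called commensurable if they have isomorphic subgroups of finite index; commensurability classes are the classes for this equivalence relation. *)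

(* Defs.v *)
From HB Require Import structures.
From mathcomp Require Import all_boot all_order all_algebra all_field.
From mathcomp Require Import all_classical reals topology normedtype.
From mathcomp Require Import complex ring.

Set Implicit Arguments.
Unset Strict Implicit.
Unset Printing Implicit Defensive.

Import Order.TTheory GRing.Theory Num.Theory.
Import numFieldNormedType.Exports.

Local Open Scope ring_scope.
Local Open Scope classical_set_scope.
Local Open Scope quotient_scope.

Section LinearSum.
Variables (K : comNzRingType) (U V : lmodType K) (f : U -> V).
Hypothesis lin_f : linear f.

Lemma lin_scale a x : f (a *: x) = a *: f x.
Proof.
have f0 : f 0 = 0 by have := lin_f (-1) 0 0; rewrite !scaleN1r oppr0 addr0 addNr.
by have := lin_f a x 0; rewrite f0 !addr0.
Qed.

Lemma lin_sum I r (P : pred I) (F : I -> U) :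
  f (\sum_(i <- r | P i) F i) = \sum_(i <- r | P i) f (F i).
Proof.
elim/big_rec2: _ => [|i u v _ <-]; first by rewrite -(scale0r 0) lin_scale scale0r.
by rewrite -[F i]scale1r lin_f !scale1r.
Qed.

End LinearSum.

HB.mixin Record Lmodule_isLie (K : comNzRingType) L of GRing.Lmodule K L := {
  lieb : L -> L -> L;
  lieb_linearl : forall z, linear (lieb ^~ z);
  lieb_linearr : forall z, linear (lieb z);
  liebxx : forall x, lieb x x = 0;
  jacobi : forall x y z,
    lieb x (lieb y z) + lieb y (lieb z x) + lieb z (lieb x y) = 0
}.

#[short(type="lieAlgType")]
HB.structure Definition LieAlgebra (K : comNzRingType) :=
  {L of Lmodule_isLie K L & GRing.Lmodule K L}.

#[short(type="fdLieAlgType")]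
HB.structure Definition FdLieAlgebra (K : fieldType) :=
  {L of LieAlgebra K L & Vector K L}.

Definition lie_iso (K : comNzRingType) (L M : lieAlgType K) : Prop :=
  exists f : {linear L -> M},
    bijective f /\ forall x y, f (lieb x y) = lieb (f x) (f y).

Section ProdLie.
Variables (K : comNzRingType) (L M : lieAlgType K).

Definition pair_lieb (x y : L * M) : L * M := (lieb x.1 y.1, lieb x.2 y.2).

Fact pair_lieb_linearl z : linear (pair_lieb ^~ z).
Proof. by move=> a x y; congr pair; rewrite /= lieb_linearl. Qed.

Fact pair_lieb_linearr z : linear (pair_lieb z).
Proof. by move=> a x y; congr pair; rewrite /= lieb_linearr. Qed.

Fact pair_liebxx x : pair_lieb x x = 0.
Proof. by rewrite /pair_lieb !liebxx. Qed.

Fact pair_jacobi x y z : pair_lieb x (pair_lieb y z) +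
  pair_lieb y (pair_lieb z x) + pair_lieb z (pair_lieb x y) = 0.
Proof. by congr pair; exact: jacobi. Qed.

HB.instance Definition _ := Lmodule_isLie.Build K (L * M)%type
  pair_lieb_linearl pair_lieb_linearr pair_liebxx pair_jacobi.

End ProdLie.

(* ((x1, x2), x3) stands for x1 f1 + x2 f2 + x3 f3, with coordinates in the    *)
(* commutative K-algebra S, regarded as a K-module by restriction of scalars. *)
Definition heis_lie (K : comNzRingType) (S : comAlgType K) : Type :=
  (S * S * S)%type.

Section HeisLie.
Variables (K : comNzRingType) (S : comAlgType K).
Local Notation L := (heis_lie S).

HB.instance Definition _ := GRing.Lmodule.copy L (S * S * S)%type.

Definition heis_lieb (x y : L) : L :=
  (0, 0, x.1.1 * y.1.2 - x.1.2 * y.1.1).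

Fact heis_lieb_linearl z : linear (heis_lieb ^~ z).
Proof.
move=> a x y; rewrite /heis_lieb; congr (_, _, _) => /=;
  rewrite ?scaler0 ?addr0 //.
by rewrite !mulrDl -!scalerAl scalerBr opprD addrACA.
Qed.

Fact heis_lieb_linearr z : linear (heis_lieb z).
Proof.
move=> a x y; rewrite /heis_lieb; congr (_, _, _) => /=;
  rewrite ?scaler0 ?addr0 //.
by rewrite !mulrDr -!scalerAr scalerBr opprD addrACA.
Qed.

Fact heis_liebxx x : heis_lieb x x = 0.
Proof. by rewrite /heis_lieb mulrC subrr. Qed.

Fact heis_jacobi x y z : heis_lieb x (heis_lieb y z) +
  heis_lieb y (heis_lieb z x) + heis_lieb z (heis_lieb x y) = 0.
Proof.
by congr (_, _, _) => /=; rewrite ?mulr0 ?subr0 ?addr0.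
Qed.

HB.instance Definition _ := Lmodule_isLie.Build K L
  heis_lieb_linearl heis_lieb_linearr heis_liebxx heis_jacobi.

End HeisLie.

(* Rcomplex R is the field R[i] seen as an algebra over R. *)
HB.instance Definition _ (R : rcfType) :=
  GRing.Lalgebra_isComAlgebra.Build R (Rcomplex R).

Section BaseChange.
Variables (K : numFieldType) (A : fdLieAlgType rat).
Local Notation n := (\dim {:A}).
Local Notation b := (vbasis {:A}).

(* A (x) K in coordinates: the row (x_i) stands for \sum_i b_i (x) x_i, where *)
(* b is the standard basis of A over the rationals.                           *)
Definition base_change : Type := 'rV[K]_n.
HB.instance Definition _ := Vector.copy base_change 'rV[K]_n.

Definition base_change_lieb (x y : base_change) : base_change :=
  \row_k \sum_i \sum_j
    x 0 i * y 0 j * ratr (coord b k (lieb b`_i b`_j)).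

Fact base_change_lieb_linearl z : linear (base_change_lieb ^~ z).
Proof.
move=> a x y; apply/rowP => k; rewrite !mxE mulr_sumr -big_split /=.
apply: eq_bigr => i _; rewrite mulr_sumr -big_split /=.
by apply: eq_bigr => j _; rewrite !mxE; ring.
Qed.

Fact base_change_lieb_linearr z : linear (base_change_lieb z).
Proof.
move=> a x y; apply/rowP => k; rewrite !mxE mulr_sumr -big_split /=.
apply: eq_bigr => i _; rewrite mulr_sumr -big_split /=.
by apply: eq_bigr => j _; rewrite !mxE; ring.
Qed.

(* The pure tensor a (x) s; by tensZl and tensZr below it is balanced over the *)
(* rationals, and lieb_tens says that the bracket is the usual one on A (x) K. *)
Definition tens (a : A) (s : K) : base_change := \row_k (s * ratr (coord b k a)).

Lemma tens_suml I r (P : pred I) (F : I -> A) s :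
  tens (\sum_(i <- r | P i) F i) s = \sum_(i <- r | P i) tens (F i) s.
Proof.
apply/rowP => k; rewrite summxE mxE linear_sum rmorph_sum mulr_sumr.
by apply: eq_bigr => i _; rewrite mxE.
Qed.

Lemma tens_sumr I r (P : pred I) (F : I -> K) a :
  tens a (\sum_(i <- r | P i) F i) = \sum_(i <- r | P i) tens a (F i).
Proof.
apply/rowP => k; rewrite summxE mxE mulr_suml.
by apply: eq_bigr => i _; rewrite mxE.
Qed.

Lemma tensZl q a s : tens (q *: a) s = tens a (ratr q * s).
Proof. by apply/rowP => k; rewrite !mxE linearZ rmorphM /=; ring. Qed.

Lemma tensZr a s t : tens a (t * s) = t *: tens a s.
Proof. by apply/rowP => k; rewrite !mxE; ring. Qed.

Lemma lieb_tens a a' s s' :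
  base_change_lieb (tens a s) (tens a' s') = tens (lieb a a') (s * s').
Proof.
have Ea : a = \sum_i coord b i a *: b`_i by exact: coord_vbasis (memvf _).
have Ea' : a' = \sum_i coord b i a' *: b`_i by exact: coord_vbasis (memvf _).
apply/rowP => k; rewrite !mxE [in RHS]Ea [in RHS]Ea'
  (lin_sum (lieb_linearl _)) linear_sum rmorph_sum mulr_sumr.
apply: eq_bigr => i _; rewrite (lin_scale (lieb_linearl _))
  (lin_sum (lieb_linearr _)) scaler_sumr linear_sum rmorph_sum mulr_sumr.
by apply: eq_bigr => j _; rewrite (lin_scale (lieb_linearr _)) !linearZ !mxE /= !rmorphM /=; ring.
Qed.

Lemma base_change_sumE (x : base_change) : x = \sum_(i < n) tens b`_i (x 0 i).
Proof.
apply/rowP => k; rewrite summxE (bigD1 k) //= mxE coord_free ?(basis_free (vbasisP _)) //.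
rewrite eqxx rmorph1 mulr1 big1 ?addr0 // => i ik.
by rewrite mxE coord_free ?(basis_free (vbasisP _)) // (negPf ik) rmorph0 mulr0.
Qed.

Lemma liebC_tens a a' s s' :
  tens (lieb a a') (s * s') = - tens (lieb a' a) (s' * s).
Proof.
have ll c u v : lieb (u + v) c = lieb u c + lieb v c.
  by rewrite -[u]scale1r lieb_linearl !scale1r.
have lr c u v : lieb c (u + v) = lieb c u + lieb c v.
  by rewrite -[u]scale1r lieb_linearr !scale1r.
have -> : lieb a a' = - lieb a' a.
  have := liebxx (a + a'); rewrite ll !lr !liebxx add0r addr0 => /eqP.
  by rewrite addr_eq0 => /eqP.
by apply/rowP => k; rewrite !mxE linearN rmorphN /=; ring.
Qed.

Fact base_change_liebxx x : base_change_lieb x x = 0.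
Proof.
have E u v : base_change_lieb u v = \sum_(i < n) \sum_(j < n)
    tens (lieb b`_i b`_j) (u 0 i * v 0 j).
  rewrite {1}(base_change_sumE u) (lin_sum (base_change_lieb_linearl _)).
  apply: eq_bigr => i _; rewrite {1}(base_change_sumE v).
  rewrite (lin_sum (base_change_lieb_linearr _)).
  by apply: eq_bigr => j _; rewrite lieb_tens.
suff : 2%:R *: base_change_lieb x x = 0.
  by move/eqP; rewrite scaler_eq0 pnatr_eq0 => /eqP.
rewrite scaler_nat mulr2n {1}E exchange_big E -big_split big1 //= => i _.
rewrite -big_split big1 //= => j _.
by rewrite liebC_tens addNr.
Qed.

Fact base_change_jacobi x y z :
  base_change_lieb x (base_change_lieb y z) +
  base_change_lieb y (base_change_lieb z x) +
  base_change_lieb z (base_change_lieb x y) = 0.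
Proof.
pose T (u v w : base_change) := \sum_(i < n) \sum_(j < n) \sum_(k < n)
  tens (lieb b`_i (lieb b`_j b`_k)) (u 0 i * (v 0 j * w 0 k)).
have E u v w : base_change_lieb u (base_change_lieb v w) = T u v w.
  rewrite {1}(base_change_sumE u) (lin_sum (base_change_lieb_linearl _)).
  apply: eq_bigr => i _.
  rewrite {1}(base_change_sumE v) (lin_sum (base_change_lieb_linearl _)).
  rewrite (lin_sum (base_change_lieb_linearr _)); apply: eq_bigr => j _.
  rewrite {1}(base_change_sumE w) (lin_sum (base_change_lieb_linearr _)).
  rewrite (lin_sum (base_change_lieb_linearr _)); apply: eq_bigr => k _.
  by rewrite !lieb_tens.
rewrite !E.
have -> : T y z x = \sum_(i < n) \sum_(j < n) \sum_(k < n)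
    tens (lieb b`_j (lieb b`_k b`_i)) (y 0 j * (z 0 k * x 0 i)).
  rewrite /T; under eq_bigr do rewrite exchange_big.
  by rewrite exchange_big; apply: eq_bigr => i _.
have -> : T z x y = \sum_(i < n) \sum_(j < n) \sum_(k < n)
    tens (lieb b`_k (lieb b`_i b`_j)) (z 0 k * (x 0 i * y 0 j)).
  rewrite /T exchange_big; apply: eq_bigr => i _.
  by rewrite exchange_big.
rewrite -!big_split big1 //= => i _; rewrite -!big_split big1 //= => j _.
rewrite -!big_split big1 //= => k _.
apply/rowP => l; rewrite !mxE.
have := congr1 (fun u => ratr (coord b l u) : K) (jacobi b`_i b`_j b`_k).
rewrite !linearD !rmorphD linear0 rmorph0 /= => J.
rewrite -[RHS](mulr0 (x 0 i * y 0 j * z 0 k)) -J; ring.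
Qed.

HB.instance Definition _ := Lmodule_isLie.Build K base_change
  base_change_lieb_linearl base_change_lieb_linearr
  base_change_liebxx base_change_jacobi.

End BaseChange.

Definition rational_structure (R : realType) (g : lieAlgType R)
    (A : fdLieAlgType rat) : Prop :=
  lie_iso (base_change R A) g.

(* 0 is excluded (take k = 0), while 1 and -1 are squarefree. *)
Definition squarefreez (d : int) : Prop :=
  forall k : int, (k ^+ 2 %| d)%Z -> `|k| = 1.

(* The six-dimensional rational Lie algebra with basis e_1, ..., e_6 and       *)
(*   [e_1, e_4] = [e_2, e_3] = e_5, [e_1, e_3] = e_6, [e_2, e_4] = - d e_6.    *)
Definition nd (d : int) : Type := 'rV[rat]_6.

Section Nd.
Variable d : int.
HB.instance Definition _ := Vector.copy (nd d) 'rV[rat]_6.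

(* The coordinate on e_i: rows are indexed from 0, the basis from 1. *)
Definition nd_coord (x : nd d) (i : nat) : rat := x 0 (inord i.-1).

Definition nd_lieb (x y : nd d) : nd d :=
  let minor i j :=
    nd_coord x i * nd_coord y j - nd_coord x j * nd_coord y i in
  \row_(k < 6)
    if k.+1 == 5%N then minor 1%N 4%N + minor 2%N 3%N
    else if k.+1 == 6%N then minor 1%N 3%N - d%:~R * minor 2%N 4%N
    else 0.

Fact nd_lieb_linearl z : linear (nd_lieb ^~ z).
Proof.
move=> a x y; apply/rowP => k; rewrite !mxE /nd_coord ?mxE.
by case: ifP => _; [|case: ifP => _]; ring.
Qed.

Fact nd_lieb_linearr z : linear (nd_lieb z).
Proof.
move=> a x y; apply/rowP => k; rewrite !mxE /nd_coord ?mxE.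
by case: ifP => _; [|case: ifP => _]; ring.
Qed.

Fact nd_liebxx x : nd_lieb x x = 0.
Proof.
apply/rowP => k; rewrite !mxE /nd_coord ?mxE.
by case: ifP => _; [|case: ifP => _]; ring.
Qed.

Fact nd_jacobi x y z :
  nd_lieb x (nd_lieb y z) + nd_lieb y (nd_lieb z x) + nd_lieb z (nd_lieb x y)
  = 0.
Proof.
apply/rowP => k; rewrite !mxE /nd_coord !mxE !inordK //=.
by case: ifP => _; [|case: ifP => _]; rewrite ?mulr0 ?mul0r ?subrr ?addr0.
Qed.

HB.instance Definition _ := Lmodule_isLie.Build rat (nd d)
  nd_lieb_linearl nd_lieb_linearr nd_liebxx nd_jacobi.

End Nd.

Definition unitriangular (S : comNzRingType) : pred 'M[S]_3 := fun M =>
  [forall i : 'I_3, forall j : 'I_3, (j <= i)%N ==> (M i j == (i == j)%:R)].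

Record heis (S : comNzRingType) : Type :=
  Heis { heis_mx : 'M[S]_3; heisP : unitriangular heis_mx }.

Section HeisGroup.
Variable S : comNzRingType.
Implicit Types M N : 'M[S]_3.

HB.instance Definition _ := [isSub for @heis_mx S].
HB.instance Definition _ := [Choice of heis S by <:].

Local Notation o0 := (ord0 : 'I_3).
Local Notation o1 := (lift ord0 ord0 : 'I_3).
Local Notation o2 := (lift ord0 (lift ord0 ord0) : 'I_3).

Fact ord3P (i : 'I_3) : [\/ i = o0, i = o1 | i = o2].
Proof.
by case: i => [[|[|[|//]]] ?]; [apply: Or31|apply: Or32|apply: Or33];
  apply/val_inj.
Qed.

Fact unitriangularP M : reflect
  ([/\ M o0 o0 = 1, M o1 o1 = 1 & M o2 o2 = 1] /\
   [/\ M o1 o0 = 0, M o2 o0 = 0 & M o2 o1 = 0]) (unitriangular M).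
Proof.
apply: (iffP forallP) => [H|[[M00 M11 M22] [M10 M20 M21]] i].
  have E (i j : 'I_3) : (j <= i)%N -> M i j = (i == j)%:R.
    by move=> ji; apply/eqP; move/forallP/(_ j): (H i); rewrite ji.
  by do 2!split; rewrite E.
apply/forallP => j; apply/implyP.
by have [->|->|->] := ord3P i; have [->|->|->] := ord3P j => //= _; apply/eqP.
Qed.

Fact unitriangular1 : unitriangular (1%:M : 'M[S]_3).
Proof. by apply/unitriangularP; do 2!split; rewrite !mxE. Qed.

Fact unitriangularM M N :
  unitriangular M -> unitriangular N -> unitriangular (M *m N).
Proof.
move=> /unitriangularP[[M00 M11 M22] [M10 M20 M21]].
move=> /unitriangularP[[N00 N11 N22] [N10 N20 N21]].
apply/unitriangularP; do 2!split; rewrite !mxE !big_ord_recl big_ord0.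
all: rewrite ?(M00, M11, M22, M10, M20, M21, N00, N11, N22, N10, N20, N21).
all: by ring.
Qed.

Definition unitriangular_inv M := 1%:M - (M - 1%:M) + (M - 1%:M) *m (M - 1%:M).

Fact unitriangularV M : unitriangular M -> unitriangular (unitriangular_inv M).
Proof.
move=> /unitriangularP[[M00 M11 M22] [M10 M20 M21]].
apply/unitriangularP; do 2!split; rewrite !mxE !big_ord_recl big_ord0 !mxE /=.
all: rewrite ?(M00, M11, M22, M10, M20, M21).
all: by ring.
Qed.

Fact unitriangular_mulV M : unitriangular M -> M *m unitriangular_inv M = 1%:M.
Proof.
move=> /unitriangularP[[M00 M11 M22] [M10 M20 M21]].
apply/matrixP => i j.
have [->|->|->] := ord3P i; have [->|->|->] := ord3P j.
all: rewrite !(mxE, big_ord_recl, big_ord0) /=.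
all: rewrite ?(M00, M11, M22, M10, M20, M21).
all: by ring.
Qed.

Fact unitriangular_mulVl M : unitriangular M -> unitriangular_inv M *m M = 1%:M.
Proof.
move=> /unitriangular_mulV <-; rewrite /unitriangular_inv.
by rewrite !(mulmxDl, mulmxDr, mulmxBl, mulmxBr, mulNmx, mulmxN, mul1mx, mulmx1)
  !mulmxA.
Qed.

Definition heis_mul (x y : heis S) := Heis (unitriangularM (heisP x) (heisP y)).
Definition heis_one := Heis unitriangular1.
Definition heis_inv (x : heis S) := Heis (unitriangularV (heisP x)).

Fact heis_mulA : associative heis_mul.
Proof. by move=> x y z; apply/val_inj; rewrite /= mulmxA. Qed.
Fact heis_mul1 : left_id heis_one heis_mul.
Proof. by move=> x; apply/val_inj; rewrite /= mul1mx. Qed.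
Fact heis_mulr1 : right_id heis_one heis_mul.
Proof. by move=> x; apply/val_inj; rewrite /= mulmx1. Qed.
Fact heis_mulV : left_inverse heis_one heis_inv heis_mul.
Proof. by move=> x; apply/val_inj/unitriangular_mulVl/heisP. Qed.
Fact heis_mulVr : right_inverse heis_one heis_inv heis_mul.
Proof. by move=> x; apply/val_inj/unitriangular_mulV/heisP. Qed.

HB.instance Definition _ := isGroup.Build (heis S)
  heis_mulA heis_mul1 heis_mulr1 heis_mulV heis_mulVr.

End HeisGroup.

(* Continuity of the operations plays no role in the definition of a lattice, *)
(* and is not part of the structure.                                          *)
HB.structure Definition TopGroup := {G of Group G & Topological G}.
HB.instance Definition _ (K : numFieldType) :=
  Topological.copy (heis K) (initial_topology (@heis_mx K)).
HB.instance Definition _ (G H : TopGroup.type) := Topological.on (G * H)%type.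

Section Subgroups.
Variables (G : groupType) (U : groupClosed G).

Record subgroup_of : Type :=
  SubgroupOf { subgroup_val : G; _ : subgroup_val \in U }.
HB.instance Definition _ := [isSub for subgroup_val].
HB.instance Definition _ := [Choice of subgroup_of by <:].
Fact subgroup_closedP : group_closed U.
Proof. by split; [exact: gpred1 | exact: gpredF]. Qed.
HB.instance Definition _ :=
  SubChoice_isSubGroup.Build G _ subgroup_of subgroup_closedP.

(* x and y are related when x U = y U, so {eq_quot coset_rel} is G / U. *)
Definition coset_rel : rel G := fun x y => (x^-1 * y)%g \in U.

Fact coset_rel_equiv : equiv_class_of coset_rel.
Proof.
split=> [x|x y|y x z].
- by rewrite /coset_rel mulVg gpred1.
- by rewrite /coset_rel -gpredV invgM invgK.
- by move=> xy yz; rewrite /coset_rel -(mulVKg y z) mulgA gpredM.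
Qed.

Canonical coset_equiv := EquivRelPack coset_rel_equiv.

End Subgroups.

Definition group_iso (G H : groupType) : Prop :=
  exists f : {multiplicative G -> H}, bijective f.

Definition finite_index (G : groupType) (U : groupClosed G) : Prop :=
  finite_set [set: {eq_quot (coset_rel U)}].

Definition commensurable (G H : groupType) : Prop :=
  exists (U : groupClosed G) (V : groupClosed H),
    [/\ finite_index U, finite_index V
      & group_iso (subgroup_of U) (subgroup_of V)].

(* Discreteness is that of the subspace topology (all points of Gamma are     *)
(* isolated in Gamma); cocompactness is compactness of G / Gamma.             *)
Definition lattice (G : TopGroup.type) (Gamma : groupClosed G) : Prop :=
  isolated [set` Gamma] = [set` Gamma] /\
  compact [set: quotient_topology {eq_quot (coset_rel Gamma)}].

Definition commensurability_class (G : TopGroup.type) (Gamma : groupClosed G)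
    (Delta : groupClosed G) : Prop :=
  lattice Delta /\ commensurable (subgroup_of Gamma) (subgroup_of Delta).

(* An infinite family of pairwise inequivalent elements. The number of classes *)
(* is not measured by infinite_set because a set of bundled Lie algebras would *)
(* be universe inconsistent.                                                   *)
Definition infinitely_many_classes (T : Type) (P : T -> Prop)
    (E : T -> T -> Prop) : Prop :=
  exists F : nat -> T,
    (forall n, P (F n)) /\ (forall m n, E (F m) (F n) -> m = n).

(* The subfield generated by a square root of m in the algebraic numbers. *)
Definition quad_field (m : int) : {pred algC} := fun z =>
  `[< exists a b : rat, z = ratr a + ratr b * sqrtC m%:~R >].

Definition quad_int (m : int) : {pred algC} :=
  [predI quad_field m & Aint].

Fact quad_int_subring m : subring_closed (quad_int m).
Proof.
have sq : sqrtC m%:~R * sqrtC m%:~R = ratr m%:~R :> algC.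
  by rewrite -expr2 sqrtCK rmorph_int.
split=> [|x y|x y]; rewrite !inE ?rpred1 ?andbT.
- by apply/asboolP; exists 1, 0; rewrite rmorph1 rmorph0 mul0r addr0.
- move=> /andP[/asboolP[a [b ->]] xA] /andP[/asboolP[c [e ->]] yA].
  rewrite rpredB // andbT; apply/asboolP; exists (a - c), (b - e).
  by rewrite !rmorphB /=; ring.
- move=> /andP[/asboolP[a [b ->]] xA] /andP[/asboolP[c [e ->]] yA].
  rewrite rpredM // andbT; apply/asboolP.
  exists (a * c + b * e * m%:~R), (a * e + b * c).
  by rewrite !rmorphD !rmorphM /= -sq; ring.
Qed.

Record quad_ring (m : int) : Type :=
  QuadRing { quad_val : algC; _ : quad_val \in quad_int m }.

Section QuadRing.
Variable m : int.
HB.instance Definition _ := [isSub for @quad_val m].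
HB.instance Definition _ := [Choice of quad_ring m by <:].
HB.instance Definition _ :=
  GRing.isSubringClosed.Build algC (quad_int m) (quad_int_subring m).
HB.instance Definition _ :=
  [SubChoice_isSubComNzRing of quad_ring m by <:].
End QuadRing.

(* Main.v *)
(* Rational structures.  The Pfaffian of the commutator form of n_d is the     *)
(* binary quadratic form a^2 + d b^2, so an isomorphism n_d ~ n_d' forces d/d'  *)
(* to be a square; the same computation with commutators instead of brackets    *)
(* separates the lattices H_1(Z[sqrt(-d)]) up to commensurability.              *)
(*                                                                              *)
(* Lattices.  Write S for C or R x R, so that the group is H_1(S).  By          *)
(* compactness a lattice projects onto a spanning subgroup of S^2, so it        *)
(* contains two elements whose commutator is a unit of S, and an automorphism   *)
(* carries them to (1,0,z1) and (0,1,z2).  Commutators with these two elements  *)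
(* are the coordinates themselves, so all coordinates lie in the discrete group *)
(* L = { z | (0,0,z) in Gamma }; hence L Q is a two-dimensional Q-algebra       *)
(* spanning S, that is Q[s] with s^2 = -d, and after a further automorphism     *)
(* Gamma lies between M Z[s] and M^-1 Z[s] coordinatewise, like H_1 of the      *)
(* maximal order.                                                               *)

From HB Require Import structures.
Require Import Defs.
From mathcomp Require Import all_boot all_order all_algebra all_field.
From mathcomp Require Import all_classical reals topology normedtype.
From mathcomp Require Import complex.
From mathcomp Require Import ring lra.

Set Implicit Arguments.
Unset Strict Implicit.
Unset Printing Implicit Defensive.

Import Order.TTheory GRing.Theory Num.Theory.
Import numFieldNormedType.Exports.

Local Open Scope ring_scope.
Local Open Scope classical_set_scope.
Local Open Scope quotient_scope.

(** * Subgroups of finite index *)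

(** The Lie algebra n_d is the Heisenberg algebra over the quadratic algebra Q[sqrt(-d)], regarded
    over Q. Tensoring with R turns Q[sqrt(-d)] into C when d > 0 and into R x R when d < 0; this is
    [nd_complex] and [nd_split], both through [base_change_iso]. The bracket is a pencil of
    alternating forms on the four-dimensional quotient by the centre, and its Pfaffian is a binary
    quadratic form of discriminant -4d, which an isomorphism can change only by a square factor.
    [pfaffian_disc] is this invariance; with [squarefreez_unique] it yields [nd_not_iso].

    An isomorphism between subgroups of finite index carries no linear structure, but an integer
    relation between central elements is a relation between powers of commutators, so it is
    transported ([expgz_relation]). The same Pfaffian identity, now over Z, shows in
    [lattice_commensurable_eq] that the groups H_1(Z[s]) with different squarefree s^2 are not
    commensurable. Primes, with the appropriate sign, supply infinitely many of them.

    For (b), both Lie groups are H_1(S) with S = R[j]. Compactness of the quotient gives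
    [lattice_spanning], and isolation of the identity gives [lattice_discrete]. From these two facts
    alone [lattice_normal_form] finds s in S with s^2 a squarefree integer and an injective
    endomorphism of H_1(S) that traps the lattice between [inner s M] and [outer s M]. Any two
    groups trapped in this way share a subgroup of finite index ([sandwich_commensurable]). The
    group H_1 of the ring of integers is trapped because quadratic integers have denominators
    dividing 2|m| over Z[sqrt m]; when s^2 = 1 the group H_1(Z) x H_1(Z) is trapped because 2(Z x Z)
    lies in Z[s] and Z[s] in Z x Z. *)

Section Groups.
Local Open Scope group_scope.

Lemma inj_surj_bijective (A B : Type) (f : A -> B) :
  injective f -> (forall b, exists a, f a = b) -> bijective f.
Proof.
move=> finj fsurj; pose g b := sval (cid (fsurj b)).
have fgK : cancel g f by move=> b; exact: svalP (cid (fsurj b)).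
by exists g => // a; apply: finj; rewrite fgK.
Qed.

Lemma group_iso_of (G H : groupType) (f : G -> H) :
  {morph f : x y / x * y} -> bijective f -> group_iso G H.
Proof.
move=> fM fbij.
pose m := isMultiplicative.Build G H f fM.
pose F : {multiplicative G -> H} := HB.pack f m.
by exists F.
Qed.

Lemma morph_gen (G H : groupType) (f : G -> H) : {morph f : x y / x * y} ->
  f 1 = 1 /\ forall x, f x^-1 = (f x)^-1.
Proof.
move=> fM.
have f1 : f 1 = 1 by apply: (mulgI (f 1)); rewrite -fM !mulg1.
by split=> // x; apply: (mulgI (f x)); rewrite -fM !mulgV.
Qed.

(** Subgroups are boolean predicates bundled with their closure properties; this turns a
    [Prop]-valued one into such a bundle classically. *)
Lemma groupClosed_of (G : groupType) (P : G -> Prop) :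
  P 1 -> (forall x y, P x -> P y -> P (x * y)) -> (forall x, P x -> P x^-1) ->
  exists U : groupClosed G, forall x, (x \in U) = `[<P x>].
Proof.
move=> P1 PM PV; pose p : {pred G} := fun x => `[<P x>].
have m1 : 1 \in p by apply/asboolP.
have mM : {in p &, forall x y, x * y \in p}.
  by move=> x y /asboolP px /asboolP py; apply/asboolP/PM.
have mV : {in p, forall x, x^-1 \in p}.
  by move=> x /asboolP px; apply/asboolP/PV.
pose i1 := isMul1Closed.Build G p m1.
pose iM := isMulClosed.Build G p mM.
pose iV := isInvClosed.Build G p mV.
pose U : groupClosed G := HB.pack p i1 iM iV.
by exists U.
Qed.


Lemma coset_piP (G : groupType) (U : groupClosed G) (x y : G) :
  reflect (\pi_{eq_quot (coset_rel U)} x = \pi_{eq_quot (coset_rel U)} y)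
          (x^-1 * y \in U).
Proof. by apply: (iffP idP) => [xy|/eqquotP //]; apply/eqquotP. Qed.

(** Each fibre of the colouring [k] lies in a single coset, so a finite set of colours maps onto the
    cosets. *)
Lemma finite_index_of (G : groupType) (U : groupClosed G) (T : finType)
    (k : G -> T) :
  (forall x y, k x = k y -> x^-1 * y \in U) -> finite_index U.
Proof.
move=> kU; pose h t := match pselect (exists x, k x = t) with
  | left e => \pi_{eq_quot (coset_rel U)} (sval (cid e))
  | right _ => \pi_{eq_quot (coset_rel U)} 1 end.
apply: (@sub_finite_set _ _ (h @` [set: T])); last first.
  exact/finite_image/finite_finset.
move=> q _; exists (k (repr q)) => //; rewrite /h.
case: pselect => [e|[]]; last by exists (repr q).
by case: cid => x /= xq; rewrite -[RHS]reprK; apply/coset_piP/kU.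
Qed.

(** Pigeonhole: two of the first powers of [x] lie in the same coset, and their quotient is the
    required power. *)
Lemma finite_index_expg (G : groupType) (U : groupClosed G) (x : G) :
  finite_index U -> exists2 n, (0 < n)%N & x ^+ n \in U.
Proof.
move=> /finite_seqP[s sE].
pose f (i : 'I_(size s).+1) := \pi_{eq_quot (coset_rel U)} (x ^+ i).
have fs i : f i \in s by have : [set: {eq_quot (coset_rel U)}] (f i) by []; rewrite sE.
have /injectivePn[i [j ij fij]] : ~~ injectiveb f.
  apply/injectiveP => finj.
  have := @uniq_leq_size _ [seq f i | i <- enum 'I_(size s).+1] s.
  rewrite map_inj_uniq ?enum_uniq// size_map size_enum_ord ltnn.
  by move=> /(_ isT) H; suff: false by []; apply: H => _ /mapP[i _ ->].
wlog ltij : i j ij fij / (i < j)%N.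
  move=> W; have [lt|lt|/val_inj e] := ltngtP i j; first exact: (W i j).
    by apply: (W j i) => //; rewrite eq_sym.
  by rewrite e eqxx in ij.
exists (j - i)%N; first by rewrite subn_gt0.
by move/coset_piP: fij; rewrite -{1}(subnKC (ltnW ltij)) expgnDr mulKg.
Qed.

(** [U] is a common subgroup of the images of [A] and [B]; its two preimages are isomorphic through
    it, and the finite colouring [k] bounds both indices. *)
Lemma commensurable_embeddings (A B H : groupType) (U : H -> Prop)
    (f : A -> H) (g : B -> H) (T : finType) (k : H -> T) :
  U 1 -> (forall x y, U x -> U y -> U (x * y)) -> (forall x, U x -> U x^-1) ->
  {morph f : x y / x * y} -> {morph g : x y / x * y} ->
  injective f -> injective g ->
  (forall h, U h -> exists a, f a = h) -> (forall h, U h -> exists b, g b = h) ->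
  (forall x y, k (f x) = k (f y) -> U ((f x)^-1 * f y)) ->
  (forall x y, k (g x) = k (g y) -> U ((g x)^-1 * g y)) ->
  commensurable A B.
Proof.
move=> U1 UM UV fM gM finj ginj fU gU fk gk.
have [f1 fV] := morph_gen fM; have [g1 gV] := morph_gen gM.
have [|||UA UAE] := @groupClosed_of A (fun a => U (f a)).
- by rewrite f1.
- by move=> x y Ux Uy; rewrite fM; apply: UM.
- by move=> x Ux; rewrite fV; apply: UV.
have [|||UB UBE] := @groupClosed_of B (fun b => U (g b)).
- by rewrite g1.
- by move=> x y Ux Uy; rewrite gM; apply: UM.
- by move=> x Ux; rewrite gV; apply: UV.
exists UA, UB; split.
- apply: (@finite_index_of _ _ _ (k \o f)) => x y kxy.
  by rewrite UAE; apply/asboolP; rewrite fM fV; apply: fk.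
- apply: (@finite_index_of _ _ _ (k \o g)) => x y kxy.
  by rewrite UBE; apply/asboolP; rewrite gM gV; apply: gk.
have UAP (a : subgroup_of UA) : U (f (val a)).
  by have := valP a; rewrite UAE => /asboolP.
have UBP (b : subgroup_of UB) : U (g (val b)).
  by have := valP b; rewrite UBE => /asboolP.
have ex (a : subgroup_of UA) : exists b : subgroup_of UB, g (val b) = f (val a).
  have [b gb] := gU _ (UAP a).
  have bU : b \in UB by rewrite UBE gb; apply/asboolP.
  by exists (SubgroupOf bU).
pose F a := sval (cid (ex a)); have FE a : g (val (F a)) = f (val a).
  exact: svalP (cid (ex a)).
apply: (@group_iso_of _ _ F).
  by move=> x y; apply/val_inj/ginj; rewrite FE !valM fM gM !FE.
apply: inj_surj_bijective => [x y Fxy|b].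
  by apply/val_inj/finj; rewrite -!FE Fxy.
have [a fa] := fU _ (UBP b).
have aU : a \in UA by rewrite UAE fa; apply/asboolP.
by exists (SubgroupOf aU); apply/val_inj/ginj; rewrite FE.
Qed.

Lemma subgroup_iso_image (G H : groupType) (U : groupClosed G) (f : H -> G) :
  {morph f : x y / x * y} -> injective f ->
  (forall h, f h \in U) -> (forall x, x \in U -> exists h, f h = x) ->
  group_iso (subgroup_of U) H.
Proof.
move=> fM finj fU Uf.
have ex (a : subgroup_of U) : exists h, f h = val a by apply/Uf/valP.
pose F a := sval (cid (ex a)); have FE a : f (F a) = val a.
  exact: svalP (cid (ex a)).
apply: (@group_iso_of _ _ F).
  by move=> x y; apply: finj; rewrite fM !FE valM.
apply: inj_surj_bijective => [x y Fxy|h].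
  by apply/val_inj; rewrite -!FE Fxy.
by exists (SubgroupOf (fU h)); apply: finj; rewrite FE.
Qed.

End Groups.

(** * The Heisenberg group in coordinates *)

Section HeisCoordinates.
Variable S : comNzRingType.
Implicit Types g h : heis S.

Local Notation o0 := (ord0 : 'I_3).
Local Notation o1 := (lift ord0 ord0 : 'I_3).
Local Notation o2 := (lift ord0 (lift ord0 ord0) : 'I_3).

Definition hx g : S := heis_mx g o0 o1.
Definition hy g : S := heis_mx g o1 o2.
Definition hz g : S := heis_mx g o0 o2.

Definition hmx (x y z : S) : 'M[S]_3 := \matrix_(i, j)
  if i == j then 1 else if (i == o0) && (j == o1) then x else
  if (i == o1) && (j == o2) then y else
  if (i == o0) && (j == o2) then z else 0.

Fact hmx_unitriangular x y z : unitriangular (hmx x y z).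
Proof. by apply/unitriangularP; do 2!split; rewrite !mxE. Qed.

Definition hmk x y z : heis S := Heis (hmx_unitriangular x y z).

Lemma hxE x y z : hx (hmk x y z) = x. Proof. by rewrite /hx mxE. Qed.
Lemma hyE x y z : hy (hmk x y z) = y. Proof. by rewrite /hy mxE. Qed.
Lemma hzE x y z : hz (hmk x y z) = z. Proof. by rewrite /hz mxE. Qed.

Lemma heis_ext g h : hx g = hx h -> hy g = hy h -> hz g = hz h -> g = h.
Proof.
move=> ex ey ez; apply/val_inj/matrixP => i j /=.
have /unitriangularP[[g00 g11 g22] [g10 g20 g21]] := heisP g.
have /unitriangularP[[h00 h11 h22] [h10 h20 h21]] := heisP h.
by have [->|->|->] := ord3P i; have [->|->|->] := ord3P j;
  rewrite ?(g00, g11, g22, g10, g20, g21, h00, h11, h22, h10, h20, h21).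
Qed.

Lemma hmkK g : hmk (hx g) (hy g) (hz g) = g.
Proof. by apply: heis_ext; rewrite ?hxE ?hyE ?hzE. Qed.

Lemma hx1 : hx 1%g = 0. Proof. by rewrite /hx mxE. Qed.
Lemma hy1 : hy 1%g = 0. Proof. by rewrite /hy mxE. Qed.
Lemma hz1 : hz 1%g = 0. Proof. by rewrite /hz mxE. Qed.

Lemma hxM g h : hx (g * h)%g = hx g + hx h.
Proof.
have /unitriangularP[[g00 g11 g22] [g10 g20 g21]] := heisP g.
have /unitriangularP[[h00 h11 h22] [h10 h20 h21]] := heisP h.
by rewrite /hx mxE !big_ord_recl big_ord0 g00 h11 h21; ring.
Qed.

Lemma hyM g h : hy (g * h)%g = hy g + hy h.
Proof.
have /unitriangularP[[g00 g11 g22] [g10 g20 g21]] := heisP g.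
have /unitriangularP[[h00 h11 h22] [h10 h20 h21]] := heisP h.
by rewrite /hy mxE !big_ord_recl big_ord0 g11 g10 h22; ring.
Qed.

Lemma hzM g h : hz (g * h)%g = hz g + hz h + hx g * hy h.
Proof.
have /unitriangularP[[g00 g11 g22] [g10 g20 g21]] := heisP g.
have /unitriangularP[[h00 h11 h22] [h10 h20 h21]] := heisP h.
by rewrite /hz mxE !big_ord_recl big_ord0 g00 h22 /hx /hy; ring.
Qed.

Lemma hxV g : hx g^-1%g = - hx g.
Proof. by apply/eqP; rewrite -addr_eq0 -hxM mulVg hx1. Qed.

Lemma hyV g : hy g^-1%g = - hy g.
Proof. by apply/eqP; rewrite -addr_eq0 -hyM mulVg hy1. Qed.

Lemma hzV g : hz g^-1%g = - hz g + hx g * hy g.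
Proof.
have := hzM g g^-1%g; rewrite mulgV hz1 hyV => e.
by apply/eqP; rewrite -subr_eq0; apply/eqP; rewrite [RHS]e; ring.
Qed.

Definition hE := (hxM, hyM, hzM, hxV, hyV, hzV, hxE, hyE, hzE, hx1, hy1, hz1).

Lemma hmkM x y z x' y' z' :
  (hmk x y z * hmk x' y' z')%g = hmk (x + x') (y + y') (z + z' + x * y').
Proof. by apply: heis_ext; rewrite !hE. Qed.

(** Commutators depend only on the first two coordinates, through an alternating form with values in
    the centre; this is the group counterpart of the bracket. *)
Lemma hmkR g h :
  [~ g, h]%g = hmk 0 0 (hx g * hy h - hx h * hy g).
Proof. by apply: heis_ext; rewrite /commg /conjg !hE; ring. Qed.

Lemma hxX g n : hx (g ^+ n)%g = hx g *+ n.
Proof.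
by elim: n => [|n IH]; rewrite ?expg0 ?hx1 // expgS hxM IH mulrS.
Qed.

Lemma hyX g n : hy (g ^+ n)%g = hy g *+ n.
Proof.
by elim: n => [|n IH]; rewrite ?expg0 ?hy1 // expgS hyM IH mulrS.
Qed.

Lemma hzX g n : hz (g ^+ n)%g = hz g *+ n + (hx g * hy g) *+ 'C(n, 2).
Proof.
elim: n => [|n IH]; first by rewrite expg0 hz1 bin0n !mulr0n addr0.
by rewrite expgS hzM IH hyX binS bin1 mulrnDr -mulrnAr mulrS; ring.
Qed.

End HeisCoordinates.

Section HeisMap.
Variables (S T : comNzRingType) (f : S -> T).
Hypothesis fD : {morph f : x y / x + y}.
Hypothesis fM : {morph f : x y / x * y}.

Definition heis_map (g : heis S) : heis T := hmk (f (hx g)) (f (hy g)) (f (hz g)).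

Lemma heis_mapM : {morph heis_map : g h / (g * h)%g}.
Proof. by move=> g h; apply: heis_ext; rewrite !hE ?fD ?fM. Qed.

Lemma heis_map_inj : injective f -> injective heis_map.
Proof.
move=> fI g h e; apply: heis_ext; apply: fI.
- by have := congr1 (@hx T) e; rewrite !hxE.
- by have := congr1 (@hy T) e; rewrite !hyE.
- by have := congr1 (@hz T) e; rewrite !hzE.
Qed.
End HeisMap.

(** * Groups trapped between multiples of Z[s] *)

Section Sandwich.
Variables (S : comNzRingType) (s : S) (D : int).
Hypothesis sD : s * s = D%:~R.
Hypothesis torsion_free : forall (n : nat) (x : S),
  (0 < n)%N -> n%:R * x = 0 -> x = 0.

Definition zlat (x : S) : Prop := exists a b : int, x = a%:~R + b%:~R * s.

Lemma zlat_int (a : int) : zlat a%:~R.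
Proof. by exists a, 0; rewrite mul0r addr0. Qed.

Lemma zlat_gen : zlat s.
Proof. by exists 0, 1; rewrite mul1r add0r. Qed.

Lemma zlatB x y : zlat x -> zlat y -> zlat (x - y).
Proof.
by move=> [a [b ->]] [c [d ->]]; exists (a - c), (b - d); rewrite !rmorphB /=; ring.
Qed.

Lemma zlat0 : zlat 0. Proof. exact: (zlat_int 0). Qed.

Lemma zlatN x : zlat x -> zlat (- x).
Proof. by move=> xL; rewrite -[- x]add0r; exact: zlatB zlat0 xL. Qed.

Lemma zlatD x y : zlat x -> zlat y -> zlat (x + y).
Proof. by move=> xL /zlatN; rewrite -{2}[y]opprK; exact: zlatB. Qed.

Lemma zlatM x y : zlat x -> zlat y -> zlat (x * y).
Proof.
move=> [a [b ->]] [c [d ->]]; exists (a * c + b * d * D), (a * d + b * c).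
by rewrite !rmorphD !rmorphM /= -sD; ring.
Qed.

Lemma zlat_nat n : zlat n%:R. Proof. exact: (zlat_int n). Qed.

(* All commensurabilities below come from trapping two groups between inner M *)
(* (coordinates in M Z[s]) and outer M (coordinates in M^-1 Z[s]).            *)
Definition inner (M : nat) (g : heis S) : Prop := exists x y z,
  [/\ zlat x, zlat y & zlat z] /\
  [/\ hx g = M%:R * x, hy g = M%:R * y & hz g = M%:R * z].

Definition outer (M : nat) (g : heis S) : Prop :=
  [/\ zlat (M%:R * hx g), zlat (M%:R * hy g) & zlat (M%:R * hz g)].

Lemma inner_dvd M N g : (M %| N)%N -> inner N g -> inner M g.
Proof.
move=> /dvdnP[k ->] [x [y [z [[xL yL zL] [ex ey ez]]]]].
exists (k%:R * x), (k%:R * y), (k%:R * z); split.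
  by split; apply: zlatM => //; exact: zlat_nat.
by split; rewrite ?ex ?ey ?ez natrM; ring.
Qed.

Lemma outer_dvd M N g : (M %| N)%N -> outer M g -> outer N g.
Proof.
move=> /dvdnP[k ->] [xL yL zL].
by split; rewrite natrM -mulrA; apply: zlatM => //; exact: zlat_nat.
Qed.

Lemma inner1 M : inner M 1%g.
Proof.
exists 0, 0, 0; split; first by split; exact: zlat0.
by rewrite !hE !mulr0.
Qed.

Lemma innerM M g h : inner M g -> inner M h -> inner M (g * h)%g.
Proof.
move=> [x [y [z [[xL yL zL] [ex ey ez]]]]] [x' [y' [z' [[xL' yL' zL'] [ex' ey' ez']]]]].
exists (x + x'), (y + y'), (z + z' + M%:R * x * y'); split.
  split; do ?apply: zlatD => //; do ?apply: zlatM => //; exact: zlat_nat.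
by rewrite !hE ex ey ez ex' ey' ez'; split; ring.
Qed.

Lemma innerV M g : inner M g -> inner M g^-1%g.
Proof.
move=> [x [y [z [[xL yL zL] [ex ey ez]]]]].
exists (- x), (- y), (- z + M%:R * x * y); split.
  split; do ?apply: zlatD => //; do ?apply: zlatN => //;
  do ?apply: zlatM => //; exact: zlat_nat.
by rewrite !hE ex ey ez; split; ring.
Qed.

(** A choice of coordinates, with (0, 0) outside Z[s]; independence of 1 and s is not assumed, and
    only [zcoordE] is used. *)
Definition zcoord (x : S) : int * int :=
  if pselect (exists ab : int * int, x = ab.1%:~R + ab.2%:~R * s) is left e
  then sval (cid e) else (0, 0).

Lemma zcoordE x : zlat x -> x = (zcoord x).1%:~R + (zcoord x).2%:~R * s.
Proof.
move=> [a [b xE]]; rewrite /zcoord; case: pselect => [e|[]]; last by exists (a, b).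
by case: cid.
Qed.

(** The target has one element too many so that [inord] applies for every [N]; for [N > 0] the last
    value is never taken. *)
Definition residue (N : nat) (a : int) : 'I_N.+1 := inord `|(a %% N)%Z|%N.

Lemma residueP N a b : (0 < N)%N -> residue N a = residue N b ->
  exists k : int, b - a = N%:Z * k.
Proof.
move=> N0 /(congr1 val); rewrite /=.
have N0' : N%:Z != 0 by rewrite eqz_nat -lt0n.
have lt (c : int) : (`|(c %% N)%Z| < N.+1)%N.
  by rewrite ltnS ltnW// -ltz_nat gez0_abs ?modz_ge0// (ltz_pmod c)// ltz_nat.
rewrite !inordK// => /(congr1 Posz).
rewrite !gez0_abs ?modz_ge0// => e.
exists ((b %/ N)%Z - (a %/ N)%Z).
rewrite {1}(divz_eq b N) {1}(divz_eq a N) e; ring.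
Qed.

Definition zres N (x : S) : 'I_N.+1 * 'I_N.+1 :=
  (residue N (zcoord x).1, residue N (zcoord x).2).

Lemma zresP N x y : (0 < N)%N -> zlat x -> zlat y -> zres N x = zres N y ->
  exists2 l, zlat l & y - x = N%:R * l.
Proof.
move=> N0 xL yL [] /(residueP N0)[k ek] /(residueP N0)[l el].
exists (k%:~R + l%:~R * s); first by exists k, l.
rewrite {1}(zcoordE xL) {1}(zcoordE yL).
have -> : N%:R = (N%:Z)%:~R :> S by [].
rewrite mulrDr mulrA -!rmorphM -ek -el !rmorphB /=; ring.
Qed.

(** Congruence modulo M^3 of the scaled coordinates makes the coordinates themselves differ by M^2
    Z[s]. In the central coordinate of g^-1 h, one factor M clears the denominator of [hx g], and
    the other one remains for [inner M]. *)
Lemma outer_cosets M g h : (0 < M)%N -> outer M g -> outer M h ->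
  zres (M ^ 3) (M%:R * hx g) = zres (M ^ 3) (M%:R * hx h) ->
  zres (M ^ 3) (M%:R * hy g) = zres (M ^ 3) (M%:R * hy h) ->
  zres (M ^ 3) (M%:R * hz g) = zres (M ^ 3) (M%:R * hz h) ->
  inner M (g^-1 * h)%g.
Proof.
move=> M0 [xg yg zg] [xh yh zh].
have M30 : (0 < M ^ 3)%N by rewrite expn_gt0 M0.
have step x y : zlat (M%:R * x) -> zlat (M%:R * y) ->
    zres (M ^ 3) (M%:R * x) = zres (M ^ 3) (M%:R * y) ->
    exists2 l, zlat l & y - x = M%:R * M%:R * l.
  move=> xL yL /(zresP M30 xL yL)[l lL e]; exists l => //.
  apply/eqP; rewrite -subr_eq0; apply/eqP/(torsion_free M0).
  rewrite mulrBr mulrBr e natrX; ring.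
move=> /(step _ _ xg xh)[a aL ea] /(step _ _ yg yh)[b bL eb] /(step _ _ zg zh)[c cL ec].
exists (M%:R * a), (M%:R * b), (M%:R * c - (M%:R * hx g) * b); split.
  by split; do ?apply: zlatB; do ?apply: zlatM => //; exact: zlat_nat.
rewrite !hE; split; rewrite 1?addrC ?ea ?eb; try by ring.
have -> : hz h = hz g + M%:R * M%:R * c by rewrite -ec; ring.
have -> : hy h = hy g + M%:R * M%:R * b by rewrite -eb; ring.
ring.
Qed.

Lemma sandwich_commensurable (A B : groupType) (M : nat)
    (f : A -> heis S) (g : B -> heis S) : (0 < M)%N ->
  {morph f : x y / (x * y)%g} -> {morph g : x y / (x * y)%g} ->
  injective f -> injective g ->
  (forall h, inner M h -> exists a, f a = h) ->
  (forall h, inner M h -> exists b, g b = h) ->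
  (forall a, outer M (f a)) -> (forall b, outer M (g b)) ->
  commensurable A B.
Proof.
move=> M0 fM gM fI gI fin gin fout gout.
pose k h := (zres (M ^ 3) (M%:R * hx h), zres (M ^ 3) (M%:R * hy h),
  zres (M ^ 3) (M%:R * hz h)).
apply: (commensurable_embeddings (U := inner M) (k := k) _ _ _ fM gM fI gI fin gin).
- exact: inner1.
- exact: innerM.
- exact: innerV.
- by move=> x y e; apply: outer_cosets (fout x) (fout y) (congr1 (fun t => t.1.1) e)
    (congr1 (fun t => t.1.2) e) (congr1 (fun t => t.2) e).
- by move=> x y e; apply: outer_cosets (gout x) (gout y) (congr1 (fun t => t.1.1) e)
    (congr1 (fun t => t.1.2) e) (congr1 (fun t => t.2) e).
Qed.

End Sandwich.

(** * The Pfaffian invariant *)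

Section Pfaffian.
Variables (K : numDomainType) (d d' : K).

(** [w5] and [w6] are the coordinates on e_5 and e_6 of the bracket of n_d'. They are also the
    coordinates on s' and 1 of a commutator in H_1(Z[s']) with s'^2 = -d', for hx = x_1 + x_2 s' and
    hy = x_3 + x_4 s'. *)
Definition w5 (x y : nat -> K) : K :=
  (x 1%N * y 4%N - x 4%N * y 1%N) + (x 2%N * y 3%N - x 3%N * y 2%N).

Definition w6 (x y : nat -> K) : K :=
  (x 1%N * y 3%N - x 3%N * y 1%N) - d' * (x 2%N * y 4%N - x 4%N * y 2%N).

(* The Pfaffian of a w5 + b w6 is a^2 + d' b^2, so an isomorphism identifies *)
(* a^2 + d b^2 with a multiple of a^2 + d' b^2 up to a change of variables;  *)
(* the conclusion compares discriminants.                                    *)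
Lemma pfaffian_disc (P : nat -> nat -> K) :
  w5 (P 1) (P 4) = w5 (P 2) (P 3) -> w6 (P 1) (P 4) = w6 (P 2) (P 3) ->
  w5 (P 2) (P 4) = - d * w5 (P 1) (P 3) -> w6 (P 2) (P 4) = - d * w6 (P 1) (P 3) ->
  w5 (P 1) (P 2) = 0 -> w6 (P 1) (P 2) = 0 ->
  w5 (P 3) (P 4) = 0 -> w6 (P 3) (P 4) = 0 ->
  exists e : K, e ^+ 2 * d' =
    d * (w5 (P 1) (P 4) * w6 (P 1) (P 3) - w6 (P 1) (P 4) * w5 (P 1) (P 3)) ^+ 2.
Proof.
move=> a5 a6 b5 b6 c5 c6 f5 f6.
(* [pol l l] is the Pfaffian of [l] on the four vectors, and [pol l m + pol m l] is its
   polarization. Pulling back multiplies the Pfaffian by the determinant of the four vectors, which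
   is [pol w5 w5]; hence [e56] and [e66]. *)
pose pol (l m : (nat -> K) -> (nat -> K) -> K) :=
  (l (P 1) (P 2) * m (P 3) (P 4) - l (P 1) (P 3) * m (P 2) (P 4) +
  l (P 1) (P 4) * m (P 2) (P 3)).
have e56 : pol w5 w6 + pol w6 w5 = 0 by rewrite /pol /w5 /w6; ring.
have e66 : pol w6 w6 = pol w5 w5 * d' by rewrite /pol /w5 /w6; ring.
exists (pol w5 w5); rewrite expr2 -mulrA -e66.
(* The relations assumed on the vectors make [pol w5 w6] symmetric in [w5] and [w6]. *)
have : 2 * pol w5 w6 = 0.
  rewrite -e56; rewrite {1 2 3}/pol c5 c6 f5 f6 b5 b6 -a5 -a6; ring.
move/eqP; rewrite mulf_eq0 pnatr_eq0 /= => /eqP p56.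
suff : pol w5 w5 * pol w6 w6 - pol w5 w6 * pol w5 w6 =
    d * (w5 (P 1) (P 4) * w6 (P 1) (P 3) - w6 (P 1) (P 4) * w5 (P 1) (P 3)) ^+ 2.
  by rewrite p56 mulr0 subr0.
rewrite /pol c5 c6 f5 f6 b5 b6 -a5 -a6; ring.
Qed.

End Pfaffian.

Lemma squarefreez_neq0 d : squarefreez d -> d != 0.
Proof. by move=> H; apply/eqP => d0; have := H 0; rewrite d0 dvdz0 => /(_ isT). Qed.

(** Write c / e = p / q in lowest terms. Then p^2 d' = d q^2, so p^2 divides d and q^2 divides d',
    and both squares are 1. *)
Lemma squarefreez_unique (d d' : int) (c e : rat) :
  squarefreez d -> squarefreez d' -> c != 0 -> e != 0 ->
  c ^+ 2 * d'%:~R = d%:~R * e ^+ 2 -> d = d'.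
Proof.
move=> sd sd' c0 e0 H.
pose p := numq (c / e); pose q := denq (c / e).
have pq : p ^+ 2 * d' = d * q ^+ 2.
  apply: (@intr_inj rat).
  have numE : (p%:~R : rat) = c / e * q%:~R by exact: numqE.
  have q0 : (q%:~R : rat) != 0 by rewrite intr_eq0 denq_eq0.
  rewrite !expr2 !rmorphM /= numE; apply: (mulfI (expf_neq0 2 e0)).
  transitivity (c ^+ 2 * d'%:~R * q%:~R ^+ 2); first by field.
  by rewrite H; field.
have cop : coprimez (p ^+ 2) (q ^+ 2).
  by rewrite coprimezXl// coprimezXr// coprimezE coprime_num_den.
have p1 : `|p| = 1.
  by apply: sd; rewrite -(Gauss_dvdzl _ cop) -pq dvdz_mulr.
have q1 : `|q| = 1.
  by apply: sd'; rewrite -(Gauss_dvdzr d' (etrans (coprimez_sym _ _) cop)) pq dvdz_mull.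
by move: pq; rewrite -[p ^+ 2]real_normK ?num_real// -[q ^+ 2]real_normK ?num_real//
  p1 q1 expr1n mul1r mulr1.
Qed.

(** Strong induction on |E|, splitting off a square k^2 with |k| > 1; the sign stays in [d]. *)
Lemma squarefreez_factor (E : int) : E != 0 ->
  exists d r : int, [/\ squarefreez d, 0 < r & E = d * r ^+ 2].
Proof.
have [n] := ubnP `|E|%N; elim: n E => // n IH E lt E0.
have [sE|] := pselect (squarefreez E); first by exists E, 1; rewrite expr1n mulr1.
move=> /existsNP[k /not_implyP[/dvdzP[F EF] k1]].
have k0 : k != 0 by apply: contra_neq E0 => k0; rewrite EF k0 expr0n mulr0.
have F0 : F != 0 by apply: contra_neq E0 => F0; rewrite EF F0 mul0r.
have lk : (1 < `|k|)%N.
  have : (0 < `|k|)%N by rewrite absz_gt0.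
  by rewrite leq_eqVlt => /orP[/eqP e|//]; case: k1; rewrite -abszE -e.
have ltF : (`|F| < n)%N.
  apply: leq_trans (_ : `|E| <= n)%N; last by rewrite -ltnS.
  rewrite EF abszM ltn_Pmulr ?absz_gt0// abszX.
  by rewrite (leq_trans lk)// expnS expn1 leq_pmulr// ltnW.
have [d [r [sd r0 FE]]] := IH F ltF F0.
exists d, (r * `|k|); split=> //; first by rewrite mulr_gt0// normr_gt0.
by rewrite exprMn real_normK ?num_real// mulrA -FE.
Qed.

Lemma lie_iso_of (K : comNzRingType) (L M : lieAlgType K) (f : L -> M) :
  linear f -> bijective f -> (forall x y, f (lieb x y) = lieb (f x) (f y)) ->
  lie_iso L M.
Proof.
move=> lf bf fb.
pose m := GRing.isLinear.Build K L M _ f lf.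
pose F : {linear L -> M} := HB.pack f m.
by exists F.
Qed.

(** * The rational structures n_d *)

Section NdBasis.
Variable d : int.

Definition nd_basis (i : nat) : nd d := delta_mx 0 (inord i.-1).

Lemma nd_coord_basis i j : (0 < i < 7)%N -> (0 < j < 7)%N ->
  nd_coord (nd_basis i) j = (j == i)%:R.
Proof.
case: i j => [//|i] [//|j] /= hi hj; rewrite /nd_coord mxE eqxx /=.
by rewrite -val_eqE /= !inordK.
Qed.

Lemma nd_ext (x y : nd d) :
  (forall i, (0 < i < 7)%N -> nd_coord x i = nd_coord y i) -> x = y.
Proof.
move=> H; apply/rowP => i; have := H i.+1; rewrite /nd_coord /= inord_val.
by apply; have := ltn_ord i; case: i.
Qed.

Lemma nd_coord_lieb (x y : nd d) i : (0 < i < 7)%N ->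
  nd_coord (lieb x y) i = if i == 5%N then w5 (nd_coord x) (nd_coord y)
    else if i == 6%N then w6 d%:~R (nd_coord x) (nd_coord y) else 0.
Proof.
case: i => [//|i] /= hi; rewrite {1}/nd_coord mxE /= inordK//.
Qed.

Lemma nd_coordZ a (x : nd d) i : nd_coord (a *: x) i = a * nd_coord x i.
Proof. by rewrite /nd_coord mxE. Qed.

Lemma nd_coordD (x y : nd d) i : nd_coord (x + y) i = nd_coord x i + nd_coord y i.
Proof. by rewrite /nd_coord mxE. Qed.

Lemma nd_coord0 i : nd_coord (0 : nd d) i = 0.
Proof. by rewrite /nd_coord mxE. Qed.

Lemma nd_basis_brackets :
  [/\ lieb (nd_basis 1) (nd_basis 4) = nd_basis 5,
      lieb (nd_basis 2) (nd_basis 3) = nd_basis 5,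
      lieb (nd_basis 1) (nd_basis 3) = nd_basis 6 &
      lieb (nd_basis 2) (nd_basis 4) = - d%:~R *: nd_basis 6] /\
  (lieb (nd_basis 1) (nd_basis 2) = 0 /\ lieb (nd_basis 3) (nd_basis 4) = 0).
Proof.
by split; [split|split]; apply: nd_ext => i hi;
  rewrite nd_coord_lieb// ?nd_coordZ ?nd_coord0 ?[RHS]nd_coord_basis//
    /w5 /w6 !nd_coord_basis//; move: i hi => [|[|[|[|[|[|[|]]]]]]] //= _; ring.
Qed.

End NdBasis.

(** The images of e_1, ..., e_4 satisfy the hypotheses of [pfaffian_disc]. The quantity squared
    there is the determinant [k] of [f] on the span of e_5 and e_6; it is nonzero because [f] is
    injective and maps brackets to brackets. *)
Lemma nd_not_iso (d d' : int) : squarefreez d -> squarefreez d' -> d <> d' ->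
  ~ lie_iso (nd d) (nd d').
Proof.
move=> sd sd' dd' [f [fbij fb]]; apply: dd'.
have finj := bij_inj fbij.
have [[b14 b23 b13 b24] [b12 b34]] := nd_basis_brackets d.
pose P i := nd_coord (f (nd_basis d i)).
have W5 i j : w5 (P i) (P j) = nd_coord (f (lieb (nd_basis d i) (nd_basis d j))) 5.
  by rewrite fb nd_coord_lieb.
have W6 i j : w6 d'%:~R (P i) (P j) = nd_coord (f (lieb (nd_basis d i) (nd_basis d j))) 6.
  by rewrite fb nd_coord_lieb.
have [||||||||e] := @pfaffian_disc rat d%:~R d'%:~R P.
1-8: by rewrite ?W5 ?W6 ?b14 ?b23 ?b13 ?b24 ?b12 ?b34 ?linearZ ?nd_coordZ ?linear0 ?nd_coord0.
set k := _ - _ => H.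
have k0 : k != 0.
  apply/eqP; rewrite /k !W5 !W6 b14 b13 -b14 -b13 => kE.
  have lowf x y i : (0 < i < 5)%N -> nd_coord (f (lieb x y)) i = 0.
    by rewrite fb => hi; rewrite nd_coord_lieb; move: i hi => [|[|[|[|[|]]]]].
  have step a c : (a * nd_coord (f (nd_basis d 5)) 5 + c * nd_coord (f (nd_basis d 6)) 5 = 0) ->
     (a * nd_coord (f (nd_basis d 5)) 6 + c * nd_coord (f (nd_basis d 6)) 6 = 0) -> a = 0 /\ c = 0.
    move=> e5 e6.
    have z : f (a *: nd_basis d 5 + c *: nd_basis d 6) = 0.
      apply: nd_ext => i hi; rewrite linearD !linearZ nd_coordD !nd_coordZ nd_coord0.
      move: i hi => [|[|[|[|[|[|[|]]]]]]] //= _; rewrite -{1}b14 -b13 !lowf// ?mulr0 ?addr0//;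
        by rewrite b13.
    have {}z : a *: nd_basis d 5 + c *: nd_basis d 6 = 0 by apply: finj; rewrite z linear0.
    have := congr1 (fun x => nd_coord x 5) z; have := congr1 (fun x => nd_coord x 6) z.
    rewrite !nd_coordD !nd_coordZ !nd_coord_basis// !nd_coord0 /=.
    by rewrite !mulr1 !mulr0 add0r addr0 => -> ->.
  move: kE; rewrite b14 b13 => kE.
  (* If the determinant vanished, the matrix would kill the vectors of its adjugate, so by
     injectivity all its entries would be zero. *)
  have [||v5 u5] := step (nd_coord (f (nd_basis d 6)) 5) (- nd_coord (f (nd_basis d 5)) 5).
  - by ring.
  - by rewrite -[RHS]oppr0 -kE; ring.
  have [||v6 u6] := step (nd_coord (f (nd_basis d 6)) 6) (- nd_coord (f (nd_basis d 5)) 6).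
  - by rewrite -kE; ring.
  - by ring.
  have [||] := step 1 0; rewrite ?mul0r ?mul1r ?addr0.
  - by apply: oppr_inj; rewrite u5 oppr0.
  - by apply: oppr_inj; rewrite u6 oppr0.
  by move/eqP; rewrite oner_eq0.
apply: (squarefreez_unique sd sd' _ k0 H).
apply: contraTneq (_ : d%:~R * k ^+ 2 != 0) => [e0|].
  by rewrite -H e0 expr0n mul0r eqxx.
by rewrite mulf_neq0 ?expf_neq0// intr_eq0 squarefreez_neq0.
Qed.

Section BaseChangeIso.
Variables (R : realType) (A : fdLieAlgType rat) (g : lieAlgType R) (n : nat).
Variables (e : 'I_n -> A) (q : 'I_n -> A -> rat).
Variables (phi : A -> g) (c : 'I_n -> g -> R).
Hypothesis phi_lin : forall a x y, phi (a *: x + y) = ratr a *: phi x + phi y.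
Hypothesis phi_lieb : forall x y, phi (lieb x y) = lieb (phi x) (phi y).
Hypothesis c_lin : forall k a u v, c k (a *: u + v) = a * c k u + c k v.
Hypothesis e_gen : forall x, x = \sum_k q k x *: e k.
Hypothesis phi_gen : forall u, u = \sum_k c k u *: phi (e k).
Hypothesis c_phi : forall k x, c k (phi x) = ratr (q k x).

Local Notation b := (vbasis {:A}).
Local Notation N := (\dim {:A}).

Let f (x : base_change R A) : g := \sum_(i < N) x 0 i *: phi b`_i.

Let f_lin : linear f.
Proof.
move=> a x y; rewrite /f scaler_sumr -big_split /=; apply: eq_bigr => i _.
by rewrite !mxE scalerDl scalerA.
Qed.

Let phi0 : phi 0 = 0.
Proof.
by have := phi_lin (-1) 0 0; rewrite !scaleN1r rmorphN1 oppr0 addr0 scaleN1r addNr.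
Qed.

Let phiZ a x : phi (a *: x) = ratr a *: phi x.
Proof. by have := phi_lin a x 0; rewrite phi0 !addr0. Qed.

Let phi_sum I r (P : pred I) (F : I -> A) :
  phi (\sum_(i <- r | P i) F i) = \sum_(i <- r | P i) phi (F i).
Proof.
elim/big_rec2: _ => [|i u v _ <-]; first exact: phi0.
by rewrite -[F i]scale1r phi_lin rmorph1 !scale1r.
Qed.

Let c_sum k I r (P : pred I) (a : I -> R) (u : I -> g) :
  c k (\sum_(i <- r | P i) a i *: u i) = \sum_(i <- r | P i) a i * c k (u i).
Proof.
have c0 : c k 0 = 0.
  by have := c_lin k (-1) 0 0; rewrite scaleN1r oppr0 addr0 mulN1r addNr.
by elim/big_rec2: _ => [//|i x y _ <-]; rewrite c_lin.
Qed.

Let f_tens a s : f (@tens R A a s) = s *: phi a.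
Proof.
have Ea : a = \sum_i coord b i a *: b`_i by exact: coord_vbasis (memvf _).
rewrite [in RHS]Ea phi_sum scaler_sumr /f; apply: eq_bigr => i _.
by rewrite mxE phiZ scalerA.
Qed.

Let f_lieb x y : f (lieb x y) = lieb (f x) (f y).
Proof.
rewrite {1}(base_change_sumE x) {1}(base_change_sumE y).
rewrite (lin_sum (lieb_linearl _)) (lin_sum f_lin) {2}/f (lin_sum (lieb_linearl _)).
apply: eq_bigr => i _.
rewrite (lin_sum (lieb_linearr _)) (lin_sum f_lin) /f (lin_sum (lieb_linearr _)).
apply: eq_bigr => j _.
rewrite -/(f _) [lieb _ _]lieb_tens f_tens phi_lieb.
rewrite (lin_scale (lieb_linearl _)) (lin_scale (lieb_linearr _)) scalerA.
by [].
Qed.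

Let psi (u : g) : base_change R A := \sum_k c k u *: @tens R A (e k) 1.

Let fK : cancel f psi.
Proof.
move=> x; rewrite /psi [RHS]base_change_sumE.
under eq_bigr do rewrite /f c_sum scaler_suml.
rewrite exchange_big; apply: eq_bigr => i _ /=.
rewrite [in RHS](e_gen b`_i) tens_suml; apply: eq_bigr => k _.
by rewrite c_phi tensZl -[ratr _ * _ in RHS]mulr1 tensZr mulrC.
Qed.

Let psiK : cancel psi f.
Proof.
move=> u; rewrite [RHS]phi_gen /psi (lin_sum f_lin); apply: eq_bigr => k _.
by rewrite (lin_scale f_lin) f_tens scale1r.
Qed.

(** [base_change] is written in the internal basis [vbasis], whereas [e] is any convenient basis. So
    [f] extends [phi] along the former, the inverse [psi] is written in the latter, and [c_phi]
    reconciles the two. *)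
Lemma base_change_iso : rational_structure g A.
Proof. apply: (lie_iso_of f_lin _ f_lieb); exists psi; [exact: fK|exact: psiK]. Qed.

End BaseChangeIso.

Lemma nd_expand d (x : nd d) : x = \sum_(k < 6) x 0 k *: nd_basis d k.+1.
Proof.
apply: nd_ext => i hi; rewrite /nd_coord summxE.
under eq_bigr do rewrite !mxE eqxx inord_val.
rewrite (bigD1 (inord i.-1)) //= eqxx mulr1 big1 ?addr0// => k kj.
by rewrite eq_sym (negPf kj) mulr0.
Qed.

Section NdStructures.
Variables (R : realType) (d : int).

(** Here e_1, e_2 and e_3, e_4 and e_6, e_5 are f_1, f_2, f_3 and their multiples by sqrt(-d) = i
    sqrt d. *)
Lemma nd_complex : 0 < d ->
  rational_structure (heis_lie (Rcomplex R) : lieAlgType R) (nd d).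
Proof.
move=> d0; pose s : R := Num.sqrt d%:~R.
have s0 : s != 0 by rewrite sqrtr_eq0 -ltNge ltr0z.
have s2 : s * s = d%:~R by rewrite -expr2 sqr_sqrtr// ler0z ltW.
pose C (x : nd d) i j : Rcomplex R :=
  Complex (ratr (nd_coord x i)) (ratr (nd_coord x j) * s).
pose phi (x : nd d) : heis_lie (Rcomplex R) := (C x 1%N 2%N, C x 3%N 4%N, C x 6%N 5%N).
pose c (k : 'I_6) (u : heis_lie (Rcomplex R)) : R :=
  nth 0 [:: complex.Re u.1.1; complex.Im u.1.1 / s; complex.Re u.1.2;
    complex.Im u.1.2 / s; complex.Im u.2 / s; complex.Re u.2] k.
apply: (@base_change_iso R (nd d) (heis_lie (Rcomplex R)) 6 (fun k => nd_basis d k.+1)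
  (fun k x => x 0 k) phi c).
- move=> a x y; congr (_, _, _); rewrite /C; congr Complex;
    rewrite !nd_coordD !nd_coordZ rmorphD rmorphM /=; ring.
- move=> x y; congr (_, _, _); rewrite /C !nd_coord_lieb//= /w5 /w6.
  + by rewrite rmorph0 mul0r.
  + by rewrite rmorph0 mul0r.
  congr Complex; rewrite /= ?rmorphB ?rmorphD /= ?rmorphM ?rmorphB ?rmorphM /= ?ratr_int -?s2; ring.
- case=> [[|[|[|[|[|[|//]]]]]] ?] a [[[u1 u2] [v1 v2]] [w1 w2]]
    [[[u1' u2'] [v1' v2']] [w1' w2']]; rewrite /c /=; ring.
- exact: nd_expand.
- move=> [[[x1 x2] [y1 y2]] [z1 z2]]; rewrite !big_ord_recl big_ord0.
  have CB i j k : (0 < i < 7)%N -> (0 < j < 7)%N -> (0 < k < 7)%N ->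
      C (nd_basis d i) j k = Complex (j == i)%:R ((k == i)%:R * s).
    by move=> hi hj hk; rewrite /C !nd_coord_basis// !ratr_nat.
  rewrite /phi !CB// /c /=.
  by congr (_, _, _); congr Complex; rewrite /=; field.
- case=> [[|[|[|[|[|[|//]]]]]] ?] x; rewrite /c /= ?mulfK// /nd_coord /=;
    congr (ratr (x _ _)); apply/val_inj; rewrite /= inordK//.
Qed.

(** The two factors receive the two real values of sqrt(-d), namely [s] and [- s]; half sums and
    half differences ([p] and [m]) recover the rational coordinates. For d = -1 this is the
    splitting Q[t]/(t^2 - 1) = Q x Q. *)
Lemma nd_split : d < 0 ->
  rational_structure (heis_lie R^o * heis_lie R^o : lieAlgType R)%type (nd d).
Proof.
move=> d0; pose s : R := Num.sqrt (- d%:~R).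
have s0 : s != 0 by rewrite sqrtr_eq0 -ltNge oppr_gt0 ltrz0.
have s2 : s * s = - d%:~R by rewrite -expr2 sqr_sqrtr// oppr_ge0 lerz0 ltW.
have scE (a : R) (b : R^o) : a *: b = a * b by [].
pose C (t : R) (x : nd d) i j : R := ratr (nd_coord x i) + ratr (nd_coord x j) * t.
pose h t (x : nd d) : heis_lie R^o := (C t x 1%N 2%N, C t x 3%N 4%N, C t x 6%N 5%N).
pose phi (x : nd d) : (heis_lie R^o * heis_lie R^o)%type := (h s x, h (- s) x).
pose p (x y : R) : R := (x + y) / 2; pose m (x y : R) : R := (x - y) / 2 / s.
pose c (k : 'I_6) (u : (heis_lie R^o * heis_lie R^o)%type) : R :=
  nth 0 [:: p u.1.1.1 u.2.1.1; m u.1.1.1 u.2.1.1;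
    p u.1.1.2 u.2.1.2; m u.1.1.2 u.2.1.2; m u.1.2 u.2.2; p u.1.2 u.2.2] k.
apply: (@base_change_iso R (nd d) (heis_lie R^o * heis_lie R^o)%type 6 (fun k => nd_basis d k.+1)
  (fun k x => x 0 k) phi c).
- move=> a x y; congr ((_, _, _), (_, _, _)); rewrite [in RHS]/= ?scE /C
    !nd_coordD !nd_coordZ !rmorphD !rmorphM /=; ring.
- move=> x y.
  have zc t : t * t = - d%:~R ->
      C t (lieb x y) 6%N 5%N = C t x 1%N 2%N * C t y 3%N 4%N - C t x 3%N 4%N * C t y 1%N 2%N.
    move=> t2; rewrite /C !nd_coord_lieb//= /w5 /w6.
    rewrite /= ?rmorphB ?rmorphD /= ?rmorphM ?rmorphB ?rmorphM /= ?ratr_int.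
    by rewrite -[d%:~R]opprK -t2; ring.
  have xyc t i j : (0 < i < 5)%N -> (0 < j < 5)%N -> C t (lieb x y) i j = 0.
    move=> hi hj; have w k : (0 < k < 5)%N -> (0 < k < 7)%N.
      by case/andP => -> k5; exact: ltn_trans k5 _.
    rewrite /C !nd_coord_lieb ?w//.
    have n k : (0 < k < 5)%N -> ((k == 5) = false) * ((k == 6) = false).
      by move: k => [|[|[|[|[|]]]]].
    by rewrite !n// rmorph0 mul0r addr0.
  by rewrite /phi /h !(xyc _ 1%N 2%N, xyc _ 3%N 4%N)// !zc// mulrNN.
- by case=> [[|[|[|[|[|[|//]]]]]] ?] a [[[u1 u2] u3] [[u4 u5] u6]] [[[v1 v2] v3] [[v4 v5] v6]];
    rewrite /c /p /m /= /GRing.scale /=; field.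
- exact: nd_expand.
- move=> [[[x1 x2] x3] [[y1 y2] y3]]; rewrite !big_ord_recl big_ord0.
  have CB t i j k : (0 < i < 7)%N -> (0 < j < 7)%N -> (0 < k < 7)%N ->
      C t (nd_basis d i) j k = (j == i)%:R + (k == i)%:R * t.
    by move=> hi hj hk; rewrite /C !nd_coord_basis// !ratr_nat.
  rewrite /phi /h !CB// /c /=.
  by congr ((_, _, _), (_, _, _)); rewrite /p /m /= !scE; field.
- case=> [[|[|[|[|[|[|//]]]]]] ?] x;
    rewrite /c /p /m /= /C; (transitivity (ratr (nd_coord x 1) : R); first by field) ||
    (transitivity (ratr (nd_coord x 2) : R); first by field) ||
    (transitivity (ratr (nd_coord x 3) : R); first by field) ||
    (transitivity (ratr (nd_coord x 4) : R); first by field) ||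
    (transitivity (ratr (nd_coord x 5) : R); first by field) ||
    (transitivity (ratr (nd_coord x 6) : R); first by field).
  all: by rewrite /nd_coord; congr (ratr (x _ _)); apply/val_inj; rewrite /= inordK.
Qed.
End NdStructures.

(** * Non-commensurability of the lattices H_1(Z[s]) *)

Section IntegerPowers.
Variables (G : groupType) (S : comNzRingType) (F : G -> heis S).
Hypothesis FM : {morph F : x y / (x * y)%g}.

Definition expgz (x : G) (n : int) : G :=
  match n with Posz n => (x ^+ n)%g | Negz n => (x ^- n.+1)%g end.

Lemma expgz_central x u n : F x = hmk 0 0 u -> F (expgz x n) = hmk 0 0 (n%:~R * u).
Proof.
have [F1 FV] := morph_gen FM.
have FX k : F (x ^+ k)%g = (F x ^+ k)%g.
  by elim: k => [|k IH]; rewrite ?expg0 // !expgS FM IH.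
move=> Fx; apply: heis_ext.
- by case: n => n; rewrite /= ?FV FX Fx ?hxV hxX !hE mul0rn ?oppr0.
- by case: n => n; rewrite /= ?FV FX Fx ?hyV hyX !hE mul0rn ?oppr0.
- case: n => n; rewrite /= ?FV FX Fx ?hzV hzX ?hxX ?hyX !hE mul0r.
    by rewrite mul0rn addr0 -mulr_natl.
  by rewrite !mul0rn mul0r !addr0 NegzE mulrNz mulNr -mulr_natl.
Qed.

(** The right-hand side mentions the abstract group only, so comparing two embeddings [F] of one
    group transports integer linear relations from one ring to the other. *)
Lemma expgz_relation p q u v a b : F p = hmk 0 0 u -> F q = hmk 0 0 v ->
  (forall x, F x = 1%g -> x = 1%g) ->
  (a%:~R * u + b%:~R * v = 0) <-> (expgz p a * expgz q b = 1)%g.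
Proof.
have [F1 _] := morph_gen FM.
move=> Fp Fq Finj.
have E : F (expgz p a * expgz q b)%g = hmk 0 0 (a%:~R * u + b%:~R * v).
  by rewrite FM (expgz_central a Fp) (expgz_central b Fq) hmkM !addr0 mul0r addr0.
split=> [e0|e]; first by apply: Finj; rewrite E e0; apply: heis_ext; rewrite !hE.
by have := congr1 (@hz S) E; rewrite e F1 !hE.
Qed.

End IntegerPowers.

Lemma morph_inj1 (G H : groupType) (F : G -> H) : {morph F : x y / (x * y)%g} ->
  injective F -> forall x, F x = 1%g -> x = 1%g.
Proof. by move=> FM Finj x Fx; have [F1 _] := morph_gen FM; apply: Finj; rewrite F1. Qed.

Lemma hmkRX (S : comNzRingType) (g h : heis S) n :
  [~ g ^+ n, h ^+ n]%g = hmk 0 0 (n%:R * n%:R * (hx g * hy h - hx h * hy g)).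
Proof.
rewrite hmkR !hxX !hyX -(mulr_natl (hx g)) -(mulr_natl (hx h)).
by rewrite -(mulr_natl (hy g)) -(mulr_natl (hy h)); congr hmk; ring.
Qed.

Section NonCommensurable.
Variables (S S' : comNzRingType) (s : S) (s' : S') (d d' : int).
Hypothesis s2 : s * s = (- d)%:~R.
Hypothesis s2' : s' * s' = (- d')%:~R.
Hypothesis s_free : forall a b : int, a%:~R + b%:~R * s = 0 -> a = 0 /\ b = 0.
Hypothesis s_free' : forall a b : int, a%:~R + b%:~R * s' = 0 -> a = 0 /\ b = 0.
Hypotheses (sd : squarefreez d) (sd' : squarefreez d').

(** The common subgroup has two embeddings [F] and [G]. Suitable powers of the elements with
    coordinates 1 and s satisfy the relations of n_d in [F]; these hold in [G] as well, where [w5]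
    and [w6] compute the commutators, and [pfaffian_disc] applies over Z. *)
Lemma lattice_commensurable_eq (A B : groupType) (f : A -> heis S) (g : B -> heis S') :
  {morph f : x y / (x * y)%g} -> {morph g : x y / (x * y)%g} ->
  injective f -> injective g ->
  (forall h, inner s 1 h -> exists a, f a = h) -> (forall b, inner s' 1 (g b)) ->
  commensurable A B -> d = d'.
Proof.
move=> fM gM finj ginj fin gin [U [V [Ufin Vfin [phi phib]]]].
have phiM : {morph phi : x y / (x * y)%g} by exact: gmulfM.
pose F (u : subgroup_of U) := f (val u).
pose G (u : subgroup_of U) := g (val (phi u)).
have FM : {morph F : x y / (x * y)%g} by move=> x y; rewrite /F valM fM.
have GM : {morph G : x y / (x * y)%g} by move=> x y; rewrite /G phiM valM gM.
have Finj : injective F by move=> x y /finj/val_inj.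
have Ginj : injective G by move=> x y /ginj/val_inj/(bij_inj phib).
(* [E 1], ..., [E 4] are (1,0,0), (s,0,0), (0,1,0), (0,s,0), the analogues of e_1, ..., e_4; index 0
   is padding. *)
pose E i : heis S := hmk (nth 0 [:: 0; 1; s] i) (nth 0 [:: 0; 0; 0; 1; s] i) 0.
have nthz (l : seq S) i : {subset l <= [:: 0; 1; s]} -> zlat s (nth 0 l i).
  move=> H; have [lt|ge] := ltnP i (size l); last by rewrite nth_default//; exact: zlat0.
  have := H _ (mem_nth 0 lt); rewrite !inE => /or3P[]/eqP->;
    [exact: zlat0|exact: (zlat_int s 1)|exact: zlat_gen].
have exE i : exists a, f a = E i.
  apply: fin; exists (nth 0 [:: 0; 1; s] i), (nth 0 [:: 0; 0; 0; 1; s] i), 0.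
  split; last by rewrite !hE !mul1r.
  split; [exact: nthz|apply: nthz|exact: zlat0].
  by move=> t; rewrite !inE => /orP[->//|/orP[->//|]] /or3P[]->; rewrite ?orbT.
have [x xE] := choice exE.
have ex_n i : exists n, (0 < n)%N && ((x i ^+ n)%g \in U).
  by have [n n0 nU] := finite_index_expg (x i) Ufin; exists n; rewrite n0.
have [n nP] := choice ex_n.
have [N N0 NU] : exists2 N, (0 < N)%N & forall i, (0 < i < 5)%N -> (x i ^+ N)%g \in U.
  exists (n 1 * n 2 * n 3 * n 4)%N.
    by rewrite !muln_gt0 !(fun i => proj1 (andP (nP i))).
  move=> i hi; have st k : (n i %| k)%N -> (x i ^+ k)%g \in U.
    by move=> /dvdnP[j ->]; rewrite mulnC expgnA gpredXn//; case/andP: (nP i).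
  move: i st hi => [|[|[|[|[|]]]]] // st _; apply: st.
  - by rewrite -!mulnA dvdn_mulr.
  - by rewrite -!mulnA dvdn_mull// dvdn_mulr.
  - by rewrite dvdn_mulr// dvdn_mull.
  - by rewrite dvdn_mull.
have ey i : exists y : subgroup_of U, (0 < i < 5)%N -> val y = (x i ^+ N)%g.
  have [hi|_] := boolP (0 < i < 5)%N; last by exists 1%g.
  by exists (SubgroupOf (NU i hi)).
have [y yE] := choice ey.
have fX (a : A) k : f (a ^+ k)%g = (f a ^+ k)%g.
  by elim: k => [|k IH]; rewrite ?expg0 ?(morph_gen fM).1 // !expgS fM IH.
have FR i j : (0 < i < 5)%N -> (0 < j < 5)%N -> F [~ y i, y j]%g =
    hmk 0 0 (N%:R * N%:R * (hx (E i) * hy (E j) - hx (E j) * hy (E i))).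
  move=> hi hj; have [_ FV] := morph_gen FM.
  rewrite /commg /conjg !FM !FV -/(conjg _ _) -/(commg _ _) /F !yE// !fX !xE hmkRX.
  by [].
pose P i j : int := nth 0 [:: 0; (zcoord s' (hx (G (y i)))).1; (zcoord s' (hx (G (y i)))).2;
  (zcoord s' (hy (G (y i)))).1; (zcoord s' (hy (G (y i)))).2] j.
have GE i : hx (G (y i)) = (P i 1%N)%:~R + (P i 2%N)%:~R * s' /\
    hy (G (y i)) = (P i 3%N)%:~R + (P i 4%N)%:~R * s'.
  have [a [b [c [[aL bL _] [ex ey' _]]]]] := gin (val (phi (y i))).
  by split; apply: zcoordE; rewrite /G ?ex ?ey' mul1r.
have GR i j : G [~ y i, y j]%g =
    hmk 0 0 ((w6 d' (P i) (P j))%:~R + (w5 (P i) (P j))%:~R * s').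
  have [_ GV] := morph_gen GM.
  rewrite /commg /conjg !GM !GV -/(conjg _ _) -/(commg _ _) hmkR.
  have [-> ->] := GE i; have [-> ->] := GE j; congr hmk.
  have s2'' : d'%:~R = - (s' * s') by rewrite s2' rmorphN opprK.
  by rewrite /w5 /w6 !(rmorphB, rmorphD, rmorphM) /= s2''; ring.
(* An integer relation between two commutators holds in S exactly when both of its coordinates hold
   in Z[s']. *)
have tr i j k l a b : (0 < i < 5)%N -> (0 < j < 5)%N -> (0 < k < 5)%N -> (0 < l < 5)%N ->
   (a%:~R * (N%:R * N%:R * (hx (E i) * hy (E j) - hx (E j) * hy (E i))) +
    b%:~R * (N%:R * N%:R * (hx (E k) * hy (E l) - hx (E l) * hy (E k))) = 0) <->
   (a * w6 d' (P i) (P j) + b * w6 d' (P k) (P l) = 0 /\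
    a * w5 (P i) (P j) + b * w5 (P k) (P l) = 0).
  move=> hi hj hk hl.
  rewrite (expgz_relation FM a b (FR i j hi hj) (FR k l hk hl) (morph_inj1 FM Finj)).
  rewrite -(expgz_relation GM a b (GR i j) (GR k l) (morph_inj1 GM Ginj)).
  have lin (t u t' u' : int) : a%:~R * (t%:~R + u%:~R * s') + b%:~R * (t'%:~R + u'%:~R * s') =
      (a * t + b * t')%:~R + (a * u + b * u')%:~R * s'.
    by rewrite !rmorphD !rmorphM /=; ring.
  rewrite lin.
  by split=> [/s_free'//|[-> ->]]; rewrite mul0r addr0.
have sub_eq (t u c : int) : 1 * t + c * u = 0 -> t = - c * u.
  by move=> e; apply/eqP; rewrite -subr_eq0 -e; apply/eqP; ring.
have [r14 r23] : w6 d' (P 1) (P 4) = w6 d' (P 2) (P 3) /\ w5 (P 1) (P 4) = w5 (P 2) (P 3).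
  have [h6 h5] : 1 * w6 d' (P 1) (P 4) + -1 * w6 d' (P 2) (P 3) = 0 /\
      1 * w5 (P 1) (P 4) + -1 * w5 (P 2) (P 3) = 0.
    by apply/(tr 1%N 4%N 2%N 3%N) => //; rewrite /E !hE /=; ring.
  by rewrite (sub_eq _ _ _ h6) (sub_eq _ _ _ h5) opprK !mul1r.
have [q24 q13] : w6 d' (P 2) (P 4) = - d * w6 d' (P 1) (P 3) /\
    w5 (P 2) (P 4) = - d * w5 (P 1) (P 3).
  have [h6 h5] : 1 * w6 d' (P 2) (P 4) + d * w6 d' (P 1) (P 3) = 0 /\
      1 * w5 (P 2) (P 4) + d * w5 (P 1) (P 3) = 0.
    apply/(tr 2%N 4%N 1%N 3%N) => //; rewrite /E !hE /=.
    have -> : d%:~R = - (s * s) by rewrite s2 rmorphN opprK.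
    by ring.
  by rewrite (sub_eq _ _ _ h6) (sub_eq _ _ _ h5).
have zero i j : (0 < i < 5)%N -> (0 < j < 5)%N -> hx (E i) * hy (E j) - hx (E j) * hy (E i) = 0 ->
    w6 d' (P i) (P j) = 0 /\ w5 (P i) (P j) = 0.
  move=> hi hj e; have [h6 h5] : 1 * w6 d' (P i) (P j) + 0 * w6 d' (P i) (P j) = 0 /\
      1 * w5 (P i) (P j) + 0 * w5 (P i) (P j) = 0.
    by apply/(tr i j i j) => //; rewrite e; ring.
  by move: h6 h5; rewrite !mul1r !mul0r !addr0.
have [z12 z12'] : w6 d' (P 1) (P 2) = 0 /\ w5 (P 1) (P 2) = 0.
  by apply: zero => //; rewrite /E !hE /=; ring.
have [z34 z34'] : w6 d' (P 3) (P 4) = 0 /\ w5 (P 3) (P 4) = 0.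
  by apply: zero => //; rewrite /E !hE /=; ring.
(* The two commutators are N^2 s and N^2, so their independence comes from that of s and 1; it then
   forces [k] to be nonzero. *)
have indep a b : a * w6 d' (P 1) (P 4) + b * w6 d' (P 1) (P 3) = 0 ->
    a * w5 (P 1) (P 4) + b * w5 (P 1) (P 3) = 0 -> a = 0 /\ b = 0.
  move=> h6 h5; have := conj h6 h5; rewrite -(tr 1%N 4%N 1%N 3%N)//.
  have -> : hx (E 1) * hy (E 4) - hx (E 4) * hy (E 1) = s by rewrite /E !hE /=; ring.
  have -> : hx (E 1) * hy (E 3) - hx (E 3) * hy (E 1) = 1 by rewrite /E !hE /=; ring.
  move=> e; have [|b0 a0] := s_free (a := b * (N * N)%:Z) (b := a * (N * N)%:Z).
    by rewrite -[RHS]e !rmorphM /= -!pmulrn; ring.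
  have NN : (N * N)%:Z != 0 by rewrite eqz_nat -lt0n muln_gt0 N0.
  by split; apply/eqP; [move/eqP: a0|move/eqP: b0]; rewrite mulf_eq0 (negPf NN) orbF.
have [e He] := pfaffian_disc r23 r14 q13 q24 z12' z12 z34' z34.
move: He; set k := _ - _ => He.
have k0 : k != 0.
  apply/eqP => k0.
  have [||a0 _] := indep (w5 (P 1) (P 3)) (- w5 (P 1) (P 4)).
  - by transitivity (- k); [rewrite /k; ring|rewrite k0 oppr0].
  - by ring.
  have [||c0 _] := indep (w6 d' (P 1) (P 3)) (- w6 d' (P 1) (P 4)).
  - by ring.
  - by rewrite -[RHS]k0 /k; ring.
  have [||_ /eqP] := indep 0 1; last by rewrite oner_eq0.
  - by rewrite c0 mul0r mulr0 addr0.
  - by rewrite a0 mul0r mulr0 addr0.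
have He' : (e%:~R : rat) ^+ 2 * d'%:~R = d%:~R * (k%:~R) ^+ 2.
  by rewrite !expr2 -!rmorphM /= -expr2 He expr2.
apply: (squarefreez_unique sd sd' _ _ He'); last by rewrite intr_eq0.
rewrite intr_eq0; apply: contraTneq (_ : d * k ^+ 2 != 0) => [e0|].
  by rewrite -He e0 expr0n mul0r eqxx.
by rewrite mulf_neq0 ?expf_neq0// squarefreez_neq0.
Qed.

End NonCommensurable.

(** * Normal form of a lattice *)

Section Dirichlet.
Variables (R : realType) (P : R -> R -> Prop) (e : R).
Hypothesis PB : forall s t s' t', P s t -> P s' t' -> P (s - s') (t - t').
Hypothesis PZ : forall a b : int, P a%:~R b%:~R.
Hypothesis e0 : 0 < e.
Hypothesis P_discrete : forall s t, P s t -> `|s| < e -> `|t| < e -> s = 0 /\ t = 0.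

(* Pigeonhole on the fractional parts of the multiples of (s, t) in a Q x Q grid. *)
Lemma discrete_finite_index : exists2 n : nat, (0 < n)%N & forall s t, P s t ->
  exists a b : int, n%:R * s = a%:~R /\ n%:R * t = b%:~R.
Proof.
pose Q := (Num.truncn e^-1).+1.
have Qe : Q%:R^-1 < e.
  rewrite invf_plt ?posrE// ?ltr0n//.
  exact: truncnS_gt.
(* Pigeonhole gives a multiplier between 1 and Q^2 that depends on (s, t); the factorial is a common
   multiple of all of them. *)
exists (Q ^ 2)`!; first exact: fact_gt0.
move=> s t Pst.
pose fr (x : R) := x - (Num.floor x)%:~R.
have fr0 x : 0 <= fr x by rewrite subr_ge0 floor_le.
have fr1 x : fr x < 1.
  by have := floorD1_gt x; rewrite rmorphD /= /fr ltrBlDr addrC.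
pose box (x : R) : 'I_Q := inord (Num.truncn (Q%:R * fr x)).
have boxE x : box x = Num.truncn (Q%:R * fr x) :> nat.
  by rewrite inordK// truncn_lt_nat ?mulr_ge0// gtr_pMr// ltr0n.
have close x y : box x = box y -> `|fr x - fr y| < e.
  move=> /(congr1 val); rewrite /= !boxE => E.
  apply: lt_trans Qe; have Q0 : 0 < Q%:R :> R by rewrite ltr0n.
  rewrite -(ltr_pM2l Q0) mulfV ?gt_eqF// -[X in X * _]ger0_norm ?ltW// -normrM mulrBr.
  have /andP[] := truncn_itv (mulr_ge0 (ltW Q0) (fr0 x)).
  have /andP[] := truncn_itv (mulr_ge0 (ltW Q0) (fr0 y)).
  by rewrite E -natr1 ltr_norml; move: (_%:R) => T *; apply/andP; split; lra.
have PN u v : P u v -> P (- u) (- v).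
  by move=> Puv; have := PB (PZ 0 0) Puv; rewrite !sub0r.
have PX k : P (k%:R * s) (k%:R * t).
  elim: k => [|k IH]; first by rewrite !mul0r; exact: (PZ 0 0).
  have := PB IH (PN _ _ Pst); congr P; rewrite -natr1; ring.
pose f (k : 'I_(Q ^ 2).+1) := (box (k%:R * s), box (k%:R * t)).
have /injectivePn[k [k' kk' fk]] : ~~ injectiveb f.
  apply/injectiveP => /leq_card; rewrite card_prod !card_ord -[(Q * Q)%N]/(Q ^ 2)%N.
  by rewrite ltnn.
wlog lt_kk' : k k' kk' fk / (k < k')%N.
  move=> W; have [lt|lt|/val_inj ee] := ltngtP k k'; first exact: (W k k').
    by apply: (W k' k) => //; rewrite eq_sym.
  by rewrite ee eqxx in kk'.
have [f1 f2] : box (k%:R * s) = box (k'%:R * s) /\ box (k%:R * t) = box (k'%:R * t).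
  by case: fk.
have Pfr l : P (fr (l%:R * s)) (fr (l%:R * t)) by apply: PB => //; exact: PX.
have [] := P_discrete (PB (Pfr k) (Pfr k')) (close _ _ f1) (close _ _ f2).
move=> e1 e2.
have /dvdnP[c ->] : (k' - k %| (Q ^ 2)`!)%N.
  apply: dvdn_fact; rewrite subn_gt0 lt_kk' /=.
  by apply: leq_trans (leq_subr _ _) _; rewrite -ltnS.
exists (c%:Z * (Num.floor (k'%:R * s) - Num.floor (k%:R * s))),
  (c%:Z * (Num.floor (k'%:R * t) - Num.floor (k%:R * t))).
rewrite natrM natrB ?(ltnW lt_kk')// !rmorphM !rmorphB /= -!pmulrn.
have intE (x y : R) : fr x - fr y = 0 -> (Num.floor y)%:~R - (Num.floor x)%:~R = y - x.
  by rewrite /fr => h; apply/eqP; rewrite -subr_eq0 -h; apply/eqP; ring.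
by rewrite !intE//; split; ring.
Qed.
End Dirichlet.

Section AdditiveSubgroup.
Variables (V : zmodType) (P : V -> Prop).
Hypothesis P0 : P 0.
Hypothesis PB : forall x y, P x -> P y -> P (x - y).

Lemma sub_closedD x y : P x -> P y -> P (x + y).
Proof. by move=> Px Py; rewrite -[y]opprK -[- y]sub0r; apply: PB => //; exact: PB. Qed.

Lemma sub_closedMz x (n : int) : P x -> P (x *~ n).
Proof.
move=> Px; have PN k : P (x *+ k).
  by elim: k => [//|k IH]; rewrite mulrS; exact: sub_closedD.
by case: n => n; [exact: PN|rewrite NegzE mulrNz -sub0r; exact/PB/PN].
Qed.
End AdditiveSubgroup.

Lemma sqr_absz_intr (A : nzRingType) (D : int) : (`|D| ^ 2)%N%:R = D%:~R ^+ 2 :> A.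
Proof.
rewrite -rmorphXn /=; have -> : D ^+ 2 = (`|D| ^ 2)%N :> int.
  by rewrite -[LHS]gez0_abs ?sqr_ge0// abszX.
by rewrite -pmulrn.
Qed.

(* S is the real algebra R[j], j^2 = eps: C for eps = -1 and R x R for eps = 1. *)
Section QuadraticAlgebra.
Variables (R : realType) (S : comNzRingType) (r : {rmorphism R -> S}) (j : S) (eps : R).
Variables (re im : S -> R).
Hypothesis jj : j * j = r eps.
Hypothesis eps0 : eps != 0.
Hypothesis reim : forall x, x = r (re x) + r (im x) * j.
Hypothesis reE : forall a b, re (r a + r b * j) = a.
Hypothesis imE : forall a b, im (r a + r b * j) = b.

Lemma qa_ext x y : re x = re y -> im x = im y -> x = y.
Proof. by move=> e f; rewrite (reim x) (reim y) e f. Qed.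

Lemma qa_addE x y : x + y = r (re x + re y) + r (im x + im y) * j.
Proof. by rewrite {1}(reim x) {1}(reim y) !rmorphD; ring. Qed.

Lemma reD x y : re (x + y) = re x + re y.
Proof. by rewrite qa_addE reE. Qed.

Lemma imD x y : im (x + y) = im x + im y.
Proof. by rewrite qa_addE imE. Qed.

Lemma qa_mulE x y : x * y =
  r (re x * re y + eps * im x * im y) + r (re x * im y + im x * re y) * j.
Proof.
rewrite {1}(reim x) {1}(reim y) !rmorphD !rmorphM -jj; ring.
Qed.

Lemma reM x y : re (x * y) = re x * re y + eps * im x * im y.
Proof. by rewrite qa_mulE reE. Qed.

Lemma imM x y : im (x * y) = re x * im y + im x * re y.
Proof. by rewrite qa_mulE imE. Qed.

Lemma re_r a : re (r a) = a.
Proof. by rewrite -[r a]addr0 -[0](mul0r j) -[X in X * j](rmorph0 r) reE. Qed.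

Lemma im_r a : im (r a) = 0.
Proof. by rewrite -[r a]addr0 -[0](mul0r j) -[X in X * j](rmorph0 r) imE. Qed.

Lemma re_j : re j = 0.
Proof. by rewrite -[j]add0r -[j in X in re X]mul1r -(rmorph0 r) -(rmorph1 r) reE. Qed.

Lemma im_j : im j = 1.
Proof. by rewrite -[j]add0r -[j in X in im X]mul1r -(rmorph0 r) -(rmorph1 r) imE. Qed.

Lemma reN x : re (- x) = - re x.
Proof. by apply/eqP; rewrite -addr_eq0 -reD addNr -(rmorph0 r) re_r. Qed.

Lemma imN x : im (- x) = - im x.
Proof. by apply/eqP; rewrite -addr_eq0 -imD addNr -(rmorph0 r) im_r. Qed.

Lemma re0 : re 0 = 0. Proof. by rewrite -(rmorph0 r) re_r. Qed.
Lemma im0 : im 0 = 0. Proof. by rewrite -(rmorph0 r) im_r. Qed.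
Lemma re1 : re 1 = 1. Proof. by rewrite -(rmorph1 r) re_r. Qed.
Lemma im1 : im 1 = 0. Proof. by rewrite -(rmorph1 r) im_r. Qed.

Lemma r_inj : injective r.
Proof. by move=> a b e; rewrite -[a]re_r e re_r. Qed.

Lemma qa_torsion_free (n : nat) (x : S) : (0 < n)%N -> n%:R * x = 0 -> x = 0.
Proof.
move=> n0 nx; have -> : x = r (n%:R^-1) * (n%:R * x).
  by rewrite mulrA -(rmorph_nat r) -rmorphM mulVf ?rmorph1 ?mul1r// pnatr_eq0 -lt0n.
by rewrite nx mulr0.
Qed.

Definition qconj x := r (re x) - r (im x) * j.
(** R x R has zero divisors, so invertibility is expressed by a nonzero norm; [mul_conj] then
    provides the inverse. *)
Definition qnorm x := re x ^+ 2 - eps * im x ^+ 2.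

Lemma re_conj x : re (qconj x) = re x.
Proof. by rewrite /qconj -mulNr -rmorphN reE. Qed.

Lemma im_conj x : im (qconj x) = - im x.
Proof. by rewrite /qconj -mulNr -rmorphN imE. Qed.

Lemma mul_conj x : x * qconj x = r (qnorm x).
Proof. by rewrite /qconj {1}(reim x) /qnorm rmorphB !rmorphM -jj; ring. Qed.

Lemma conjK : involutive qconj.
Proof. by move=> x; apply: qa_ext; rewrite ?re_conj ?im_conj ?opprK. Qed.

Lemma conj0 x : qconj x = 0 -> x = 0.
Proof.
by move=> x0; rewrite -[x]conjK x0 /qconj re0 im0 rmorph0 mul0r subr0.
Qed.

Lemma conjM x y : qconj (x * y) = qconj x * qconj y.
Proof.
by apply: qa_ext; rewrite ?(re_conj, im_conj, reM, imM); ring.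
Qed.

Lemma qnorm_polar x y : qnorm x = 0 -> qnorm y = 0 -> qnorm (x + y) = 0 ->
  re (qconj x * y) = 0.
Proof.
move=> x0 y0 xy0; apply: (@mulfI _ 2); first by rewrite pnatr_eq0.
transitivity (qnorm (x + y) - qnorm x - qnorm y); last by rewrite x0 y0 xy0; ring.
by rewrite /qnorm !reM re_conj im_conj reD imD; ring.
Qed.

Definition omega (g h : heis S) : S := hx g * hy h - hx h * hy g.

(* Every real functional on S^2 is of the form re (p x + q y), as eps <> 0. *)
Definition spanning (Gam : heis S -> Prop) : Prop := forall p q : S,
  (forall g, Gam g -> re (p * hx g + q * hy g) = 0) -> p = 0 /\ q = 0.

Definition centrally_discrete (Gam : heis S -> Prop) : Prop := exists2 e : R, 0 < e &
  forall z, Gam (hmk 0 0 z) -> `|re z| < e -> `|im z| < e -> z = 0.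

Definition is_subgroup (G : groupType) (Gam : G -> Prop) : Prop :=
  [/\ Gam 1%g, forall g h, Gam g -> Gam h -> Gam (g * h)%g &
      forall g, Gam g -> Gam g^-1%g].

(* Otherwise the quadratic form h |-> qnorm (omega g h) vanishes on a spanning *)
(* subgroup; so does its polarization, which is then zero by spanning.         *)
Lemma nondegenerate_pair Gam : is_subgroup Gam -> spanning Gam ->
  exists g h, [/\ Gam g, Gam h & qnorm (omega g h) != 0].
Proof.
move=> [G1 GM GV] sp; apply: contrapT => H.
have N0 g h : Gam g -> Gam h -> qnorm (omega g h) = 0.
  by move=> Gg Gh; apply/eqP/negPn/negP => n0; apply: H; exists g, h.
have omM g h h' : omega g (h * h')%g = omega g h + omega g h'.
  by rewrite /omega !hE; ring.
have B1 g h h' : Gam g -> Gam h -> Gam h' -> re (qconj (omega g h) * omega g h') = 0.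
  by move=> *; apply: qnorm_polar; rewrite -?omM; apply: N0 => //; exact: GM.
(* For fixed [g] and [h], [B1] is a real functional of the coordinates of [h'] that vanishes on
   [Gam], so spanning kills its coefficients. The same device gives [B4] and [B6], ending with
   [hx = 0] on [Gam]. *)
have B2 g h : Gam g -> Gam h -> qconj (omega g h) * hx g = 0.
  move=> Gg Gh; have [|_] := sp (- (qconj (omega g h) * hy g)) (qconj (omega g h) * hx g); last by [].
  by move=> h' Gh'; rewrite -(B1 g h h')//; congr re; rewrite /omega; ring.
have B3 g h : Gam g -> Gam h -> omega g h * qconj (hx g) = 0.
  by move=> Gg Gh; apply: conj0; rewrite conjM conjK; exact: B2.
have B4 g : Gam g -> hx g * qconj (hx g) = 0.
  move=> Gg; have [|_] := sp (- (qconj (hx g) * hy g)) (hx g * qconj (hx g)); last by [].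
  by move=> h Gh; rewrite -re0 -(B3 g h)//; congr re; rewrite /omega; ring.
have B5 g : Gam g -> qnorm (hx g) = 0.
  by move=> Gg; apply: r_inj; rewrite -mul_conj B4// rmorph0.
have B6 g : Gam g -> hx g = 0.
  move=> Gg; apply: conj0; have [|] := sp (qconj (hx g)) 0; last by [].
  move=> h Gh; rewrite mul0r addr0; apply: qnorm_polar; rewrite -?hxM; apply: B5 => //.
  exact: GM.
have [|/eqP] := sp 1 0; last by rewrite oner_eq0.
by move=> g Gg; rewrite B6// !mulr0 mul0r addr0 re0.
Qed.

Section LinearChange.
Variables (a b c e w : S).
Hypothesis detw : (a * e - b * c) * w = 1.

Let h := r 2^-1.

Let hh : h + h = 1.
Proof. by rewrite -rmorphD -div1r -splitr rmorph1. Qed.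

(** The lift to H_1(S) of the matrix with rows (a, b) and (c, e). The centre is scaled by the
    determinant, and the quadratic terms are the coboundary that absorbs the change of cocycle. *)
Definition linear_change (g : heis S) : heis S :=
  let x := hx g in let y := hy g in
  hmk (a * x + b * y) (c * x + e * y)
    ((a * e - b * c) * hz g + b * c * x * y + h * (a * c * x * x + b * e * y * y)).

Lemma linear_changeM : {morph linear_change : g k / (g * k)%g}.
Proof.
move=> g k; rewrite /linear_change hmkM !hE; congr hmk; try by ring.
apply/eqP; rewrite -subr_eq0; apply/eqP.
transitivity ((h + h - 1) * (a * c * hx g * hx k + b * e * hy g * hy k)); first by ring.
by rewrite hh subrr mul0r.
Qed.

Lemma linear_change_inj : injective linear_change.
Proof.
move=> g k E.
have Ex : a * hx g + b * hy g = a * hx k + b * hy k.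
  by have := congr1 (@hx S) E; rewrite /linear_change !hE.
have Ey : c * hx g + e * hy g = c * hx k + e * hy k.
  by have := congr1 (@hy S) E; rewrite /linear_change !hE.
have det_inj x y : (a * e - b * c) * x = (a * e - b * c) * y -> x = y.
  by move=> xy; rewrite -[x]mul1r -[y]mul1r -detw ![_ * w]mulrC -!mulrA xy.
have xE : hx g = hx k.
  apply: det_inj; transitivity (e * (a * hx g + b * hy g) - b * (c * hx g + e * hy g)).
    by ring.
  by rewrite Ex Ey; ring.
have yE : hy g = hy k.
  apply: det_inj; transitivity (a * (c * hx g + e * hy g) - c * (a * hx g + b * hy g)).
    by ring.
  by rewrite Ex Ey; ring.
apply: heis_ext => //; apply: det_inj.
have := congr1 (@hz S) E; rewrite /linear_change !hE xE yE.
by move/addIr/addIr.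
Qed.

Definition image_pred (f : heis S -> heis S) (Gam : heis S -> Prop) (k : heis S) : Prop :=
  exists2 g, Gam g & f g = k.

Lemma image_subgroup (f : heis S -> heis S) Gam : {morph f : g k / (g * k)%g} ->
  is_subgroup Gam -> is_subgroup (image_pred f Gam).
Proof.
move=> fM [G1 GM GV]; have [f1 fV] := morph_gen fM; split.
- by exists 1%g.
- by move=> _ _ [g Gg <-] [k Gk <-]; exists (g * k)%g; rewrite ?fM//; exact: GM.
- by move=> _ [g Gg <-]; exists g^-1%g; rewrite ?fV//; exact: GV.
Qed.

Lemma linear_change_spanning Gam : spanning Gam -> spanning (image_pred linear_change Gam).
Proof.
move=> sp p q H.
have [|e1 e2] := sp (p * a + q * c) (p * b + q * e).
  move=> g Gg; rewrite -(H (linear_change g)); last by exists g.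
  by rewrite /linear_change !hE; congr re; ring.
have det0 x : (a * e - b * c) * x = 0 -> x = 0.
  by move=> x0; rewrite -[x]mul1r -detw mulrAC x0 mul0r.
split; apply: det0.
- transitivity (e * (p * a + q * c) - c * (p * b + q * e)); first by ring.
  by rewrite e1 e2 !mulr0 subrr.
- transitivity (a * (p * b + q * e) - b * (p * a + q * c)); first by ring.
  by rewrite e1 e2 !mulr0 subrr.
Qed.

(** On the centre the change is multiplication by the determinant; its inverse, multiplication by
    [w], enlarges coordinates by a factor less than [C]. *)
Lemma linear_change_discrete Gam :
  centrally_discrete Gam -> centrally_discrete (image_pred linear_change Gam).
Proof.
move=> [d d0 disc].
pose C : R := 1 + `|re w| + `|eps * im w| + `|im w|.
have C0 : 0 < C by rewrite /C -!addrA ltr_pwDl// !addr_ge0.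
exists (d / C); first by rewrite divr_gt0.
move=> z [g Gg gz] rez imz.
have gE : g = hmk 0 0 (w * z).
  apply: linear_change_inj; rewrite gz /linear_change !hE.
  by congr hmk; rewrite !(mulr0, addr0)// mulrA detw mul1r.
have small x y : `|x| + `|y| <= C - 1 -> `|x * re z + y * im z| < d.
  move=> xy; apply: le_lt_trans (ler_normD _ _) _; rewrite !normrM.
  apply: (@le_lt_trans _ _ ((`|x| + `|y|) * (d / C))).
    by rewrite mulrDl lerD// ler_wpM2l// ltW.
  apply: (@le_lt_trans _ _ ((C - 1) * (d / C))).
    by rewrite ler_wpM2r// divr_ge0// ltW.
  by rewrite mulrCA gtr_pMr// ltr_pdivrMr// mul1r gtrDl ltrN10.
have wz : w * z = 0.
  have [p1 p2 p3] := And3 (normr_ge0 (re w)) (normr_ge0 (im w)) (normr_ge0 (eps * im w)).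
  move: Gg; rewrite gE => /disc; apply.
  - by rewrite reM; apply: small; rewrite /C; lra.
  - by rewrite imM addrC; apply: small; rewrite /C; lra.
by rewrite -[z]mul1r -detw -mulrA wz mulr0.
Qed.

End LinearChange.

(** Apply the inverse of the matrix whose columns are the coordinates of the pair given by
    [nondegenerate_pair]; its determinant [omega g k] is a unit. *)
Lemma normalize_pair Gam : is_subgroup Gam -> spanning Gam -> centrally_discrete Gam ->
  exists f : heis S -> heis S, [/\ {morph f : g k / (g * k)%g}, injective f,
    spanning (image_pred f Gam), centrally_discrete (image_pred f Gam) &
    exists z1 z2, image_pred f Gam (hmk 1 0 z1) /\ image_pred f Gam (hmk 0 1 z2)].
Proof.
move=> subG sp disc; have [g [k [Gg Gk N0]]] := nondegenerate_pair subG sp.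
have [v] : exists v, omega g k * v = 1.
  by exists (r (qnorm (omega g k))^-1 * qconj (omega g k));
    rewrite mulrCA mul_conj -rmorphM mulVf ?rmorph1.
move: N0 => _; rewrite /omega => uv.
have det : ((hy k * v) * (hx g * v) - (- hx k * v) * (- hy g * v)) * (hx g * hy k - hx k * hy g) = 1.
  pose W := (hx g * hy k - hx k * hy g) * v.
  by transitivity (W * W); [rewrite /W; ring|rewrite /W uv mulr1].
exists (linear_change (hy k * v) (- hx k * v) (- hy g * v) (hx g * v)); split.
- exact: linear_changeM.
- exact: linear_change_inj det.
- exact: linear_change_spanning det _ sp.
- exact: linear_change_discrete det _ disc.
- eexists; eexists; split; [exists g => //|exists k => //]; rewrite /linear_change.
  + by congr hmk; [rewrite -[RHS]uv|]; ring.
  + by congr hmk; [|rewrite -[RHS]uv]; ring.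
Qed.

Section Normalized.
Variable Gam : heis S -> Prop.
Hypothesis subG : is_subgroup Gam.
Hypothesis sp : spanning Gam.
Hypothesis disc : centrally_discrete Gam.
Variables z1 z2 : S.
Hypothesis Gx : Gam (hmk 1 0 z1).
Hypothesis Gy : Gam (hmk 0 1 z2).

Definition central_part (z : S) : Prop := Gam (hmk 0 0 z).
Definition projection (x y : S) : Prop := exists z, Gam (hmk x y z).

Let GM g k : Gam g -> Gam k -> Gam (g * k)%g. Proof. by case: subG => _ M _; exact: M. Qed.
Let GV g : Gam g -> Gam g^-1%g. Proof. by case: subG => _ _; exact. Qed.
Let GR g k : Gam g -> Gam k -> Gam (hmk 0 0 (hx g * hy k - hx k * hy g)).
Proof. by move=> Gg Gk; rewrite -hmkR; do ?[apply: GM|apply: GV]. Qed.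

Lemma central_partB z w : central_part z -> central_part w -> central_part (z - w).
Proof.
move=> Lz Lw; have := GM Lz (GV Lw); rewrite /central_part; congr Gam.
by apply: heis_ext; rewrite !hE; ring.
Qed.

Lemma central_part1 : central_part 1.
Proof. by have := GR Gx Gy; rewrite !hE mul1r mul0r subr0. Qed.

Lemma central_part_hx g : Gam g -> central_part (hx g).
Proof. by move=> Gg; have := GR Gg Gy; rewrite !hE mulr1 mul0r subr0. Qed.

Lemma central_part_hy g : Gam g -> central_part (hy g).
Proof. by move=> Gg; have := GR Gx Gg; rewrite !hE mul1r mulr0 subr0. Qed.

Lemma projectionB x y x' y' : projection x y -> projection x' y' ->
  projection (x - x') (y - y').
Proof.
move=> [z Gz] [w Gw]; exists (hz (hmk x y z * (hmk x' y' w)^-1)%g).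
have := GM Gz (GV Gw); congr Gam.
by apply: heis_ext; rewrite !hE.
Qed.

Lemma projectionZ (k : int) x y : projection x y -> projection (k%:~R * x) (k%:~R * y).
Proof.
move=> Pxy; pose P (v : S * S) := projection v.1 v.2.
have P0 : P 0 by case: subG => G1 _ _; exists 0; have := G1; congr Gam; apply: heis_ext; rewrite !hE.
have PB v v' : P v -> P v' -> P (v - v') by exact: projectionB.
have /= := sub_closedMz P0 PB (x := (x, y)) k Pxy.
have fstZ (v : S * S) : (v *~ k).1 = k%:~R * v.1 /\ (v *~ k).2 = k%:~R * v.2.
  by rewrite !mulrzl; split; [exact: (raddfMz fst)|exact: (raddfMz snd)].
by rewrite /P; have [-> ->] := fstZ (x, y).
Qed.

Lemma projectionD x y x' y' : projection x y -> projection x' y' ->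
  projection (x + x') (y + y').
Proof.
move=> Pv Pv'; have := projectionB Pv (projectionZ (-1) Pv').
by rewrite !mulN1r !opprK.
Qed.

Lemma projection_gen g : Gam g -> projection (hx g) (hy g).
Proof. by move=> Gg; exists (hz g); rewrite hmkK. Qed.

Lemma r_int (a : int) : r a%:~R = a%:~R.
Proof. exact: rmorph_int. Qed.

Lemma central_partZ (k : int) z : central_part z -> central_part (k%:~R * z).
Proof.
move=> Lz; rewrite mulrzl; apply: (sub_closedMz _ central_partB) => //.
by rewrite -(subrr z); exact: central_partB.
Qed.

Lemma central_partD z w : central_part z -> central_part w -> central_part (z + w).
Proof.
move=> Lz Lw; have := central_partB Lz (central_partZ (-1) Lw).
by rewrite mulN1r opprK.
Qed.

(** The functional re (j hx) equals eps im (hx), so it cannot vanish on a spanning subgroup. *)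
Lemma exists_nonreal : exists2 g, Gam g & im (hx g) != 0.
Proof.
apply: contrapT => H; have [|j0 _] := sp (p := j) (q := 0).
  move=> g Gg; rewrite mul0r addr0 reM re_j im_j mul0r add0r mulr1.
  have -> : im (hx g) = 0 by apply/eqP/negPn/negP => n0; apply: H; exists g.
  by rewrite mulr0.
by have /eqP := im_j; rewrite j0 im0 eq_sym oner_eq0.
Qed.

(** In the real basis 1, th of S the central part becomes a discrete subgroup of R^2 containing Z^2,
    so [discrete_finite_index] applies. Coordinates below d / C in this basis keep [re] and [im]
    below d. *)
Lemma central_part_finite_index th : central_part th -> im th != 0 ->
  exists2 n : nat, (0 < n)%N & forall z, central_part z ->
    exists a b : int, n%:R * z = a%:~R + b%:~R * th.
Proof.
move=> Lth imth; have [d d0 dP] := disc.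
pose C := 1 + `|re th| + `|im th|.
have C0 : 0 < C by rewrite /C -!addrA ltr_pwDl// !addr_ge0.
have reth s t : re (r s + r t * th) = s + t * re th.
  by rewrite reD reM !re_r im_r mulr0 mul0r addr0.
have imth' s t : im (r s + r t * th) = t * im th.
  by rewrite imD imM !re_r !im_r mul0r addr0 add0r.
have [|||n n0 nP] := @discrete_finite_index R
    (fun s t => central_part (r s + r t * th)) (d / C) _ _ (divr_gt0 d0 C0).
- move=> s t s' t' L1 L2; have := central_partB L1 L2; congr central_part.
  by rewrite !rmorphB; ring.
- move=> a b; rewrite !r_int; apply: central_partD; last exact: central_partZ.
  by rewrite -[a%:~R]mulr1; apply/central_partZ/central_part1.
- move=> s t L st tt.
  have bd : d / C * (C - 1) < d.
    by rewrite mulrAC ltr_pdivrMr// ltr_pM2l// gtrDl ltrN10.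
  have [p1 p2] := conj (normr_ge0 (re th)) (normr_ge0 (im th)).
  have dC0 : 0 < d / C by rewrite divr_gt0.
  have z0 : r s + r t * th = 0.
    apply: (dP _ L).
      rewrite reth; apply: le_lt_trans (ler_normD _ _) _; rewrite normrM.
      apply: le_lt_trans (_ : d / C + d / C * `|re th| < d).
        by apply: lerD; [exact: ltW|rewrite ler_wpM2r// ltW].
      rewrite -[X in X + _]mulr1 -mulrDr; apply: (@lt_le_trans _ _ (d / C * C)); last first.
        by rewrite divfK// gt_eqF.
      rewrite ltr_pM2l// /C; have : 0 < `|im th| by rewrite normr_gt0.
      by lra.
    rewrite imth' normrM; apply: le_lt_trans bd.
    apply: (@le_trans _ _ (d / C * `|im th|)); first by rewrite ler_wpM2r// ltW.
    by rewrite ler_wpM2l ?(ltW dC0)// /C; lra.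
  have t0 : t = 0.
    have /eqP := congr1 im z0; rewrite imth' im0 mulf_eq0 (negPf imth) orbF.
    by move/eqP.
  split=> //; have := congr1 re z0.
  by rewrite reth t0 mul0r addr0 re0.
exists n => // z Lz; pose t := im z / im th; pose s := re z - t * re th.
have zE : z = r s + r t * th.
  by apply: qa_ext; rewrite ?reth ?imth' /s ?subrK// /t divfK.
have [|a [b [sa tb]]] := nP s t; first by rewrite -zE.
exists a, b; rewrite zE -!r_int -sa -tb !rmorphM !rmorph_nat; ring.
Qed.

(** By spanning there is an element [k] whose imaginary parts are not proportional to those of [g].
    Modulo (1,0) and (0,1), a multiple of each is an integer combination of (th, 0) and (0, th), and
    Cramer's rule isolates these two. *)
Lemma projection_multiples g (n : nat) : Gam g -> im (hx g) != 0 -> (0 < n)%N ->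
  (forall z, central_part z -> exists a b : int, n%:R * z = a%:~R + b%:~R * hx g) ->
  exists D : int, [/\ D != 0, projection (D%:~R * hx g) 0 & projection 0 (D%:~R * hx g)].
Proof.
move=> Gg img n0 nP; pose t := im (hy g) / im (hx g).
have [k Gk kt] : exists2 k, Gam k & im (hy k) - t * im (hx k) != 0.
  apply: contrapT => H; have [|_ j0] := sp (p := - (r t * j)) (q := j).
    move=> k Gk; have k0 : im (hy k) - t * im (hx k) = 0.
      by apply/eqP/negPn/negP => k0; apply: H; exists k.
    rewrite reD mulNr reN -mulrA [re (r t * _)]reM !reM im_r re_r re_j im_j.
    by rewrite !(mul0r, mulr0, add0r, addr0, mulr1) mulrCA addrC -mulrBr k0 mulr0.
  by have /eqP := im_j; rewrite j0 im0 eq_sym oner_eq0.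
have [a' [b' yg]] := nP _ (central_part_hy Gg).
have [a [b xk]] := nP _ (central_part_hx Gk).
have [c [e yk]] := nP _ (central_part_hy Gk).
have imL (u v : int) : im (u%:~R + v%:~R * hx g) = v%:~R * im (hx g).
  by rewrite -!r_int imD imM !re_r !im_r mul0r addr0 add0r.
have imn z : im (n%:R * z) = n%:R * im z.
  by rewrite -(rmorph_nat r) imM re_r im_r mul0r addr0.
have n0' : n%:R != 0 :> R by rewrite pnatr_eq0 -lt0n.
(* The determinant of the th-coordinates of [g] and [k], up to the denominators [n]; the multipliers
   below are its cofactors. *)
exists (n%:Z * e - b' * b); split.
- apply: contra_neq kt => D0.
  have DR : n%:R * e%:~R = b'%:~R * b%:~R :> R.
    by rewrite -[n%:R]/(n%:Z%:~R) -!rmorphM /=; congr intr; apply/eqP; rewrite -subr_eq0 D0.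
  apply: (mulfI n0'); apply: (mulfI n0'); rewrite !mulr0.
  have := congr1 im yk; rewrite imn imL => eyk.
  have := congr1 im xk; rewrite imn imL => exk.
  have := congr1 im yg; rewrite imn imL => eyg.
  rewrite !mulrBr eyk (_ : n%:R * (n%:R * (t * im (hx k))) =
    (n%:R * t) * (n%:R * im (hx k))); last by ring.
  rewrite exk (_ : n%:R * t = b'%:~R); last by rewrite /t mulrA eyg mulfK.
  by rewrite !mulrA DR subrr.
- have := projectionD (projectionB (projectionZ (n%:Z * e) (projection_gen Gg))
     (projectionZ (n%:Z * b') (projection_gen Gk)))
    (projectionB (projectionZ (b' * a) (projection_gen Gx))
     (projectionZ (e * a' - b' * c) (projection_gen Gy))).
  rewrite !hE; congr projection.
  + transitivity (n%:R * e%:~R * hx g - b'%:~R * (n%:R * hx k) + b'%:~R * a%:~R).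
      by rewrite !(rmorphM, rmorphB) /= -!pmulrn; ring.
    by rewrite xk !(rmorphM, rmorphB) /= -!pmulrn; ring.
  + transitivity (e%:~R * (n%:R * hy g) - b'%:~R * (n%:R * hy k) - (e * a' - b' * c)%:~R).
      by rewrite !(rmorphM, rmorphB) /= -!pmulrn; ring.
    by rewrite yk yg !(rmorphM, rmorphB) /=; ring.
- have := projectionD (projectionB (projectionZ (n%:Z * n%:Z) (projection_gen Gk))
     (projectionZ (n%:Z * b) (projection_gen Gg)))
    (projectionB (projectionZ (b * a' - n%:Z * c) (projection_gen Gy))
     (projectionZ (n%:Z * a) (projection_gen Gx))).
  rewrite !hE; congr projection.
  + transitivity (n%:R * (n%:R * hx k) - n%:R * b%:~R * hx g - n%:R * a%:~R).
      by rewrite !(rmorphM, rmorphB) /= -!pmulrn; ring.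
    by rewrite xk; ring.
  + transitivity (n%:R * (n%:R * hy k) - b%:~R * (n%:R * hy g) + (b * a' - n%:Z * c)%:~R).
      by rewrite !(rmorphM, rmorphB) /= -!pmulrn; ring.
    by rewrite yk yg !(rmorphM, rmorphB) /= -!pmulrn; ring.
Qed.


(** The elements above (D th, 0) and (0, D th) have commutator D^2 th^2, which therefore lies in the
    central part; so th satisfies an integral quadratic equation. Its shifted root [w] is nonreal
    with real square, so re w = 0 and w^2 has the sign of [eps]. *)
Lemma quadratic_generator th (n : nat) (D : int) : im th != 0 -> (0 < n)%N ->
  (forall z, central_part z -> exists a b : int, n%:R * z = a%:~R + b%:~R * th) ->
  D != 0 -> projection (D%:~R * th) 0 -> projection 0 (D%:~R * th) ->
  exists (del rho q : int) (m : nat) (s : S),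
    [/\ squarefreez del, 0 < del%:~R * eps, (0 < m)%N & 0 < rho] /\
    [/\ s * s = del%:~R, im s != 0 & (2 * m)%:R * th = q%:~R + rho%:~R * s].
Proof.
move=> imth n0 nP D0 [z3 G3] [z4 G4].
have [p [q thE]] : exists p q : int, n%:R * (D%:~R * th * (D%:~R * th)) = p%:~R + q%:~R * th.
  by apply: nP; have := GR G3 G4; rewrite !hE mul0r subr0.
pose m := (n * `|D| ^ 2)%N.
have mE (A : nzRingType) : m%:R = n%:R * D%:~R ^+ 2 :> A.
  by rewrite natrM sqr_absz_intr.
have m0 : (0 < m)%N by rewrite muln_gt0 n0 expn_gt0 absz_gt0 D0.
have mth : m%:R * th * th = p%:~R + q%:~R * th by rewrite -thE mE; ring.
(* Completing the square in m th^2 = q th + p. *)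
pose w := (2 * m)%:R * th - q%:~R.
pose E : int := q ^+ 2 + 4 * m%:Z * p.
have wE : w * w = E%:~R.
  transitivity (4 * m%:R * (m%:R * th * th) - 4 * m%:R * q%:~R * th + q%:~R * q%:~R : S).
    by rewrite /w natrM; ring.
  by rewrite mth /E rmorphD !rmorphM /= -!pmulrn; ring.
have imw : im w = (2 * m)%:R * im th.
  rewrite /w imD imN -r_int -(rmorph_nat r) imM !im_r re_r; ring.
have imw0 : im w != 0.
  by rewrite imw mulf_neq0// pnatr_eq0 muln_eq0 -lt0n m0.
have rew : re w = 0.
  have := congr1 im wE; rewrite imM -r_int im_r => e0.
  apply: (mulIf imw0); rewrite mul0r; apply: (@mulfI _ 2); first by rewrite pnatr_eq0.
  by rewrite mulr0 -[RHS]e0; ring.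
have ER : E%:~R = eps * im w ^+ 2.
  have := congr1 re wE; rewrite reM -r_int re_r rew => <-.
  by ring.
have E0 : E != 0.
  by rewrite -(intr_eq0 R) ER mulf_neq0// expf_neq0.
have [del [rho [sdel rho0 Efac]]] := squarefreez_factor E0.
have EfR : E%:~R = del%:~R * (rho%:~R * rho%:~R) :> R by rewrite Efac expr2 !rmorphM.
have rhoR : rho%:~R != 0 :> R by rewrite intr_eq0 gt_eqF.
pose s := r rho%:~R^-1 * w.
exists del, rho, q, m, s; split; split=> //.
- have : 0 < E%:~R * eps :> R.
    by rewrite ER mulrAC mulr_gt0 ?exprn_even_gt0 ?imw0// -expr2 exprn_even_gt0.
  by rewrite EfR mulrAC pmulr_lgt0// -expr2 exprn_even_gt0.
- have -> : del%:~R = r (rho%:~R^-1 * rho%:~R^-1 * E%:~R) :> S.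
    by rewrite EfR -r_int; congr (r _); field.
  by rewrite !rmorphM /= r_int -wE /s; ring.
- by rewrite /s imM re_r im_r mul0r addr0 mulf_neq0// invr_eq0.
- by rewrite /s -(r_int rho) mulrA -rmorphM mulfV// rmorph1 mul1r /w addrC subrK.
Qed.

(** From above, all x and y lie in the central part, hence have bounded denominators over Z[s]. From
    below, the elements over (1,0), (0,1), (D th,0), (0,D th), once their central coordinates are
    cleared, generate a multiple of Z[s] in each coordinate. *)
Lemma normalized_sandwich : exists (del : int) (s : S) (M : nat) (f : heis S -> heis S),
  [/\ squarefreez del, 0 < del%:~R * eps, s * s = del%:~R & im s != 0] /\
  [/\ (0 < M)%N, {morph f : g k / (g * k)%g}, injective f,
      forall k, inner s M k -> image_pred f Gam k &
      forall g, Gam g -> outer s M (f g)].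
Proof.
have [g0 Gg0 imth] := exists_nonreal.
have [n n0 nP] := central_part_finite_index (central_part_hx Gg0) imth.
have [D [D0 PDx PDy]] := projection_multiples Gg0 imth n0 nP.
have [del [rho [q [m [s [[sdel dele m0 rho0] [ss ims thE]]]]]]] :=
  quadratic_generator imth n0 nP D0 PDx PDy.
have Lth := central_part_hx Gg0.
move: Lth imth nP PDx PDy thE; move: (hx g0) => {g0 Gg0} th Lth imth nP [z3 G3] [z4 G4] thE.
have DR : D%:~R != 0 :> R by rewrite intr_eq0.
(* The coordinates of x in the real basis: x = u x + (t x) th. *)
pose t x := im x / im th; pose u x := re x - t x * re th.
have tD x y : t (x + y) = t x + t y by rewrite /t imD mulrDl.
have uD x y : u (x + y) = u x + u y by rewrite /u tD reD; ring.
(* The automorphism (x, y, z) |-> (x, y, z + l x y) kills the central parts of *)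
(* the four elements above (1,0), (0,1), (D th,0) and (0,D th).               *)
pose l x y := - (r (u x) * z1 + r (t x / D%:~R) * z3 + r (u y) * z2 + r (t y / D%:~R) * z4).
have lD x y x' y' : l (x + x') (y + y') = l x y + l x' y'.
  by rewrite /l !tD !uD !mulrDl !rmorphD; ring.
have t0 : t 0 = 0 by rewrite /t im0 mul0r.
have u0 : u 0 = 0 by rewrite /u t0 re0 mul0r subr0.
have t1 : t 1 = 0 by rewrite /t im1 mul0r.
have u1 : u 1 = 1 by rewrite /u t1 re1 mul0r subr0.
have tth : t (D%:~R * th) = D%:~R.
  by rewrite /t -r_int imM re_r im_r mul0r addr0 mulfK.
have uth : u (D%:~R * th) = 0.
  by rewrite /u tth -r_int reM re_r im_r mulr0 mul0r addr0 subrr.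
have l00 : l 0 0 = 0 by rewrite /l !t0 !u0 !mul0r !rmorph0 !mul0r !addr0 oppr0.
pose f g := hmk (hx g) (hy g) (hz g + l (hx g) (hy g)).
have fM : {morph f : g k / (g * k)%g}.
  by move=> g k; rewrite /f hmkM !hE lD; congr hmk; ring.
have finj : injective f.
  move=> g k E; have ex : hx g = hx k by have := congr1 (@hx S) E; rewrite !hE.
  have ey : hy g = hy k by have := congr1 (@hy S) E; rewrite !hE.
  apply: heis_ext => //; have := congr1 (@hz S) E; rewrite !hE ex ey.
  exact: addIr.
pose H := image_pred f Gam.
have [H1 HM HV] : is_subgroup H := image_subgroup fM subG.
have H_of x y z : Gam (hmk x y z) -> l x y = - z -> H (hmk x y 0).
  by move=> Gz lz; exists (hmk x y z) => //; rewrite /f !hE lz subrr.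
have Hcen z : central_part z <-> H (hmk 0 0 z).
  split=> [Gz|[g Gg gE]]; first by exists (hmk 0 0 z); rewrite // /f !hE l00 addr0.
  have ex : hx g = 0 by have := congr1 (@hx S) gE; rewrite !hE.
  have ey : hy g = 0 by have := congr1 (@hy S) gE; rewrite !hE.
  have := congr1 (@hz S) gE; rewrite !hE ex ey l00 addr0 => ez.
  by rewrite /central_part (_ : hmk 0 0 z = g)//; apply: heis_ext; rewrite !hE.
pose X x := H (hmk x 0 0); pose Y y := H (hmk 0 y 0).
have XB x x' : X x -> X x' -> X (x - x').
  move=> Xx Xx'; have := HM _ _ Xx (HV _ Xx'); congr H.
  by apply: heis_ext; rewrite !hE; ring.
have YB x x' : Y x -> Y x' -> Y (x - x').
  move=> Xx Xx'; have := HM _ _ Xx (HV _ Xx'); congr H.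
  by apply: heis_ext; rewrite !hE; ring.
have one0 : H (hmk 0 0 0) by apply/Hcen; rewrite -(subrr 1); apply: central_partB; exact: central_part1.
have XZ (a b : int) : X (a%:~R + b%:~R * (D%:~R * th)).
  rewrite mulrzl; apply: (sub_closedD one0 XB); apply: (sub_closedMz one0 XB).
    by apply: (H_of _ _ z1) => //; rewrite /l u1 t1 u0 t0 !mul0r rmorph1 !rmorph0; ring.
  by apply: (H_of _ _ z3) => //; rewrite /l uth tth u0 t0 mulfV// !mul0r rmorph1 !rmorph0; ring.
have YZ (a b : int) : Y (a%:~R + b%:~R * (D%:~R * th)).
  rewrite mulrzl; apply: (sub_closedD one0 YB); apply: (sub_closedMz one0 YB).
    by apply: (H_of _ _ z2) => //; rewrite /l u1 t1 u0 t0 !mul0r rmorph1 !rmorph0; ring.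
  by apply: (H_of _ _ z4) => //; rewrite /l uth tth u0 t0 mulfV// !mul0r rmorph1 !rmorph0; ring.
(* Multiplying the [Y] element by the [X] element, in this order, creates no central term. *)
have HXY x y : X x -> Y y -> H (hmk x y 0).
  by move=> Xx Yy; have := HM _ _ Yy Xx; congr H; rewrite hmkM !add0r addr0 mul0r.
have LZ (a b : int) : central_part (a%:~R + b%:~R * th).
  apply: central_partD; last exact: central_partZ.
  by rewrite -[a%:~R]mulr1; apply/central_partZ/central_part1.
have natD := sqr_absz_intr.
have natrho : `|rho|%N%:R = rho%:~R :> S by rewrite -[in RHS](gtz0_abs rho0).
(* [M1] carries Z[s] into Z + Z D th. Below, [Q] carries the central part into Z[s] and [k] carries
   it into Z + Z D th; [M2] has two factors [Q] because the central coordinate involves a product x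
   y. *)
pose M1 := (`|D| ^ 2 * `|rho|)%N.
pose Q := (2 * m * n)%N; pose k := (n * `|D| ^ 2)%N; pose M2 := (Q * Q * k)%N.
have M10 : (0 < M1)%N by rewrite muln_gt0 expn_gt0 !absz_gt0 D0 lt0r_neq0.
have k0 : (0 < k)%N by rewrite muln_gt0 n0 expn_gt0 absz_gt0 D0.
have M20 : (0 < M2)%N by rewrite /M2 muln_gt0 k0 andbT !muln_gt0 m0 n0.
have rs : rho%:~R * s = (2 * m)%:R * th - q%:~R by rewrite thE addrC addKr.
have M1E (a b : int) : M1%:R * (a%:~R + b%:~R * s) =
    (D ^+ 2 * (rho * a - b * q))%:~R + (2 * m%:Z * D * b)%:~R * (D%:~R * th).
  transitivity (D%:~R ^+ 2 * (rho%:~R * a%:~R + b%:~R * (rho%:~R * s))).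
    by rewrite natrM (natD _ D) natrho; ring.
  by rewrite rs !(rmorphM, rmorphB, rmorphXn) /= natrM -!pmulrn; ring.
exists del, s, (M1 * M2)%N, f; split=> //; split=> //.
- by rewrite muln_gt0 M10.
- move=> g /(inner_dvd ss (dvdn_mulr M2 (dvdnn M1))).
  move=> [x [y [z [[[a [b xE]] [a' [b' yE]] [a'' [b'' zE]]] [ex ey ez]]]]].
  rewrite -(hmkK g) ex ey ez xE yE zE.
  have -> : hmk (M1%:R * (a%:~R + b%:~R * s)) (M1%:R * (a'%:~R + b'%:~R * s))
      (M1%:R * (a''%:~R + b''%:~R * s)) =
    (hmk (M1%:R * (a%:~R + b%:~R * s)) (M1%:R * (a'%:~R + b'%:~R * s)) 0 *
     hmk 0 0 (M1%:R * (a''%:~R + b''%:~R * s)))%g.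
    by rewrite hmkM !addr0 add0r mulr0 addr0.
  rewrite !M1E; apply: HM; first exact: HXY (XZ _ _) (YZ _ _).
  apply/Hcen; rewrite mulrA -rmorphM; exact: LZ.
move=> g Gg; apply: (outer_dvd ss (dvdn_mull M1 (dvdnn M2))).
have QL z : central_part z -> zlat s (Q%:R * z).
  move=> /nP[a [b nz]]; have -> : Q%:R * z = (2 * m%:Z * a)%:~R + b%:~R * ((2 * m)%:R * th).
    by rewrite /Q natrM -mulrA nz !natrM !rmorphM /= -!pmulrn; ring.
  rewrite thE; apply: zlatD; first exact: zlat_int.
  by apply: (zlatM ss); [exact: zlat_int|exists q, rho].
have [Lx Ly] := conj (central_part_hx Gg) (central_part_hy Gg).
have kX z : central_part z -> exists a b : int, k%:R * z = a%:~R + b%:~R * (D%:~R * th).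
  move=> /nP[a [b nz]]; exists (D ^+ 2 * a), (D * b).
  transitivity (D%:~R ^+ 2 * (n%:R * z)); first by rewrite natrM (natD _ D); ring.
  by rewrite nz !rmorphM /= ?rmorphXn /=; ring.
(* Compare the k-th power of f g with the element (k x, k y, 0). *)
have Lz : central_part (k%:R * hz (f g) + (hx g * hy g) * ('C(k, 2))%:R).
  apply/Hcen.
  have Hk : H (hmk (k%:R * hx g) (k%:R * hy g) 0).
    have [a [b ->]] := kX _ Lx; have [a' [b' ->]] := kX _ Ly.
    exact: HXY (XZ _ _) (YZ _ _).
  have Hfk : H (f g ^+ k)%g.
    elim: (k) => [|i IH]; rewrite ?expg0 // expgS; apply: HM => //; by exists g.
  have := HM _ _ (HV _ Hk) Hfk; congr H.
  apply: heis_ext; rewrite !hE ?hxX ?hyX ?hzX /f !hE -[_ *+ k]mulr_natl.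
  - by ring.
  - by ring.
  - by rewrite -[_ *+ 'C(k, 2)]mulr_natr -[hy g *+ k]mulr_natl; ring.
have [Qx Qy Qz] := And3 (QL _ Lx) (QL _ Ly) (QL _ Lz).
split.
- rewrite /f !hE /M2 (_ : _ * hx g = (Q * k)%:R * (Q%:R * hx g)).
    by apply: (zlatM ss) => //; exact: zlat_nat.
  by rewrite !natrM; ring.
- rewrite /f !hE /M2 (_ : _ * hy g = (Q * k)%:R * (Q%:R * hy g)).
    by apply: (zlatM ss) => //; exact: zlat_nat.
  by rewrite !natrM; ring.
- have -> : M2%:R * hz (f g) = Q%:R * (Q%:R * (k%:R * hz (f g) + (hx g * hy g) * ('C(k, 2))%:R))
     - ('C(k, 2))%:R * ((Q%:R * hx g) * (Q%:R * hy g)).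
    by rewrite /M2 !(natrM _ _ k) (natrM _ Q Q); ring.
  apply: zlatB; apply: (zlatM ss); do ?exact: zlat_nat => //.
    exact: Qz.
  exact: (zlatM ss).
Qed.


End Normalized.



Theorem lattice_normal_form Gam : is_subgroup Gam -> spanning Gam -> centrally_discrete Gam ->
  exists (del : int) (s : S) (M : nat) (f : heis S -> heis S),
  [/\ squarefreez del, 0 < del%:~R * eps, s * s = del%:~R & im s != 0] /\
  [/\ (0 < M)%N, {morph f : g k / (g * k)%g}, injective f,
      forall k, inner s M k -> image_pred f Gam k &
      forall g, Gam g -> outer s M (f g)].
Proof.
move=> subG sp disc.
have [f [fM fI fsp fdisc [z1 [z2 [G1 G2]]]]] := normalize_pair subG sp disc.
have [del [s [M [h [dels [M0 hM hI hin hout]]]]]] :=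
  normalized_sandwich (image_subgroup fM subG) fsp fdisc G1 G2.
exists del, s, M, (h \o f); split=> //; split=> //.
- by move=> g k /=; rewrite fM hM.
- exact: inj_comp.
- by move=> k /hin[_ [g Gg <-] <-]; exists g.
- by move=> g Gg; apply: hout; exists g.
Qed.

End QuadraticAlgebra.

Lemma squarefreezN d : squarefreez d -> squarefreez (- d).
Proof. by move=> H k; rewrite dvdzE abszN -dvdzE; exact: H. Qed.

(** * Rings of quadratic integers *)

Section QuadraticIntegers.
Variable m : int.
Hypothesis sm : squarefreez m.
Hypothesis m1 : m <> 1.

Local Notation rt := (sqrtC m%:~R : algC).

Lemma sqr_sqrtC_int : rt * rt = m%:~R.
Proof. by rewrite -expr2 sqrtCK. Qed.

Lemma squarefreez1 : squarefreez 1.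
Proof.
move=> k; rewrite dvdz1 abszX => /eqP; rewrite -[RHS](exp1n 2) => /eqP.
by rewrite eqn_exp2r// => /eqP k1; rewrite -abszE k1.
Qed.

(** A nontrivial relation makes m a rational square, and [squarefreez_unique] would then identify m
    with 1. *)
Lemma quad_free (a b : rat) : ratr a + ratr b * rt = 0 :> algC -> a = 0 /\ b = 0.
Proof.
move=> e; have [b0|b0] := eqVneq b 0.
  by move: e; rewrite b0 rmorph0 mul0r addr0 => /eqP; rewrite fmorph_eq0 => /eqP.
have sq : b ^+ 2 * m%:~R = 1%:~R * a ^+ 2.
  apply: (fmorph_inj (ratr : {rmorphism rat -> algC})).
  rewrite !expr2 !rmorphM /= ratr_int -sqr_sqrtC_int rmorph1 mul1r.
  have -> : ratr a = - (ratr b * rt) :> algC by apply/eqP; rewrite -addr_eq0 e.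
  by ring.
have a0 : a != 0.
  apply: contraTneq (_ : b ^+ 2 * m%:~R != 0) => [a0|].
    by rewrite sq a0 expr0n mulr0 eqxx.
  by rewrite mulf_neq0 ?expf_neq0// intr_eq0 squarefreez_neq0.
by case: m1; rewrite (squarefreez_unique squarefreez1 sm b0 a0 sq).
Qed.

Lemma Aint_sqrtC : rt \in Aint.
Proof.
apply: (@root_monic_Aint ('X^2 - (m%:~R)%:P)).
- by rewrite rootE !hornerE sqrtCK subrr.
- exact: monicXnsubC.
- apply/polyOverP => i; rewrite coefB coefXn coefC rpredB ?rpred_nat//.
  by case: ifP => _; [exact: intr_int|exact: rpred0].
Qed.

(* A rational polynomial takes conjugate values at z and z', so z' is a root of *)
(* the minimal polynomial of z.                                                 *)
Lemma Aint_conj (a b : rat) : ratr a + ratr b * rt \in Aint ->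
  ratr a - ratr b * rt \in Aint.
Proof.
set z := (_ + _ : algC); set z' := (_ - _ : algC) => zA.
have conj_horner (p : {poly rat}) : exists u v : rat,
    (map_poly ratr p).[z] = ratr u + ratr v * rt /\
    (map_poly ratr p).[z'] = ratr u - ratr v * rt.
  elim/poly_ind: p => [|p e [u [v [uv uv']]]].
    by exists 0, 0; rewrite !rmorph0 !horner0 mul0r subr0 addr0.
  have step x : (map_poly ratr (p * 'X + e%:P)).[x] =
      (map_poly ratr p).[x] * x + ratr e :> algC.
    by rewrite rmorphD rmorphM /= map_polyX map_polyC /= hornerMXaddC.
  exists (u * a + v * b * m%:~R + e), (u * b + v * a).
  have -> : ratr (u * a + v * b * m%:~R + e) =
      ratr u * ratr a + ratr v * ratr b * (rt * rt) + ratr e :> algC.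
    by rewrite !rmorphD !rmorphM /= ratr_int sqr_sqrtC_int.
  have -> : ratr (u * b + v * a) = ratr u * ratr b + ratr v * ratr a :> algC.
    by rewrite !rmorphD !rmorphM.
  by rewrite !step uv uv' /z /z'; split; ring.
have [p [pE pm pP]] := minCpolyP z.
have [u [v [uv uv']]] := conj_horner p.
apply: (@root_monic_Aint (minCpoly z)).
- have /eqP z0 : root (map_poly ratr p) z by rewrite pP.
  have [u0 v0] := quad_free (etrans (esym uv) z0).
  by rewrite pE rootE uv' u0 v0 rmorph0 mul0r subr0.
- by rewrite pE map_monic.
- exact: zA.
Qed.

Lemma Aint_trace (a b : rat) : ratr a + ratr b * rt \in Aint ->
  exists t : int, 2 * a = t%:~R.
Proof.
move=> zA; have : (ratr (2 * a) : algC) \in Num.int.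
  apply: Cint_rat_Aint; first exact: Crat_rat.
  have -> : ratr (2 * a) = (ratr a + ratr b * rt) + (ratr a - ratr b * rt) :> algC.
    by rewrite rmorphM /= ratr_nat; ring.
  by rewrite rpredD// Aint_conj.
by rewrite Cint_rat => /intrP[t ->]; exists t.
Qed.

(** Twice z minus its trace is 2 b sqrt m; multiplying by sqrt m gives a rational algebraic
    integer. *)
Lemma Aint_discriminant (a b : rat) : ratr a + ratr b * rt \in Aint ->
  exists t : int, 2 * m%:~R * b = t%:~R.
Proof.
move=> zA; have [t tE] := Aint_trace zA.
have : (ratr (2 * m%:~R * b) : algC) \in Num.int.
  apply: Cint_rat_Aint; first exact: Crat_rat.
  have -> : ratr (2 * m%:~R * b) =
      (2 * (ratr a + ratr b * rt) - ratr (2 * a)) * rt :> algC.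
    have e1 : ratr (2 * m%:~R * b) = 2 * (rt * rt) * ratr b :> algC.
      by rewrite !rmorphM /= ratr_nat ratr_int sqr_sqrtC_int.
    have e2 : ratr (2 * a) = 2 * ratr a :> algC by rewrite rmorphM /= ratr_nat.
    by rewrite e1 e2; ring.
  rewrite tE ratr_int rpredM ?Aint_sqrtC// rpredB ?Aint_int// rpredM//.
  exact: (Aint_int 2).
by rewrite Cint_rat => /intrP[u ->]; exists u.
Qed.

End QuadraticIntegers.

Section QuadraticOrder.
Variables (R : realType) (S : comNzRingType) (r : {rmorphism R -> S}) (j : S).
Variables (im : S -> R) (s : S) (m : int).
Hypothesis imE : forall a b : R, im (r a + r b * s) = b * im s.
Hypothesis ss : s * s = m%:~R.
Hypothesis ims : im s != 0.
Hypothesis r_inj : injective r.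
Hypothesis sm : squarefreez m.
Hypothesis m1 : m <> 1.

Local Notation rt := (sqrtC m%:~R : algC).

Let quad_coord_ex (z : quad_ring m) :
  exists ab : rat * rat, val z = ratr ab.1 + ratr ab.2 * rt.
Proof. by have := valP z; rewrite inE => /andP[/asboolP[a [b ->]] _]; exists (a, b). Qed.

Definition quad_coord (z : quad_ring m) : rat * rat := sval (cid (quad_coord_ex z)).

Lemma quad_coordE z : val z = ratr (quad_coord z).1 + ratr (quad_coord z).2 * rt.
Proof. exact: svalP (cid (quad_coord_ex z)). Qed.

Lemma quad_coord_unique z (a b : rat) : val z = ratr a + ratr b * rt ->
  quad_coord z = (a, b).
Proof.
rewrite quad_coordE; case: (quad_coord z) => a' b' /= e.
have [|a0 b0] := @quad_free m sm m1 (a' - a) (b' - b).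
  by rewrite !rmorphB /= mulrBl addrACA -opprD e subrr.
by move: a0 b0 => /eqP; rewrite subr_eq0 => /eqP-> /eqP; rewrite subr_eq0 => /eqP->.
Qed.

(** The ring embedding sending sqrt m to s; for S = R x R it combines both real embeddings. *)
Definition quad_embed (z : quad_ring m) : S :=
  r (ratr (quad_coord z).1) + r (ratr (quad_coord z).2) * s.

Lemma quad_embedE z (a b : rat) : val z = ratr a + ratr b * rt ->
  quad_embed z = r (ratr a) + r (ratr b) * s.
Proof. by move=> /quad_coord_unique zE; rewrite /quad_embed zE. Qed.

Lemma quad_embedD : {morph quad_embed : x y / x + y}.
Proof.
move=> x y; rewrite (@quad_embedE _ ((quad_coord x).1 + (quad_coord y).1)
  ((quad_coord x).2 + (quad_coord y).2)).
  by rewrite /quad_embed !rmorphD /=; ring.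
by rewrite rmorphD /= !quad_coordE !rmorphD /=; ring.
Qed.

Lemma quad_embedM : {morph quad_embed : x y / x * y}.
Proof.
move=> x y; have := quad_coordE x; have := quad_coordE y.
rewrite [quad_embed x]/quad_embed [quad_embed y]/quad_embed.
case: (quad_coord x) => a b; case: (quad_coord y) => a' b' /= yE xE.
rewrite (@quad_embedE _ (a * a' + b * b' * m%:~R) (a * b' + b * a')).
  have gen (x1 x2 y1 y2 : R) : r (x1 * y1 + x2 * y2 * m%:~R) + r (x1 * y2 + x2 * y1) * s =
      (r x1 + r x2 * s) * (r y1 + r y2 * s).
    by rewrite !rmorphD !rmorphM rmorph_int -ss; ring.
  rewrite -gen; congr (r _ + r _ * s); first by rewrite !rmorphD !rmorphM /= ratr_int.
  by rewrite !rmorphD !rmorphM.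
rewrite rmorphM /= xE yE.
have -> : ratr (a * a' + b * b' * m%:~R) = ratr a * ratr a' + ratr b * ratr b' * (rt * rt) :> algC.
  by rewrite !rmorphD !rmorphM /= ratr_int sqr_sqrtC_int.
have -> : ratr (a * b' + b * a') = ratr a * ratr b' + ratr b * ratr a' :> algC.
  by rewrite !rmorphD !rmorphM.
by ring.
Qed.

Lemma quad_embed_inj : injective quad_embed.
Proof.
move=> x y e.
have e0 : r (ratr (quad_coord x).1 - ratr (quad_coord y).1) +
    r (ratr (quad_coord x).2 - ratr (quad_coord y).2) * s = 0.
  transitivity (quad_embed x - quad_embed y); last by rewrite e subrr.
  by rewrite /quad_embed !rmorphB; ring.
have b0 : ratr (quad_coord x).2 - ratr (quad_coord y).2 = 0 :> R.
  have im0 : im 0 = 0 by have := imE 0 0; rewrite !rmorph0 !mul0r addr0.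
  have /eqP := imE (ratr (quad_coord x).1 - ratr (quad_coord y).1)
    (ratr (quad_coord x).2 - ratr (quad_coord y).2).
  by rewrite e0 im0 eq_sym mulf_eq0 (negPf ims) orbF => /eqP.
have a0 : ratr (quad_coord x).1 - ratr (quad_coord y).1 = 0 :> R.
  by apply: r_inj; move: e0; rewrite b0 !rmorph0 mul0r addr0.
apply/val_inj; rewrite !quad_coordE; congr (ratr _ + ratr _ * _).
- by apply: (fmorph_inj (ratr : {rmorphism rat -> R})); apply/eqP; rewrite -subr_eq0 a0.
- by apply: (fmorph_inj (ratr : {rmorphism rat -> R})); apply/eqP; rewrite -subr_eq0 b0.
Qed.

Lemma quad_embed_zlat x : zlat s x -> exists z, quad_embed z = x.
Proof.
move=> [a [b ->]].
have zP : ratr a%:~R + ratr b%:~R * rt \in quad_int m.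
  rewrite inE; apply/andP; split; first by apply/asboolP; exists a%:~R, b%:~R.
  by rewrite !ratr_int rpredD ?rpredM ?Aint_int ?Aint_sqrtC.
exists (QuadRing zP); rewrite (@quad_embedE _ a%:~R b%:~R)//.
by rewrite !ratr_int !rmorph_int.
Qed.

(** Integrality of 2a and 2mb, from [Aint_trace] and [Aint_discriminant], bounds the index of
    Z[sqrt m] in the ring of integers. *)
Lemma quad_embed_denominator z : zlat s ((2 * `|m|)%N%:R * quad_embed z).
Proof.
have zA : ratr (quad_coord z).1 + ratr (quad_coord z).2 * rt \in Aint.
  by rewrite -quad_coordE; have := valP z; rewrite inE => /andP[].
have [t tE] := Aint_trace sm m1 zA; have [u uE] := Aint_discriminant sm m1 zA.
have : zlat s ((2 * m)%:~R * quad_embed z).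
  exists (m * t), u; rewrite /quad_embed mulrDr mulrA; congr (_ + _ * _).
    rewrite -!(rmorph_int r) -!(ratr_int R) -!(rmorphM, rmorphM ratr) /=; congr (r (ratr _)).
    by rewrite !rmorphM /= -tE; ring.
  rewrite -!(rmorph_int r) -!(ratr_int R) -!rmorphM /=; congr (r (ratr _)).
  by rewrite -uE !rmorphM.
rewrite natrM; have [m0|m0] := leP 0 m.
  by rewrite rmorphM /= -[in m%:~R](gez0_abs m0).
move/zlatN; rewrite -mulNr; congr zlat; congr (_ * _).
by rewrite rmorphM /= -mulrN -rmorphN -(ltz0_abs m0).
Qed.

End QuadraticOrder.


(** * Lattices in the two real Lie groups *)

Section CompactQuotient.
Variables (R : realType) (G : TopGroup.type) (Gamma : groupClosed G).
Hypothesis Gcomp : compact [set: quotient_topology {eq_quot (coset_rel Gamma)}].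

(* Such a homomorphism factors through the compact quotient, so it is bounded. *)
Lemma continuous_hom_eq0 (f : G -> R) : continuous f ->
  (forall x y, f (x * y)%g = f x + f y) -> (forall x, x \in Gamma -> f x = 0) ->
  forall x, f x = 0.
Proof.
move=> fc fM fG x.
have f1 : f 1%g = 0 by apply: (addrI (f 1%g)); rewrite -fM mulg1 addr0.
have fV y : f y^-1%g = - f y by apply/eqP; rewrite -addr_eq0 -fM mulVg f1.
have fpi (y z : G) : (y^-1 * z)%g \in Gamma -> f y = f z.
  move=> /fG; rewrite fM fV => e; apply/eqP; rewrite eq_sym -subr_eq0 -e.
  by apply/eqP; ring.
pose Q : topologicalType := quotient_topology {eq_quot (coset_rel Gamma)}.
pose h : Q -> R := f \o repr.
have hpi y : h (\pi_({eq_quot (coset_rel Gamma)}) y) = f y.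
  by apply: fpi; apply/coset_piP; rewrite reprK.
have hc : continuous h.
  apply: repr_comp_continuous => // a b /eqP ab; apply/eqP; apply: fpi; exact/coset_piP.
have := continuous_compact (continuous_subspaceT hc) Gcomp.
move=> /compact_bounded[M0 [_ HM]].
pose M := `|M0| + 1.
have fB y : `|f y| <= M.
  apply: (HM M); first by rewrite /M (le_lt_trans (ler_norm _))// ltrDl.
  by exists (\pi_({eq_quot (coset_rel Gamma)}) y).
have fX n : f (x ^+ n)%g = f x *+ n.
  by elim: n => [|n IH]; rewrite ?expg0 // expgS fM IH mulrS.
apply/eqP/negPn/negP => fx0.
have fx : 0 < `|f x| by rewrite normr_gt0.
pose n := (Num.truncn (M / `|f x|)).+1.
have := fB (x ^+ n)%g; rewrite fX normrMn -mulr_natr leNgt => /negP; apply.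
by rewrite mulrC -ltr_pdivrMr//; exact: truncnS_gt.
Qed.

End CompactQuotient.

(* G is H_1(C) or H_1(R) x H_1(R), and c identifies it with H_1(S); F is the   *)
(* inverse of c read in real coordinates.                                      *)
Section Model.
Variables (R : realType) (S : comNzRingType) (r : {rmorphism R -> S}) (j : S) (eps : R).
Variables (re im : S -> R).
Hypothesis jj : j * j = r eps.
Hypothesis eps0 : eps != 0.
Hypothesis reim : forall x, x = r (re x) + r (im x) * j.
Hypothesis reE : forall a b, re (r a + r b * j) = a.
Hypothesis imE : forall a b, im (r a + r b * j) = b.
Variables (G : TopGroup.type) (c : G -> heis S) (F : 'rV[R]_6 -> G).
Hypothesis cM : {morph c : x y / (x * y)%g}.
Hypothesis c_inj : injective c.
Hypothesis cF : forall v, c (F v) = hmk (r (v 0 0) + r (v 0 1) * j)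
  (r (v 0 (inord 2)) + r (v 0 (inord 3)) * j) (r (v 0 (inord 4)) + r (v 0 (inord 5)) * j).
Hypothesis F_continuous : continuous F.
Hypothesis coords_continuous : forall u, u = re \/ u = im ->
  [/\ continuous (fun g => u (hx (c g))), continuous (fun g => u (hy (c g))) &
      continuous (fun g => u (hz (c g)))].

Let reD := reD reim reE. Let imD := imD reim imE.
Let re0 := re0 reE. Let im0 := im0 imE. Let re_j := re_j reE. Let im_j := im_j imE.
Let re_r := re_r reE. Let im_r := im_r imE. Let reN := reN reim reE. Let imN := imN reim imE.
Let reM := reM jj reim reE. Let imM := imM jj reim imE.

Let vec (x y z : S) : 'rV[R]_6 :=
  \row_i nth 0 [:: re x; im x; re y; im y; re z; im z] i.

Lemma model_preimage h : exists g, c g = h.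
Proof.
exists (F (vec (hx h) (hy h) (hz h))).
rewrite cF !mxE !inordK//= -!reim; exact: hmkK.
Qed.

Definition coord_image (Gamma : groupClosed G) (h : heis S) : Prop :=
  exists2 g, g \in Gamma & c g = h.

Lemma coord_image_subgroup Gamma : is_subgroup (coord_image Gamma).
Proof.
have [c1 cV] := morph_gen cM; split.
- by exists 1%g => //; exact: gpred1.
- by move=> _ _ [g Gg <-] [k Gk <-]; exists (g * k)%g; rewrite ?cM// gpredM.
- by move=> _ [g Gg <-]; exists g^-1%g; rewrite ?cV// gpredV.
Qed.

(** A functional vanishing on the lattice is a continuous homomorphism to R, hence zero by
    [continuous_hom_eq0]. As [c] is onto, its coefficients vanish because the form re (x y) is
    nondegenerate. *)
Lemma lattice_spanning Gamma : lattice Gamma -> spanning re (coord_image Gamma).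
Proof.
move=> [_ Gc] p q H.
have [xc yc _] := coords_continuous (or_introl erefl).
have [xc' yc' _] := coords_continuous (or_intror erefl).
have z g : re (p * hx (c g) + q * hy (c g)) = 0.
  apply: (continuous_hom_eq0 Gc (f := fun g => re (p * hx (c g) + q * hy (c g)))).
  - have -> : (fun g => re (p * hx (c g) + q * hy (c g))) = (fun g =>
       re p * re (hx (c g)) + eps * im p * im (hx (c g)) +
       (re q * re (hy (c g)) + eps * im q * im (hy (c g)))).
      by apply/funext => g'; rewrite reD !reM.
    move=> x; apply: cvgD; apply: cvgD; apply: cvgM; do ?exact: cvg_cst.
    + exact: xc. + exact: xc'. + exact: yc. + exact: yc'.
  - by move=> x y; rewrite cM hxM hyM !mulrDr addrACA reD.
  - by move=> x Gx; apply: H; exists x.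
have ev x y : re (p * x + q * y) = 0.
  by have [g gE] := model_preimage (hmk x y 0); have := z g; rewrite gE !hE.
have nz a : (forall x, re (a * x) = 0) -> a = 0.
  move=> a0; apply: (qa_ext reim).
    by have := a0 1; rewrite mulr1 re0.
  have := a0 j; rewrite reM re_j im_j mulr0 add0r mulr1.
  by rewrite im0 => /eqP; rewrite mulf_eq0 (negPf eps0) => /eqP.
split; apply: nz => x.
- by have := ev x 0; rewrite mulr0 addr0.
- by have := ev 0 x; rewrite mulr0 add0r.
Qed.

(** Pull back along [F] a neighbourhood isolating the identity, and take a ball in it. *)
Lemma lattice_discrete Gamma : lattice Gamma -> centrally_discrete re im (coord_image Gamma).
Proof.
move=> [Giso _].
have : isolated [set` Gamma] 1%g by rewrite Giso /= gpred1.
move=> [_ [V V1 VG]].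
have F0 : F 0 = 1%g.
  apply: c_inj; rewrite cF !mxE (morph_gen cM).1 !rmorph0 !mul0r !addr0.
  by apply: heis_ext; rewrite !hE.
have /nbhs_ballP[e e0 eV] : nbhs (0 : 'rV[R]_6) (F @^-1` V).
  by apply: F_continuous; rewrite F0.
exists e => // z [g Gg gE] rz iz.
have Fg : F (vec 0 0 z) = g.
  by apply: c_inj; rewrite gE cF !mxE !inordK//= -!reim.
have : (V `&` [set` Gamma])%classic (F (vec 0 0 z)).
  split; last by rewrite Fg.
  apply: eV; rewrite /ball /= /mx_ball; split=> // i k.
  rewrite !mxE -ball_normE /ball_ /= sub0r normrN re0 im0.
  by case: k => [[|[|[|[|[|[|//]]]]]] ?] /=; rewrite ?normr0.
rewrite VG Fg => g1; have := gE; rewrite g1 (morph_gen cM).1 => /(congr1 (@hz S)).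
by rewrite !hE.
Qed.

Section LatticeCriterion.
Variables (Gamma : groupClosed G) (s : S) (del : int) (M : nat).
Hypothesis ss : s * s = del%:~R.
Hypothesis ims : im s != 0.
Hypothesis M0 : (0 < M)%N.
Hypothesis Gout : forall g, g \in Gamma -> outer s M (c g).
Hypothesis Gin : forall h, inner s 1 h -> coord_image Gamma h.

Lemma re_root : re s = 0.
Proof.
have := congr1 im ss; rewrite imM -(rmorph_int r) im_r => e0.
apply: (mulIf ims); rewrite mul0r; apply: (@mulfI _ 2); first by rewrite pnatr_eq0.
by rewrite mulr0 -[RHS]e0; ring.
Qed.

(** Since s is purely imaginary, a nonzero element of Z[s] has |re| at least 1 or |im| at least |im
    s|. *)
Lemma zlat_close : exists2 e : R, 0 < e & forall x y, zlat s (M%:R * x) ->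
  zlat s (M%:R * y) -> `|re x - re y| < e -> `|im x - im y| < e -> x = y.
Proof.
have MR : 0 < M%:R :> R by rewrite ltr0n.
pose e := Num.min 1 `|im s| / M%:R.
have m0 : 0 < Num.min 1 `|im s| by rewrite lt_min ltr01 normr_gt0.
exists e; first by rewrite divr_gt0.
move=> x y xL yL rxy ixy.
have [a [b ab]] := zlatB xL yL.
have reE' : M%:R * (re x - re y) = a%:~R.
  have := congr1 re ab; rewrite !reD reN -(rmorph_nat r) -!(rmorph_int r) !reM !re_r !im_r.
  by rewrite re_root !(mul0r, mulr0, addr0) mulrBr.
have imE' : M%:R * (im x - im y) = b%:~R * im s.
  have := congr1 im ab; rewrite !imD imN -(rmorph_nat r) -!(rmorph_int r) !imM !re_r !im_r.
  by rewrite !(mul0r, mulr0, addr0, add0r) mulrBr.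
have a0 : a = 0.
  apply/eqP; rewrite -absz_eq0 -leqn0 -ltnS -(ltr_nat R) natr_absz intr_norm -reE'.
  rewrite normrM gtr0_norm// mulrC -ltr_pdivlMr//; apply: lt_le_trans rxy _.
  by rewrite /e ler_wpM2r ?invr_ge0 ?ler0n// ge_min lexx.
have b0 : b = 0.
  apply/eqP; rewrite -absz_eq0 -leqn0 -ltnS -(ltr_nat R) natr_absz intr_norm.
  have -> : b%:~R = M%:R * (im x - im y) / im s by rewrite imE' mulfK.
  rewrite !normrM normfV ltr_pdivrMr ?normr_gt0// mul1r gtr0_norm// mulrC -ltr_pdivlMr//.
  apply: lt_le_trans ixy _.
  by rewrite /e ler_wpM2r ?invr_ge0 ?ler0n// ge_min lexx orbT.
apply/eqP; rewrite -subr_eq0; apply/eqP; apply: (qa_torsion_free r M0).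
by rewrite mulrBr ab a0 b0 mul0r addr0.
Qed.

(** Discrete because the coordinates lie in M^-1 Z[s], by [zlat_close]; cocompact because a compact
    box of coordinates meets every coset of a group containing H_1(Z[s]). *)
Lemma sandwiched_lattice : lattice Gamma.
Proof.
split.
  have [xc yc zc] := coords_continuous (or_introl erefl).
  have [xc' yc' zc'] := coords_continuous (or_intror erefl).
  have [e e0 eP] := zlat_close.
  apply/seteqP; split=> [|x /= Gx]; first exact: isolatedS.
  split; first by rewrite inE.
  have nb (f : G -> R) : continuous f -> \forall g \near x, `|f g - f x| < e.
    move=> fc; have fx : f y @[y --> x] --> f x by apply: fc.
    exact: (cvgr_distC_lt _ _ fx _ e0).
  pose V := [set g | [/\ `|re (hx (c g)) - re (hx (c x))| < e,
    `|im (hx (c g)) - im (hx (c x))| < e, `|re (hy (c g)) - re (hy (c x))| < e &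
    `|im (hy (c g)) - im (hy (c x))| < e] /\ (`|re (hz (c g)) - re (hz (c x))| < e /\
    `|im (hz (c g)) - im (hz (c x))| < e)].
  exists V.
    have n1 := nb _ xc; have n2 := nb _ xc'; have n3 := nb _ yc.
    have n4 := nb _ yc'; have n5 := nb _ zc; have n6 := nb _ zc'.
    rewrite /V; near=> g; split; first split; last split; near: g => //.
  apply/seteqP; split=> [g [[[x1 x2 y1 y2] [w1 w2]] Gg]|_ ->] /=.
    have [gx gy gz] := Gout Gg; have [hx' hy' hz'] := Gout Gx.
    by apply: c_inj; apply: heis_ext; apply: eP.
  by split=> //; rewrite /V /= !subrr !normr0.
pose B := 1 + `|im s|.
pose K := [set v : 'rV[R]_6 | forall i, `[(- B), B]%classic (v ord0 i)].
have Kc : compact K by apply: (@rV_compact _ _ (fun=> `[(- B), B]%classic)) => i; exact: segment_compact.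
pose Q : topologicalType := quotient_topology {eq_quot (coset_rel Gamma)}.
pose h : 'rV[R]_6 -> Q := (\pi_({eq_quot (coset_rel Gamma)})) \o F.
have hc : continuous h.
  move=> v; apply: continuous_comp; first exact: F_continuous.
  exact: (@pi_continuous _ {eq_quot (coset_rel Gamma)}).
have := continuous_compact (continuous_subspaceT hc) Kc.
suff -> : [set h x | x in K] = setT by [].
apply/seteqP; split=> // q _.
have red z : exists x y, [/\ z = x + y, zlat s y, `|re x| <= B & `|im x| <= B].
  pose b := Num.floor (im z / im s); pose a := Num.floor (re z).
  exists (z - (a%:~R + b%:~R * s)), (a%:~R + b%:~R * s); split.
  - by rewrite subrK.
  - by exists a, b.
  - rewrite reD reN reD reM -!(rmorph_int r) !re_r !im_r re_root !(mulr0, mul0r, addr0).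
    rewrite ger0_norm ?subr_ge0 ?floor_le// /B lerBlDr.
    have := floorD1_gt (re z); rewrite rmorphD /= -/a => H.
    by have := normr_ge0 (im s); lra.
  - rewrite imD imN imD imM -!(rmorph_int r) !re_r !im_r !(mulr0, mul0r, addr0, add0r).
    have -> : im z - b%:~R * im s = (im z / im s - b%:~R) * im s by rewrite mulrBl divfK.
    rewrite normrM ger0_norm ?subr_ge0 ?floor_le//.
    apply: (@le_trans _ _ `|im s|); last by rewrite /B lerDr.
    rewrite ler_piMl// lerBlDr.
    by have := floorD1_gt (im z / im s); rewrite rmorphD /= -/b addrC => /ltW.
pose g : G := repr q.
have [x [x' [xE xL x1 x2]]] := red (hx (c g)).
have [y [y' [yE yL y1 y2]]] := red (hy (c g)).
(* The product of the reduced element and the lattice element has the central cross term x y',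
   subtracted beforehand. *)
have [z [z' [zE zL w1 w2]]] := red (hz (c g) - x * y').
have [d Gd dE] : coord_image Gamma (hmk x' y' z').
  by apply: Gin; exists x', y', z'; rewrite !hE !mul1r.
exists (vec x y z).
  move=> i; rewrite /= in_itv /= -ler_norml mxE.
  by case: i => [[|[|[|[|[|[|//]]]]]] ?].
rewrite /h /= -[RHS]reprK; apply/coset_piP; rewrite -/g.
suff -> : g = (F (vec x y z) * d)%g by rewrite mulKg.
apply: c_inj; rewrite cM dE cF !mxE !inordK//= -!reim hmkM -xE -yE.
have -> : z + z' + x * y' = hz (c g) by rewrite -zE subrK.
by rewrite hmkK.
Unshelve. all: by end_near. Qed.

End LatticeCriterion.

(** The root s depends on [Gamma] only, and [Delta] is left free so that a ring of integers and Z x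
    Z can both be tested against it. *)
Lemma lattice_commensurable_model (Gamma : groupClosed G) : lattice Gamma ->
  exists (del : int) (s : S),
    [/\ squarefreez del, 0 < del%:~R * eps, s * s = del%:~R & im s != 0] /\
    forall (Delta : groupClosed G) (M : nat), (0 < M)%N ->
      (forall g, g \in Delta -> outer s M (c g)) ->
      (forall h, inner s 1 h -> coord_image Delta h) ->
      commensurable (subgroup_of Gamma) (subgroup_of Delta).
Proof.
move=> latG.
have [del [s [N [f [dels [N0 fM fI fin fout]]]]]] :=
  lattice_normal_form jj eps0 reim reE imE (coord_image_subgroup Gamma)
    (lattice_spanning latG) (lattice_discrete latG).
exists del, s; split=> // Delta M M0 Dout Din.
have [_ _ ss _] := dels.
have tf n x : (0 < n)%N -> n%:R * x = 0 -> x = 0 :> S by exact: (qa_torsion_free r).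
apply: (sandwich_commensurable ss tf (M := N * M) (f := fun g => f (c (val g)))
  (g := fun g => c (val g))).
- by rewrite muln_gt0 N0.
- by move=> x y; rewrite valM cM fM.
- by move=> x y; rewrite valM cM.
- by move=> x y /fI/c_inj/val_inj.
- by move=> x y /c_inj/val_inj.
- move=> h /(inner_dvd ss (dvdn_mulr M (dvdnn N)))/fin[_ [g Gg <-] <-].
  by exists (SubgroupOf Gg).
- move=> h /(inner_dvd ss (dvd1n _))/Din[g Gg <-].
  by exists (SubgroupOf Gg).
- by move=> a; apply: (outer_dvd ss (dvdn_mulr M (dvdnn N))); apply: fout;
    exists (val a) => //; exact: valP.
- by move=> b; apply: (outer_dvd ss (dvdn_mull N (dvdnn M))); apply/Dout/valP.
Qed.

Lemma predicate_lattice (P : heis S -> Prop) (s : S) (del : int) (M : nat) :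
  s * s = del%:~R -> im s != 0 -> (0 < M)%N -> is_subgroup P ->
  (forall h, P h -> outer s M h) -> (forall h, inner s 1 h -> P h) ->
  exists Delta : groupClosed G, [/\ lattice Delta, forall g, (g \in Delta) = `[<P (c g)>],
    forall g, g \in Delta -> outer s M (c g) & forall h, inner s 1 h -> coord_image Delta h].
Proof.
move=> ss ims M0 [P1 PM PV] Pout Pin; have [c1 cV] := morph_gen cM.
have [|||Delta DE] := @groupClosed_of G (fun g => P (c g)).
- by rewrite c1.
- by move=> x y Px Py; rewrite cM; exact: PM.
- by move=> x Px; rewrite cV; exact: PV.
have Dout g : g \in Delta -> outer s M (c g) by rewrite DE => /asboolP; exact: Pout.
have Din h : inner s 1 h -> coord_image Delta h.
  move=> hi; have [g gh] := model_preimage h; exists g => //.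
  by rewrite DE gh; apply/asboolP/Pin.
by exists Delta; split=> //; exact: (sandwiched_lattice ss ims M0).
Qed.

Lemma im_root_scale s a b : im (r a + r b * s) = b * im s.
Proof. by rewrite imD imM !re_r !im_r mul0r addr0 add0r. Qed.

Lemma root_free s (a b : int) : im s != 0 -> a%:~R + b%:~R * s = 0 -> a = 0 /\ b = 0.
Proof.
move=> ims e; have b0 : b = 0.
  have /eqP := congr1 im e; rewrite -!(rmorph_int r) im_root_scale im0 mulf_eq0 (negPf ims) orbF.
  by rewrite intr_eq0 => /eqP.
split=> //; move: e; rewrite b0 mul0r addr0 -(rmorph_int r) -(rmorph0 r).
by move/(r_inj reE)/eqP; rewrite intr_eq0 => /eqP.
Qed.

(** [Delta] is the image of H_1 of the ring of integers; it contains H_1(Z[s]) and has denominators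
    dividing 2|del|. *)
Lemma quadratic_order_lattice (del : int) (s : S) : squarefreez del -> del <> 1 ->
  s * s = del%:~R -> im s != 0 ->
  exists Delta : groupClosed G, [/\ lattice Delta,
    group_iso (subgroup_of Delta) (heis (quad_ring del)),
    forall g, g \in Delta -> outer s (2 * `|del|) (c g) &
    forall h, inner s 1 h -> coord_image Delta h].
Proof.
move=> sdel del1 ss ims.
have imS := im_root_scale s.
pose iota := quad_embed r s (m := del).
have iotaD : {morph iota : x y / x + y} := quad_embedD r s sdel del1.
have iotaM : {morph iota : x y / x * y} := quad_embedM r ss sdel del1.
have iotaI : injective iota := quad_embed_inj imS ims (r_inj reE).
pose P h := exists k, heis_map iota k = h.
have [||||Delta [latD DE Dout Din]] := @predicate_lattice P s del (2 * `|del|) ss ims.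
- by rewrite muln_gt0 /= absz_gt0 squarefreez_neq0.
- have [m1 mV] := morph_gen (heis_mapM iotaD iotaM); split.
  + by exists 1%g.
  + by move=> _ _ [k <-] [l <-]; exists (k * l)%g; rewrite (heis_mapM iotaD iotaM).
  + by move=> _ [k <-]; exists k^-1%g; rewrite mV.
- move=> _ [k <-]; split; rewrite !hE; exact: quad_embed_denominator.
- move=> h [x [y [z [[xL yL zL] [ex ey ez]]]]].
  have [x' xE] := quad_embed_zlat r sdel del1 xL.
  have [y' yE] := quad_embed_zlat r sdel del1 yL.
  have [z' zE] := quad_embed_zlat r sdel del1 zL.
  exists (hmk x' y' z'); apply: heis_ext; rewrite !hE ?ex ?ey ?ez mul1r //.
have [f fE] := choice (fun k => model_preimage (heis_map iota k)).
exists Delta; split=> //.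
apply: (@subgroup_iso_image _ _ Delta f).
- by move=> k l; apply: c_inj; rewrite cM !fE (heis_mapM iotaD iotaM).
- by move=> k l kl; apply: (heis_map_inj iotaI); rewrite -!fE kl.
- by move=> k; rewrite DE fE; apply/asboolP; exists k.
- move=> g; rewrite DE => /asboolP[k kE]; exists k; apply: c_inj; rewrite fE.
  exact: kE.
Qed.

Lemma root_exists (del : int) : 0 < del%:~R * eps ->
  exists s, s * s = del%:~R /\ im s != 0.
Proof.
move=> dele; pose t := Num.sqrt (del%:~R / eps).
have de0 : 0 < del%:~R / eps.
  have -> : del%:~R / eps = del%:~R * eps * eps^-1 ^+ 2 by field.
  by rewrite mulr_gt0// exprn_even_gt0// invr_eq0.
have t0 : 0 < t by rewrite sqrtr_gt0.
exists (r t * j); split; last by rewrite imM re_r im_r im_j mulr1 mul0r addr0 gt_eqF.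
rewrite mulrACA jj -!rmorphM -expr2 sqr_sqrtr ?ltW// divfK//.
exact: rmorph_int.
Qed.

(** [Lam del] is H_1(Z[s]) with s^2 = del, described exactly by [inner s 1]. *)
Lemma root_lattices : exists Lam : int -> groupClosed G,
  (forall del, squarefreez del -> 0 < del%:~R * eps -> lattice (Lam del)) /\
  (forall del del', squarefreez del -> 0 < del%:~R * eps ->
     squarefreez del' -> 0 < del'%:~R * eps ->
     commensurable (subgroup_of (Lam del)) (subgroup_of (Lam del')) -> del = del').
Proof.
pose good (del : int) (Delta : groupClosed G) := exists s,
  [/\ s * s = del%:~R, im s != 0, lattice Delta,
      forall g, g \in Delta -> inner s 1 (c g) &
      forall h, inner s 1 h -> coord_image Delta h].
have ex (del : int) : exists Delta, 0 < del%:~R * eps -> good del Delta.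
  (* For the wrong sign the whole group serves as a placeholder. *)
  have [dele|_] := boolP (0 < del%:~R * eps); last first.
    have [|||Delta _] := @groupClosed_of G (fun=> True) => //.
    by exists Delta.
  have [s [ss ims]] := root_exists dele.
  have [||Delta [latD DE Dout Din]] := @predicate_lattice (inner s 1) s del 1 ss ims isT _ _ (fun=> id).
  - by split; [exact: inner1|exact: (innerM ss)|exact: (innerV ss)].
  - move=> h [x [y [z [[xL yL zL] [ex ey ez]]]]].
    by split; rewrite ?ex ?ey ?ez !mul1r.
  by exists Delta => _; exists s; split=> // g; rewrite DE => /asboolP.
have [Lam LamP] := choice ex; exists Lam; split=> [del _ /LamP[s []]//|].
move=> del del' sd dele sd' dele' com.
have [s [ss ims latL Lin Lex]] := LamP del dele.
have [s' [ss' ims' latL' Lin' Lex']] := LamP del' dele'.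
apply: oppr_inj.
apply: (@lattice_commensurable_eq S S s s' (- del) (- del') _ _ _ _ _ _ _ _
  (fun g => c (val g)) (fun g => c (val g)) _ _ _ _ _ _ com); rewrite ?opprK//.
- by move=> a b; exact: root_free.
- by move=> a b; exact: root_free.
- exact: squarefreezN.
- exact: squarefreezN.
- by move=> x y; rewrite valM cM.
- by move=> x y; rewrite valM cM.
- by move=> x y /c_inj/val_inj.
- by move=> x y /c_inj/val_inj.
- by move=> h /Lex[g Gg <-]; exists (SubgroupOf Gg).
- by move=> b; apply/Lin'/valP.
Qed.

End Model.

Local Open Scope complex_scope.

(** * Continuity of the coordinates *)

Section HeisTopology.
Variable K : numFieldType.
Local Notation o0 := (ord0 : 'I_3).
Local Notation o1 := (lift ord0 ord0 : 'I_3).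
Local Notation o2 := (lift ord0 (lift ord0 ord0) : 'I_3).

Lemma heis_entry_continuous i k : continuous (fun g : heis K => heis_mx g i k : K).
Proof.
have mc : continuous (@heis_mx K : heis K -> 'M[K]_3).
  exact: (@initial_continuous (heis K) 'M[K]_3 (@heis_mx K)).
move=> g.
have : continuous ((fun M : 'M[K]_3 => M i k : K) \o (@heis_mx K : heis K -> 'M[K]_3)).
  by move=> x; apply: continuous_comp; [exact: mc|exact: coord_continuous].
by apply.
Qed.

Lemma hx_continuous : continuous (fun g : heis K => hx g : K).
Proof. exact: heis_entry_continuous. Qed.
Lemma hy_continuous : continuous (fun g : heis K => hy g : K).
Proof. exact: heis_entry_continuous. Qed.
Lemma hz_continuous : continuous (fun g : heis K => hz g : K).
Proof. exact: heis_entry_continuous. Qed.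

Lemma mx_continuous (T : topologicalType) m n (f : T -> 'M[K]_(m, n)) :
  (forall i k, continuous (fun t => f t i k : K)) -> continuous f.
Proof.
move=> fc t A [P PN sPA]; rewrite /= nbhs_filterE.
have : \forall x \near t, forall ik : 'I_m * 'I_n, P ik.1 ik.2 (f x ik.1 ik.2).
  apply: filter_forall => -[i k] /=; exact: (fc i k t).
by apply: filterS => x H; apply: sPA => i k; exact: (H (i, k)).
Qed.

Lemma heis_continuous (T : topologicalType) (x y z : T -> K) :
  continuous x -> continuous y -> continuous z ->
  continuous (fun t => hmk (x t) (y t) (z t) : heis K).
Proof.
move=> xc yc zc.
have mc : continuous (fun t => hmx (x t) (y t) (z t)).
  apply: mx_continuous => i k.
  rewrite (_ : (fun t => _) = (fun t => if i == k then 1 else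
    if (i == o0) && (k == o1) then x t else if (i == o1) && (k == o2) then y t else
    if (i == o0) && (k == o2) then z t else 0)); last by apply/funext => t; rewrite mxE.
  case: (i == k); first exact: cst_continuous.
  case: (_ && _) => //; case: (_ && _) => //; case: (_ && _) => //.
  exact: cst_continuous.
apply/continuousP => A [B oB <-].
by have /continuousP/(_ _ oB) := mc.
Qed.

End HeisTopology.

(** Radii over [K] and [L] are elements of different fields, so [w] translates a radius in the
    target into one in the source. *)
Lemma modulus_continuous (K L : numFieldType) (f : K -> L) (w : L -> K) :
  (forall e, 0 < e -> 0 < w e) ->
  (forall x y e, 0 < e -> `|x - y| < w e -> `|f x - f y| < e) -> continuous f.
Proof.
move=> w0 fw x; apply/(@cvgrPdist_lt L L K (nbhs x) (nbhs_filter x) f (f x)) => e e0.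
near=> y; apply: fw => //.
suff : ball x (w e) y by rewrite -ball_normE.
by near: y; apply: nbhsx_ballx; exact: w0.
Unshelve. all: by end_near. Qed.

Lemma affine_continuous (K : numFieldType) (T : topologicalType) (f g : T -> K) (a : K) :
  continuous f -> continuous g -> continuous (fun t => f t + g t * a).
Proof.
move=> fc gc t; apply: cvgD; first exact: fc.
by apply: cvgM; [exact: gc|exact: cvg_cst].
Qed.

Section ComplexModel.
Variable R : realType.
Let C : numFieldType := R[i].

Lemma Re_continuous : continuous (fun z : C => complex.Re z).
Proof.
apply: (@modulus_continuous (R[i] : numFieldType) R _ (real_complex R)) => [e|x y e e0 xy].
  by rewrite ltcR.
rewrite -ltcR; apply: le_lt_trans xy.
by have := normc_ge_Re (x - y); case: (x) (y) => [a b] [a' b'].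
Qed.

Lemma Im_continuous : continuous (fun z : C => complex.Im z).
Proof.
apply: (@modulus_continuous (R[i] : numFieldType) R _ (real_complex R)) => [e|x y e e0 xy].
  by rewrite ltcR.
rewrite -ltcR; apply: le_lt_trans xy.
have := normc_ge_Re ((x - y) * 'i); rewrite ReiNIm normrN normrM.
have -> : `|'i : R[i]| = 1 by rewrite normc_def /= expr0n expr1n add0r sqrtr1.
by rewrite mulr1; case: (x) (y) => [a b] [a' b'].
Qed.

Lemma real_complex_continuous :
  continuous (fun x : R => x%:C : C).
Proof.
apply: (@modulus_continuous R (R[i] : numFieldType) _ (@complex.Re R)) => [e|x y e].
  by rewrite ltcE /= => /andP[].
rewrite ltcE /= => /andP[/eqP eI eR] xy.
by rewrite -rmorphB normc_def /= expr0n addr0 sqrtr_sqr ltcE /= eI eqxx.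
Qed.

End ComplexModel.

(** * Infinitely many squarefree integers of each sign *)

Lemma prime_squarefreez p : prime p -> squarefreez p%:Z.
Proof.
move=> pp k; rewrite dvdzE abszX /= => kp.
have kd : (`|k| %| p)%N by apply: dvdn_trans kp; rewrite dvdn_exp.
have [/eqP k1|k1] := boolP (`|k|%N == 1%N); first by rewrite -abszE k1.
move/(prime_nt_dvdP pp k1): kd kp => ->.
move/(dvdn_leq (prime_gt0 pp)); rewrite expnS expn1 leqNgt.
by rewrite ltn_Pmulr ?prime_gt0 ?prime_gt1.
Qed.

Lemma increasing_primes : exists p : nat -> nat, (forall n, prime (p n)) /\ injective p.
Proof.
have ex m : exists p, (m < p)%N && prime p.
  by have [p mp pp] := prime_above m; exists p; rewrite mp.
have [next nextP] := choice ex.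
pose p n := iter n.+1 next 0%N.
have pS n : (p n < p n.+1)%N by rewrite /p [iter n.+2 _ _]iterS; case/andP: (nextP (p n)).
exists p; split=> [n|]; first by rewrite /p iterS; case/andP: (nextP (iter n next 0%N)).
exact/incn_inj/leq_mono/(homo_ltn ltn_trans pS).
Qed.

(** [e] is the sign of the admissible integers, and the family is indexed by the signed primes. *)
Lemma squarefree_family (T : Type) (P : T -> Prop) (E : T -> T -> Prop) (F : int -> T) (e : int) :
  e = 1 \/ e = -1 ->
  (forall d, squarefreez d -> 0 < d * e -> P (F d)) ->
  (forall d d', squarefreez d -> 0 < d * e -> squarefreez d' -> 0 < d' * e ->
    E (F d) (F d') -> d = d') ->
  infinitely_many_classes P E.
Proof.
move=> eE PF EF; have [p [pp pinj]] := increasing_primes.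
have sq n : squarefreez ((p n)%:Z * e).
  have := prime_squarefreez (pp n).
  by case: eE => -> sp; rewrite ?mulr1// mulrN1; exact: squarefreezN.
have pos n : 0 < (p n)%:Z * e * e.
  rewrite -mulrA; have -> : e * e = 1 by case: eE => ->.
  by rewrite mulr1 ltz_nat prime_gt0.
exists (fun n => F ((p n)%:Z * e)); split=> [n|n k Enk]; first exact: PF.
have e0 : e != 0 by case: eE => ->.
by apply: pinj; have := EF _ _ (sq n) (pos n) (sq k) (pos k) Enk; move/(mulIf e0) => [].
Qed.

(** * The two Lie groups *)

Section Conclusions.
Variable R : realType.

(** The model with j = i, eps = -1 and [c] the identity; the sign condition reads del < 0, and d =
    -del. *)
Lemma complex_lattices :
  infinitely_many_classes (fun Gamma : groupClosed (heis R[i]) => lattice Gamma)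
    (fun Gamma Delta => commensurable (subgroup_of Gamma) (subgroup_of Delta)) /\
  forall Gamma : groupClosed (heis R[i]), lattice Gamma ->
    exists d : int, [/\ squarefreez d, 0 < d &
      exists Delta : groupClosed (heis R[i]),
        commensurability_class Gamma Delta /\
        group_iso (subgroup_of Delta) (heis (quad_ring (- d)))].
Proof.
pose C : numFieldType := R[i].
pose r : {rmorphism R -> R[i]} := real_complex R.
have jj : 'i * 'i = r (-1) :> R[i] by rewrite -expr2 sqr_i rmorphN1.
have eps0 : (-1 : R) != 0 by rewrite oppr_eq0 oner_eq0.
have reim (x : R[i]) : x = r (complex.Re x) + r (complex.Im x) * 'i.
  by rewrite {1}[x]complexE mulrC.
have reE a b : complex.Re (r a + r b * 'i) = a by rewrite /=; ring.
have imE a b : complex.Im (r a + r b * 'i) = b by rewrite /=; ring.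
pose c (g : heis R[i]) := g.
pose F (v : 'rV[R]_6) : heis R[i] := hmk (r (v 0 0) + r (v 0 1) * 'i)
   (r (v 0 (inord 2)) + r (v 0 (inord 3)) * 'i) (r (v 0 (inord 4)) + r (v 0 (inord 5)) * 'i).
have cM : {morph c : x y / (x * y)%g} by [].
have c_inj : injective c by [].
have cF v : c (F v) = hmk (r (v 0 0) + r (v 0 1) * 'i)
   (r (v 0 (inord 2)) + r (v 0 (inord 3)) * 'i) (r (v 0 (inord 4)) + r (v 0 (inord 5)) * 'i).
  by [].
have lin (i k : 'I_6) : continuous (fun v : 'rV[R]_6 => (r (v 0 i) + r (v 0 k) * 'i) : C).
  have rc (l : 'I_6) : continuous (fun v : 'rV[R]_6 => r (v 0 l) : C).
    move=> v; apply: (@continuous_comp _ _ _ (fun v : 'rV[R]_6 => v 0 l) (fun x => r x : C)).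
      exact: coord_continuous.
    exact: real_complex_continuous.
  exact: (@affine_continuous C _ _ _ ('i : C) (rc i) (rc k)).
have F_continuous : continuous F by apply: (@heis_continuous C); exact: lin.
have coords u : u = complex.Re (R := R) \/ u = complex.Im (R := R) ->
    [/\ continuous (fun g : heis R[i] => u (hx (c g))),
      continuous (fun g : heis R[i] => u (hy (c g))) &
      continuous (fun g : heis R[i] => u (hz (c g)))].
  move=> uE; have uc : continuous (fun z : C => u z).
    by case: uE => ->; [exact: Re_continuous|exact: Im_continuous].
  split=> g.
  - by apply: (@continuous_comp _ C _ (fun g => hx g) (fun z => u z)); [exact: (@hx_continuous C)|exact: uc].
  - by apply: (@continuous_comp _ C _ (fun g => hy g) (fun z => u z)); [exact: (@hy_continuous C)|exact: uc].
  - by apply: (@continuous_comp _ C _ (fun g => hz g) (fun z => u z)); [exact: (@hz_continuous C)|exact: uc].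
have sgn (d : int) : (0 < d%:~R * -1 :> R) = (0 < d * -1).
  by rewrite !mulrN1 -rmorphN /= ltr0z.
split.
  have [Lam [LamP LamE]] := root_lattices jj eps0 reim reE imE cM c_inj cF F_continuous coords.
  apply: (@squarefree_family _ _ _ Lam (-1)); first by right.
    by move=> d sd d0; apply: LamP; rewrite ?sgn.
  by move=> d d' sd d0 sd' d0'; apply: LamE; rewrite ?sgn.
move=> Gamma latG.
have [del [s [[sdel dele ss ims] com]]] :=
  lattice_commensurable_model jj eps0 reim reE imE cM c_inj cF F_continuous coords latG.
rewrite sgn mulrN1 in dele.
have del1 : del <> 1 by move=> e; rewrite e in dele.
have [Delta [latD isoD Dout Din]] := quadratic_order_lattice jj reim reE imE cM c_inj cF
  F_continuous coords sdel del1 ss ims.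
exists (- del); split=> //; first exact: squarefreezN.
exists Delta; rewrite opprK; split=> //; split=> //.
by apply: com Dout Din; rewrite muln_gt0 /= absz_gt0 squarefreez_neq0.
Qed.


Definition diag (a : R) : (R * R)%type := (a, a).

Fact diag_is_zmod_morphism : zmod_morphism diag.
Proof. by []. Qed.
Fact diag_is_monoid_morphism : monoid_morphism diag.
Proof. by []. Qed.
HB.instance Definition _ := GRing.isZmodMorphism.Build R (R * R)%type diag diag_is_zmod_morphism.
HB.instance Definition _ := GRing.isMonoidMorphism.Build R (R * R)%type diag diag_is_monoid_morphism.

(** The model with j = (1, -1) and eps = 1, where [c] identifies H_1(R) x H_1(R) with H_1(R x R).
    The sign condition reads del > 0; the value del = 1 is the split case. *)
Lemma split_lattices :
  infinitely_many_classes (fun Gamma : groupClosed (heis R * heis R)%type => lattice Gamma)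
    (fun Gamma Delta => commensurable (subgroup_of Gamma) (subgroup_of Delta)) /\
  forall Gamma : groupClosed (heis R * heis R)%type, lattice Gamma ->
    (exists d : int, [/\ squarefreez d, d < -1 &
      exists Delta : groupClosed (heis R * heis R)%type,
        commensurability_class Gamma Delta /\
        group_iso (subgroup_of Delta) (heis (quad_ring (- d)))])
    \/
    (exists Delta : groupClosed (heis R * heis R)%type,
       commensurability_class Gamma Delta /\
       group_iso (subgroup_of Delta) (heis int * heis int)%type).
Proof.
pose r : {rmorphism R -> (R * R)%type} := diag.
pose j : (R * R)%type := (1, -1).
pose re (x : (R * R)%type) : R := (x.1 + x.2) / 2.
pose im (x : (R * R)%type) : R := (x.1 - x.2) / 2.
have jj : j * j = r 1 by congr pair; rewrite /=; ring.
have eps0 : (1 : R) != 0 by rewrite oner_eq0.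
have reim (x : (R * R)%type) : x = r (re x) + r (im x) * j.
  by case: x => a b; congr pair; rewrite /re /im /=; field.
have reE a b : re (r a + r b * j) = a by rewrite /re /=; field.
have imE a b : im (r a + r b * j) = b by rewrite /im /=; field.
pose G := (heis R * heis R)%type.
pose c (g : G) : heis (R * R)%type := hmk (hx g.1, hx g.2) (hy g.1, hy g.2) (hz g.1, hz g.2).
pose F (v : 'rV[R]_6) : G :=
  (hmk (v 0 0 + v 0 1 * 1) (v 0 (inord 2) + v 0 (inord 3) * 1) (v 0 (inord 4) + v 0 (inord 5) * 1),
   hmk (v 0 0 + v 0 1 * -1) (v 0 (inord 2) + v 0 (inord 3) * -1) (v 0 (inord 4) + v 0 (inord 5) * -1)).
have cM : {morph c : x y / (x * y)%g}.
  by move=> x y; rewrite /c hmkM /= !hE.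
have c_inj : injective c.
  move=> [g g'] [h h'] E; have := congr1 (@hx _) E; have := congr1 (@hy _) E; have := congr1 (@hz _) E.
  by rewrite /c !hE /= => -[z1 z2] [y1 y2] [x1 x2]; congr pair; apply: heis_ext.
have cF v : c (F v) = hmk (r (v 0 0) + r (v 0 1) * j)
   (r (v 0 (inord 2)) + r (v 0 (inord 3)) * j) (r (v 0 (inord 4)) + r (v 0 (inord 5)) * j).
  by rewrite /c /F /= !hE.
have lin (i k : 'I_6) (a : R) : continuous (fun v : 'rV[R]_6 => v 0 i + v 0 k * a).
  exact: (@affine_continuous R _ _ _ a (@coord_continuous R 1 6 0 i) (@coord_continuous R 1 6 0 k)).
have F_continuous : continuous F.
  have F1c := heis_continuous (lin 0 1 1) (lin (inord 2) (inord 3) 1) (lin (inord 4) (inord 5) 1).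
  have F2c := heis_continuous (lin 0 1 (-1)) (lin (inord 2) (inord 3) (-1))
    (lin (inord 4) (inord 5) (-1)).
  by move=> v; exact: (cvg_pair (F1c v) (F2c v)).
have coords u : u = re \/ u = im ->
    [/\ continuous (fun g : G => u (hx (c g))),
      continuous (fun g : G => u (hy (c g))) & continuous (fun g : G => u (hz (c g)))].
  move=> uE; have [a uaE] : exists a, forall x y, u (x, y) = (x + y * a) / 2.
    by case: uE => ->; [exists 1|exists (-1)] => x y; rewrite /re /im /= ?mulr1 ?mulrN1.
  have uc (h : heis R -> R) : continuous h ->
      continuous (fun g : G => (h g.1 + h g.2 * a) / 2).
    move=> hc g; apply: cvgM; last exact: cvg_cst.
    apply: (@affine_continuous R G (fun g => h g.1) (fun g => h g.2)) => {}g.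
    - by apply: (@continuous_comp _ _ _ fst h); [exact: cvg_fst|exact: hc].
    - by apply: (@continuous_comp _ _ _ snd h); [exact: cvg_snd|exact: hc].
  split.
  - rewrite (_ : (fun g => _) = (fun g : G => (hx g.1 + hx g.2 * a) / 2)).
      exact: (uc _ (@hx_continuous R)).
    by apply/funext => g; rewrite /c !hE uaE.
  - rewrite (_ : (fun g => _) = (fun g : G => (hy g.1 + hy g.2 * a) / 2)).
      exact: (uc _ (@hy_continuous R)).
    by apply/funext => g; rewrite /c !hE uaE.
  - rewrite (_ : (fun g => _) = (fun g : G => (hz g.1 + hz g.2 * a) / 2)).
      exact: (uc _ (@hz_continuous R)).
    by apply/funext => g; rewrite /c !hE uaE.
have sgn (d : int) : (0 < d%:~R * 1 :> R) = (0 < d * 1).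
  by rewrite !mulr1 ltr0z.
split.
  have [Lam [LamP LamE]] := root_lattices jj eps0 reim reE imE cM c_inj cF F_continuous coords.
  apply: (@squarefree_family _ _ _ Lam 1); first by left.
    by move=> d sd d0; apply: LamP; rewrite ?sgn.
  by move=> d d' sd d0 sd' d0'; apply: LamE; rewrite ?sgn.
move=> Gamma latG.
have [del [s [[sdel dele ss ims] com]]] :=
  lattice_commensurable_model jj eps0 reim reE imE cM c_inj cF F_continuous coords latG.
rewrite sgn mulr1 in dele.
have [del1|/eqP del1] := eqVneq del 1; last first.
  have [Delta [latD isoD Dout Din]] := quadratic_order_lattice jj reim reE imE cM c_inj cF
    F_continuous coords sdel del1 ss ims.
  left; exists (- del); split; first exact: squarefreezN.
    by rewrite ltrN2 lt_neqAle eq_sym (introN eqP del1) -gtz0_ge1.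
  exists Delta; rewrite opprK; split=> //; split=> //.
  by apply: com Dout Din; rewrite muln_gt0 /= absz_gt0 squarefreez_neq0.
right.
pose f (h : (heis int * heis int)%type) : G := (heis_map intr h.1, heis_map intr h.2).
have iD : {morph intr : x y / x + y >-> x + y :> R} by exact: rmorphD.
have iM : {morph intr : x y / x * y >-> x * y :> R} by exact: rmorphM.
have fM : {morph f : x y / (x * y)%g}.
  by move=> x y; rewrite /f /= !(heis_mapM iD iM).
have fI : injective f.
  move=> [x y] [x' y'] e; congr pair; apply: (heis_map_inj (@intr_inj R)).
    exact: (congr1 fst e).
  exact: (congr1 snd e).
(* The square roots of 1 in R x R are (1,1), (1,-1) and their opposites, and im s <> 0 leaves the
   second pair. *)
have sE : s = j \/ s = - j.
  move: ss ims; rewrite del1 {latG com}; case: s => a b [] /eqP; rewrite -expr2 sqrf_eq1.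
  move=> /orP[]/eqP-> /eqP; rewrite -expr2 sqrf_eq1 => /orP[]/eqP-> ims.
  - by move: ims; rewrite /im /= subrr mul0r eqxx.
  - by left.
  - by right; congr pair; rewrite opprK.
  - by move: ims; rewrite /im /= subrr mul0r eqxx.
have ii (n : int) : n%:~R = (n%:~R, n%:~R) :> (R * R)%type by rewrite -(rmorph_int r).
have nn (n : nat) : n%:R = (n%:R, n%:R) :> (R * R)%type by rewrite -(rmorph_nat r).
(* Z[s] consists of the integer pairs of equal parity, so it lies between 2(Z x Z) and Z x Z; hence
   [M = 2] below. *)
have zl (a b : int) : zlat s (2%:R * ((a%:~R, b%:~R) : (R * R)%type)).
  by case: sE => ->; [exists (a + b), (a - b)|exists (a + b), (b - a)];
    rewrite nn !ii; congr pair; rewrite /= !rmorphD !rmorphN /=; ring.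
have lz (x : (R * R)%type) : zlat s x -> exists mn : int * int, x = (mn.1%:~R, mn.2%:~R).
  move=> [a [b ->]]; case: sE => ->; [exists (a + b, a - b)|exists (a - b, a + b)];
    by rewrite !ii; congr pair; rewrite /= ?rmorphD ?rmorphN /=; ring.
pose P h := exists k, c (f k) = h.
have [c1 cV] := morph_gen cM; have [f1 fV] := morph_gen fM.
have [|||Delta [latD DE Dout Din]] := predicate_lattice jj reim reE imE cM c_inj cF
  F_continuous coords (P := P) (M := 2) ss ims isT.
- split; first by exists 1%g; rewrite f1 c1.
    by move=> _ _ [k <-] [l <-]; exists (k * l)%g; rewrite fM cM.
  by move=> _ [k <-]; exists k^-1%g; rewrite fV cV.
- by move=> _ [k <-]; split; rewrite /c /f /= /heis_map !hE; exact: zl.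
- move=> h [x [y [z [[/lz[xx xE] /lz[yy yE] /lz[zz zE]] [ex ey ez]]]]].
  exists (hmk xx.1 yy.1 zz.1, hmk xx.2 yy.2 zz.2).
  by apply: heis_ext; rewrite /c /f /= /heis_map !hE ?ex ?ey ?ez mul1r ?xE ?yE ?zE.
exists Delta; split; first by split=> //; exact: com Dout Din.
apply: (subgroup_iso_image fM fI).
- by move=> h; rewrite DE; apply/asboolP; exists h.
- by move=> g; rewrite DE => /asboolP[h /c_inj <-]; exists h.
Qed.

End Conclusions.

Local Close Scope quotient_scope.
Local Close Scope classical_set_scope.
Local Close Scope complex_scope.

Theorem theorem1 (R : realType) :
  ([/\ infinitely_many_classes
         (rational_structure (heis_lie (Rcomplex R) : lieAlgType R))
         (fun A B => lie_iso A B),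
       infinitely_many_classes
         (rational_structure (heis_lie R^o * heis_lie R^o : lieAlgType R)%type)
         (fun A B => lie_iso A B),
       forall d : int, squarefreez d -> 0 < d ->
         rational_structure (heis_lie (Rcomplex R) : lieAlgType R) (nd d),
       forall d : int, squarefreez d -> d < 0 ->
         rational_structure
           (heis_lie R^o * heis_lie R^o : lieAlgType R)%type (nd d)
     & forall d d' : int, squarefreez d -> squarefreez d' -> d <> d' ->
         ~ lie_iso (nd d) (nd d')]
   /\
   (infinitely_many_classes (fun Gamma : groupClosed (heis R[i]) => lattice Gamma)
      (fun Gamma Delta =>
         commensurable (subgroup_of Gamma) (subgroup_of Delta))
    /\
    infinitely_many_classes
      (fun Gamma : groupClosed (heis R * heis R)%type => lattice Gamma)
      (fun Gamma Delta =>
         commensurable (subgroup_of Gamma) (subgroup_of Delta))))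
  /\
  ((forall Gamma : groupClosed (heis R[i]), lattice Gamma ->
      exists d : int, [/\ squarefreez d, 0 < d &
        exists Delta : groupClosed (heis R[i]),
          commensurability_class Gamma Delta /\
          group_iso (subgroup_of Delta) (heis (quad_ring (- d)))])
   /\
   (forall Gamma : groupClosed (heis R * heis R)%type, lattice Gamma ->
      (exists d : int, [/\ squarefreez d, d < -1 &
        exists Delta : groupClosed (heis R * heis R)%type,
          commensurability_class Gamma Delta /\
          group_iso (subgroup_of Delta) (heis (quad_ring (- d)))])
      \/
      (exists Delta : groupClosed (heis R * heis R)%type,
         commensurability_class Gamma Delta /\
         group_iso (subgroup_of Delta) (heis int * heis int)%type))).
Proof.
have sgnC (d : int) : (0 < d * -1) = (d < 0) by rewrite mulrN1 oppr_gt0.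
split; [split; [split|split]|split].
- apply: (@squarefree_family _ _ _ (fun d => nd d : fdLieAlgType rat) 1); first by left.
    by move=> d _; rewrite mulr1; exact: nd_complex.
  move=> d d' sd _ sd' _ iso; apply: contrapT => dd'; exact: (nd_not_iso sd sd' dd' iso).
- apply: (@squarefree_family _ _ _ (fun d => nd d : fdLieAlgType rat) (-1)); first by right.
    by move=> d _; rewrite sgnC; exact: nd_split.
  move=> d d' sd _ sd' _ iso; apply: contrapT => dd'; exact: (nd_not_iso sd sd' dd' iso).
- by move=> d _; exact: nd_complex.
- by move=> d _; exact: nd_split.
- exact: nd_not_iso.
- exact: (complex_lattices R).1.
- exact: (split_lattices R).1.
- exact: (complex_lattices R).2.
- exact: (split_lattices R).2.
Qed.
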